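(* Let $\Omega$ be a Polish space, $c\in L^\infty(\Omega\times\Omega)$, and $P,Q$ Borel probability measures on $\Omega$. Let $$\hat\sigma^2_{n,m}=\frac{m}{n+m}\operatorname{Var}_{X\sim P_n}[f_{P_n,Q_m}(X)]+\frac{n}{n+m}\operatorname{Var}_{Y\sim Q_m}[g_{P_n,Q_m}(Y)],$$ $$\sigma_\lambda^2=\lambda\operatorname{Var}_{X\sim P}[f_{P,Q}(X)]+(1-\lambda)\operatorname{Var}_{Y\sim Q}[g_{P,Q}(Y)].$$ Then, as $n,m\to\infty$ with $\frac{m}{n+m}\to\lambda\in(0,1)$, $\hat\sigma^2_{n,m}\to\sigma^2_\lambda$ in probability. Consequently, if $\sigma^2_\lambda>0$, then $$\sqrt{\frac{nm}{n+m}}\;\frac{S(P_n,Q_m)-S(P,Q)}{\hat\sigma_{n,m}}\to\mathcal N(0,1)\quad\text{in distribution}.$$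
   Context: $L^\infty$ denotes bounded Borel-measurable functions. Put $C(x,y)=\exp(-c(x,y))$. For Borel probability measures $P,Q$ on $\Omega$, $S(P,Q)=\inf_{\pi\in\Pi(P,Q)}\int c\,d\pi+\mathrm{KL}(\pi\mid P\otimes Q)$, where $\Pi(P,Q)$ is the set of couplings and $\mathrm{KL}(\alpha\mid\beta)=\int\log\frac{d\alpha}{d\beta}d\alpha$ if $\alpha\ll\beta$, $+\infty$ otherwise. The potentials are the unique bounded measurable $f_{P,Q},g_{P,Q}:\Omega\to\mathbb R$ with, everywhere on $\Omega$, $f_{P,Q}=-\log\int C(\cdot,y)e^{g_{P,Q}(y)}dQ(y)$, $g_{P,Q}=-\log\int C(x,\cdot)e^{f_{P,Q}(x)}dP(x)$, and $\int g_{P,Q}\,dQ=0$; the same definition applies to $(P_n,Q_m)$. Samples: $X_1,\dots,X_n$ i.i.d. $\sim P$ and $Y_1,\dots,Y_m$ i.i.d. $\sim Q$ are mutually independent, $P_n=\frac1n\sum_i\delta_{X_i}$, $Q_m=\frac1m\sum_j\delta_{Y_j}$. The variances $\operatorname{Var}_{X\sim P_n}$, $\operatorname{Var}_{Y\sim Q_m}$ are taken with respect to the (random) empirical measures. $\hat\sigma_{n,m}$ is the nonnegative square root of $\hat\sigma_{n,m}^2$. *)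

(* Defs.v *)
From HB Require Import structures.
From mathcomp Require Import all_boot all_order all_algebra.
From mathcomp Require Import all_classical all_reals all_analysis.

Set Implicit Arguments.
Unset Strict Implicit.
Unset Printing Implicit Defensive.

Import Order.TTheory GRing.Theory Num.Theory.
Import numFieldNormedType.Exports.

Local Open Scope classical_set_scope.
Local Open Scope ring_scope.

Section polish.
Variables (R : realType) (T : topologicalType).

Definition is_metric (dist : T -> T -> R) : Prop :=
  [/\ forall x y, dist x y = 0 <-> x = y,
      forall x y, dist x y = dist y x &
      forall x y z, dist x z <= dist x y + dist y z].

Definition metrizes (dist : T -> T -> R) : Prop :=
  forall x : T,
    nbhs x = filter_from [set e : R | 0 < e] (fun e => [set y | dist x y < e]).

Definition complete_metric (dist : T -> T -> R) : Prop :=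
  forall u : nat -> T,
    (forall e, 0 < e -> exists N : nat, forall i j,
       (N <= i)%N -> (N <= j)%N -> dist (u i) (u j) < e) ->
    exists l : T, u @ \oo --> l.

Definition polish_space : Prop :=
  (exists dist : T -> T -> R,
     [/\ is_metric dist, metrizes dist & complete_metric dist]) /\
  (exists2 D : set T, countable D & dense D).

End polish.

Definition borel (T : ptopologicalType) : measurableType (@open T).-sigma :=
  g_sigma_algebraType (@open T).

(* [borel T * borel T] carries the product sigma-algebra. Since a Polish space
   is second countable, it is the Borel sigma-algebra of the product topology,
   so Borel functions and Borel measures on T * T can be read off from it. *)
Lemma measurable_borel_prod (R : realType) (T : ptopologicalType) :
  polish_space R T ->
  (@measurable _ (borel T * borel T)%type : set (set (T * T))) =
  <<s @open (T * T)%type >>.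
Proof.
move=> [[dist [[d0 dC dtri] metr _]] [D cD denD]].
pose B (p : T * nat) : set T := [set y | dist p.1 y < p.2.+1%:R^-1].
have nbhsd (x : T) (e : R) : 0 < e -> nbhs x [set y | dist x y < e].
  by move=> e0; rewrite metr; exists e.
have oB p : open (B p).
  rewrite openE => y /= By; rewrite /interior metr.
  exists (p.2.+1%:R^-1 - dist p.1 y); first by rewrite /= subr_gt0.
  move=> z /=; rewrite ltrBrDl => h.
  exact: le_lt_trans (dtri _ y _) h.
have small (x : T) (U : set T) : nbhs x U ->
    exists a k, [/\ D a, B (a, k) x & B (a, k) `<=` U].
  rewrite metr => -[e /= e0 eU].
  have e20 : 0 < e / 2 by rewrite divr_gt0.
  have [k kP] : exists k : nat, k.+1%:R^-1 < e / 2.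
    have /cvgrPdist_lt/(_ _ e20) := @cvg_harmonic R.
    case=> N _ /(_ N (leqnn N)) /=.
    by rewrite sub0r normrN ger0_norm ?invr_ge0// => h; exists N.
  have [] := denD (B (x, k)).
  - by exists x; rewrite /B /= (d0 x x).2.
  - exact: oB.
  move=> a [Bxa Da]; exists a, k; split => //; first by rewrite /B /= dC.
  move=> z; rewrite /B /= => az; apply: eU => /=.
  rewrite (le_lt_trans (dtri x a z))// (splitr e) ltrD//.
    exact: lt_trans Bxa kP.
  exact: lt_trans az kP.
rewrite measurable_prod_measurableType eqEsubset; split.
  apply: smallest_sub; first exact: smallest_sigma_algebra.
  move=> _ [A mA] [A' mA'] <-.
  have H1 : <<s @open (T * T)%type >> (fst @^-1` A : set (T * T)).
    have -> : (fst @^-1` A : set (T * T)) = setT `&` fst @^-1` A by rewrite setTI.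
    have H : @measurable_fun _ _ (g_sigma_algebraType (@open (T * T)%type))
       (borel T) setT fst.
      apply: (@measurability _ _ (g_sigma_algebraType (@open (T * T)%type))
        (borel T) setT fst (@open T) (erefl _)) => _ [U oU <-].
      rewrite setTI; apply: sub_sigma_algebra.
      by apply: open_comp => // -[x y] _; exact: cvg_fst.
    exact: (H measurableT _ mA).
  have H2 : <<s @open (T * T)%type >> (snd @^-1` A' : set (T * T)).
    have -> : (snd @^-1` A' : set (T * T)) = setT `&` snd @^-1` A'
      by rewrite setTI.
    have H : @measurable_fun _ _ (g_sigma_algebraType (@open (T * T)%type))
       (borel T) setT snd.
      apply: (@measurability _ _ (g_sigma_algebraType (@open (T * T)%type))
        (borel T) setT snd (@open T) (erefl _)) => _ [U oU <-].
      rewrite setTI; apply: sub_sigma_algebra.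
      by apply: open_comp => // -[x y] _; exact: cvg_snd.
    exact: (H measurableT _ mA').
  exact: (@measurableI _ (g_sigma_algebraType (@open (T * T)%type)) _ _ H1 H2).
apply: smallest_sub; first exact: smallest_sigma_algebra.
move=> U oU.
pose I : set ((T * nat) * (T * nat)) :=
  [set i | [/\ D i.1.1, D i.2.1 & B i.1 `*` B i.2 `<=` U]].
have cI : countable I.
  apply: (@sub_countable _ _ _ ((D `*` [set: nat]) `*` (D `*` [set: nat]))).
    by apply: subset_card_le => -[[a k] [a' k']] [].
  by do ?apply: countableX.
have -> : U = \bigcup_(i in I) (B i.1 `*` B i.2).
  rewrite eqEsubset; split; last by move=> z [i [_ _]] + ?; apply.
  move=> [x y] Uxy.
  have : nbhs (x, y) U by exact: open_nbhs_nbhs.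
  case=> -[V W] /= [nV nW] VWU.
  have [a [k [Da ax aV]]] := small _ _ nV.
  have [b [l [Db bx bW]]] := small _ _ nW.
  exists ((a, k), (b, l)) => //; split => //= z [z1 z2].
  by apply: VWU; split; [apply: aV | apply: bW].
rewrite -measurable_prod_measurableType bigcup_set_type.
apply: (@countable_bigcupT_measurable _ (borel T * borel T)%type).
  by rewrite (eq_countable (card_setT _)).
by move=> i; apply: measurableX; apply: sub_sigma_algebra; exact: oB.
Qed.

Section product_probability.
Local Open Scope ereal_scope.
Context d (T : measurableType d) (R : realType) (P Q : probability T R).

Definition product_probability : set (T * T) -> \bar R := P \x Q.

HB.instance Definition _ := Measure.on product_probability.

Let product_probability_setT : product_probability setT = 1.
Proof.
rewrite /product_probability -setXTT product_measure1E//.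
by rewrite /= (probability_setT P) (probability_setT Q) mule1.
Qed.

HB.instance Definition _ := Measure_isProbability.Build _ _ _
  product_probability product_probability_setT.

End product_probability.

Section entropic_transport.
Local Open Scope ereal_scope.
Context d (T : measurableType d) (R : realType).
Implicit Types (c : T * T -> R) (P Q : probability T R).

Definition coupling P Q : set (probability (T * T)%type R) :=
  [set pi | forall A, measurable A ->
     pi (A `*` setT) = P A /\ pi (setT `*` A) = Q A].

(* The chosen Radon-Nikodym derivative may take values [<= 0], where [lne] is
   [-oo], but only on an [alpha]-null set. *)
Definition KL d' (U : measurableType d') (alpha beta : probability U R) :
    \bar R :=
  if `[< alpha `<< beta >]
  then \int[alpha]_z
         lne (Radon_Nikodym (charge_of_finite_measure alpha) beta z)
  else +oo.

Definition entropic_cost c P Q : \bar R :=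
  ereal_inf [set \int[pi]_z (c z)%:E + KL pi (product_probability P Q)
            | pi in coupling P Q].

End entropic_transport.

Section potentials.
Context d (T : measurableType d) (R : realType).
Implicit Types (c : T * T -> R) (P Q : probability T R).

Definition is_potentials c P Q (fg : (T -> R) * (T -> R)) : Prop :=
  let C x y := expR (- c (x, y)) in
  let: (f, g) := fg in
  [/\ measurable_fun setT f /\ bounded_fun f,
      measurable_fun setT g /\ bounded_fun g,
      forall x, f x = - ln (\int[Q]_y (C x y * expR (g y))),
      forall y, g y = - ln (\int[P]_x (C x y * expR (f x))) &
      \int[Q]_y g y = 0].

(* For bounded measurable [c] exactly one pair satisfies [is_potentials]; the
   default value of [xget] is irrelevant. *)
Definition potentials c P Q : (T -> R) * (T -> R) :=
  xget (cst 0, cst 0) [set fg | is_potentials c P Q fg].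

Definition potential_f c P Q : T -> R := (potentials c P Q).1.

Definition potential_g c P Q : T -> R := (potentials c P Q).2.

Definition variance_f c P Q : R := fine 'V_P[potential_f c P Q].

Definition variance_g c P Q : R := fine 'V_Q[potential_g c P Q].

Definition sigma2 c P Q (lambda : R) : R :=
  lambda * variance_f c P Q + (1 - lambda) * variance_g c P Q.

End potentials.

Section empirical.
Context d (T : measurableType d) (R : realType).

(* Only the points [x 0], ..., [x n.-1] are used. The proof of [0 < n] is what
   makes it a probability measure. *)
Definition empirical (n : nat) (n_gt0 : (0 < n)%N) (x : nat -> T) :
    set T -> \bar R :=
  mscale (n%:R^-1)%:nng (msum (fun i => \d_(x i)) n).

Variables (n : nat) (n_gt0 : (0 < n)%N) (x : nat -> T).

HB.instance Definition _ := Measure.on (empirical n_gt0 x).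

Let empirical_setT : empirical n_gt0 x setT = 1%E.
Proof.
rewrite /empirical /mscale /=.
have -> : msum (fun i => \d_(x i)) n [set: T] = (n%:R : R)%:E.
  rewrite /msum (eq_bigr (fun=> 1%:E)) => [|i _]; last exact: diracT.
  by rewrite sumEFin sumr_const card_ord.
by rewrite -EFinM mulVf// pnatr_eq0 -lt0n.
Qed.

HB.instance Definition _ :=
  Measure_isProbability.Build _ _ _ (empirical n_gt0 x) empirical_setT.

End empirical.

Arguments empirical {d T R n}.

Definition empirical_sigma2 d (T : measurableType d) (R : realType)
    (c : T * T -> R) (n m : nat) (n_gt0 : (0 < n)%N) (m_gt0 : (0 < m)%N)
    (x y : nat -> T) : R :=
  let Pn : probability T R := empirical n_gt0 x in
  let Qm : probability T R := empirical m_gt0 y in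
  m%:R / (n + m)%:R * variance_f c Pn Qm +
  n%:R / (n + m)%:R * variance_g c Pn Qm.

Section stochastic_convergence.
Context d (W : measurableType d) (R : realType) (Pr : probability W R).

Definition mutually_independent (I : eqType) d' (T : measurableType d')
    (Z : I -> W -> T) : Prop :=
  forall (s : seq I) (A : I -> set T), uniq s ->
    (forall i, measurable (A i)) ->
    Pr (\bigcap_(i in [set` s]) (Z i @^-1` A i)) =
    (\prod_(i <- s) Pr (Z i @^-1` A i))%E.

Definition has_law d' (T : measurableType d') (X : W -> T)
    (P : probability T R) : Prop :=
  measurable_fun setT X /\
  forall A, measurable A -> Pr (X @^-1` A) = P A.

(* Both modes of convergence include the assertion that the [Z k] are random
   variables: measures have unspecified values on non-measurable sets. *)
Definition cvg_in_probability (Z : nat -> W -> R) (l : R) : Prop :=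
  (forall k, measurable_fun setT (Z k)) /\
  forall e, 0 < e -> Pr [set w | e <= `|Z k w - l|] @[k --> \oo] --> 0%E.

Definition cvg_in_distribution (Z : nat -> W -> R)
    (mu : probability (measurableTypeR R) R) : Prop :=
  (forall k, measurable_fun setT (Z k)) /\
  forall h : R -> R, continuous h -> bounded_fun h ->
    (\int[Pr]_w h (Z k w)) @[k --> \oo] --> \int[mu]_x h x.

End stochastic_convergence.

(* Main.v *)
(* Write xi = exp (f + g - c) for the Gibbs density of the population
   potentials. The dual objective
     int f dP + int g dQ - int int exp (f + g - c) dP dQ
   is strongly concave on bounded potentials, up to constants. Comparing its
   values at the population and at the empirical potentials, for the measures
   P_n and Q_m, gives
     S(P_n, Q_m) = int f dP_n + int g dQ_m + (mean of 1 - xi) + O(Delta),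
   while f_{P_n, Q_m} - f and g_{P_n, Q_m} - g are O(Delta^(1/2)) in L^2(P_n) and
   L^2(Q_m) modulo constants; here Delta is the sum of the squared L^2 norms of
   the marginal defects of xi under P_n and Q_m. Both marginals of 1 - xi under
   P and Q vanish, so by independence E Delta = O(1/n + 1/m) and the mean of
   1 - xi has second moment O(1/(nm)). This gives the consistency of the
   variance estimator, and reduces the limit theorem to a sum of n + m
   independent centered bounded variables, which Lindeberg's replacement
   argument handles. The potentials are limits of Sinkhorn iterates, which
   contract the oscillation; the same iterates show that the statistics are
   measurable. *)

Require Import Defs.
From HB Require Import structures.
From mathcomp Require Import all_boot all_order all_algebra.
From mathcomp Require Import all_classical all_reals all_analysis.
From mathcomp Require Import measurable_realfun ring lra.

Set Implicit Arguments.
Unset Strict Implicit.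
Unset Printing Implicit Defensive.

Import Order.TTheory GRing.Theory Num.Theory.
Import numFieldNormedType.Exports.

Local Open Scope classical_set_scope.
Local Open Scope ring_scope.

(** * Bounded measurable functions *)

(** Normalized potentials are bounded by [3 * M] for every pair of measures, with [M] a bound of the
    cost. Hence the modulus of concavity depends on [M] alone, and one deterministic inequality
    applies to every realization of P_n and Q_m; randomness enters only through second moments of
    averages of fixed functions: 1 - xi, f, g and the squares of f and g. The dual objective does
    not see the shift (f + s, g - s), so potentials can be compared only modulo constants. This is
    harmless: variances ignore the shift, and in the cost the two shifts cancel. With rate = 1/n +
    1/m, the scaling factor is rate^(-1/2). It turns Delta, of order rate, into rate^(1/2). The mean
    of 1 - xi would in general survive this scaling if only one marginal of 1 - xi vanished; that
    both vanish makes it a degenerate double average, with second moment of order rate^2. *)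

Section bounded_measurable.
Context d (T : measurableType d) (R : realType).
Implicit Types f g : T -> R.

(** An explicit bound is easier to compute with than the filter form of [bounded_fun]; closure under
    pointwise operations then settles integrability for every probability measure. *)
Definition bm f := measurable_fun setT f /\ exists B, forall x, `|f x| <= B.

Lemma bm_bounded_fun f : measurable_fun setT f -> bounded_fun f -> bm f.
Proof.
move=> mf [M [_ /(_ (M + 1))]]; rewrite ltrDl ltr01 => /(_ erefl) h.
by split => //; exists (M + 1) => x; exact: h.
Qed.

Lemma bounded_fun_bm f : bm f -> bounded_fun f.
Proof.
move=> [_ [B fB]]; exists B; split; first exact: num_real.
by move=> M BM x _; exact: le_trans (fB x) (ltW BM).
Qed.

Lemma bm_cst r : bm (fun=> r).
Proof. by split; [exact: measurable_cst|exists `|r|]. Qed.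

Lemma bmD f g : bm f -> bm g -> bm (fun x => f x + g x).
Proof.
move=> [mf [B fB]] [mg [C gC]]; split; first exact: measurable_funD.
by exists (B + C) => x; rewrite (le_trans (ler_normD _ _))// lerD.
Qed.

Lemma bmN f : bm f -> bm (fun x => - f x).
Proof.
move=> [mf [B fB]]; split; first exact: measurableT_comp.
by exists B => x; rewrite normrN.
Qed.

Lemma bmB f g : bm f -> bm g -> bm (fun x => f x - g x).
Proof. by move=> bf bg; apply: bmD => //; exact: bmN. Qed.

Lemma bmM f g : bm f -> bm g -> bm (fun x => f x * g x).
Proof.
move=> [mf [B fB]] [mg [C gC]]; split; first exact: measurable_funM.
by exists (B * C) => x; rewrite normrM ler_pM.
Qed.

Lemma bmX f n : bm f -> bm (fun x => f x ^+ n).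
Proof.
move=> bf; elim: n => [|n IH].
  by under eq_fun do rewrite expr0; exact: bm_cst.
by under eq_fun do rewrite exprS; exact: bmM.
Qed.

Lemma bm_norm f : bm f -> bm (fun x => `|f x|).
Proof.
move=> [mf [B fB]]; split; first exact: measurableT_comp.
by exists B => x; rewrite normr_id.
Qed.

Lemma bm_sum (I : Type) (s : seq I) (F : I -> T -> R) :
  (forall i, bm (F i)) -> bm (fun x => \sum_(i <- s) F i x).
Proof.
move=> bF; elim: s => [|i s IH].
  by under eq_fun do rewrite big_nil; exact: bm_cst.
by under eq_fun do rewrite big_cons; exact: bmD.
Qed.

Lemma bm_expR f : bm f -> bm (fun x => expR (f x)).
Proof.
move=> [mf [B fB]]; split; first exact: measurableT_comp.
exists (expR B) => x; rewrite ger0_norm ?expR_ge0// ler_expR.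
exact: le_trans (ler_norm _) (fB x).
Qed.

Lemma bm_ln f (a : R) : 0 < a -> (forall x, a <= f x) -> bm f ->
  bm (fun x => ln (f x)).
Proof.
move=> a0 af [mf [B fB]]; split.
  by apply: measurableT_comp => //; exact: measurable_ln.
exists (`|ln a| + `|ln B|) => x.
have fx0 : 0 < f x by exact: lt_le_trans (af x).
have fxB : f x <= B by exact: le_trans (ler_norm _) (fB x).
have B0 : 0 < B by exact: lt_le_trans fxB.
have h1 : ln a <= ln (f x) by rewrite ler_ln.
have h2 : ln (f x) <= ln B by rewrite ler_ln.
rewrite ler_norml; apply/andP; split.
  apply: le_trans h1; rewrite lerNl.
  by rewrite (le_trans (ler_norm _))// normrN lerDl.
by apply: (le_trans h2); rewrite (le_trans (ler_norm _))// lerDr.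
Qed.

End bounded_measurable.

Lemma bm_comp d d' (T : measurableType d) (T' : measurableType d')
  (R : realType) (f : T -> R) (phi : T' -> T) :
  bm f -> measurable_fun setT phi -> bm (fun x => f (phi x)).
Proof.
move=> [mf [B fB]] mphi; split; first exact: measurableT_comp.
by exists B.
Qed.

Section bounded_integral.
Context d (T : measurableType d) (R : realType) (P : probability T R).
Implicit Types f g : T -> R.

Lemma bm_integrable f : bm f -> P.-integrable setT (EFin \o f).
Proof.
move=> bf; apply: measurable_bounded_integrable => //.
- by rewrite (le_lt_trans (probability_le1 _ _))// ltry.
- by case: bf.
- exact: bounded_fun_bm.
Qed.

Lemma RintegralT_cst r : \int[P]_x r = r.
Proof. by rewrite Rintegral_cst//= probability_setT mulr1. Qed.

Lemma bm_RintegralD f g : bm f -> bm g ->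
  \int[P]_x (f x + g x) = \int[P]_x f x + \int[P]_x g x.
Proof. by move=> bf bg; rewrite RintegralD//; exact: bm_integrable. Qed.

Lemma bm_RintegralB f g : bm f -> bm g ->
  \int[P]_x (f x - g x) = \int[P]_x f x - \int[P]_x g x.
Proof. by move=> bf bg; rewrite RintegralB//; exact: bm_integrable. Qed.

Lemma bm_RintegralZl r f : bm f -> \int[P]_x (r * f x) = r * \int[P]_x f x.
Proof. by move=> bf; rewrite RintegralZl//; exact: bm_integrable. Qed.

Lemma bm_RintegralZr r f : bm f -> \int[P]_x (f x * r) = \int[P]_x f x * r.
Proof. by move=> bf; rewrite RintegralZr//; exact: bm_integrable. Qed.

Lemma bm_Rintegral_sum (I : Type) (s : seq I) (F : I -> T -> R) :
  (forall i, bm (F i)) ->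
  \int[P]_x (\sum_(i <- s) F i x) = \sum_(i <- s) \int[P]_x F i x.
Proof.
move=> bF; elim: s => [|i s IH].
  by rewrite big_nil; under eq_Rintegral do rewrite big_nil; exact: RintegralT_cst.
rewrite big_cons -IH -bm_RintegralD//; last exact: bm_sum.
by under eq_Rintegral do rewrite big_cons.
Qed.

Lemma bm_le_Rintegral f g : bm f -> bm g -> (forall x, f x <= g x) ->
  \int[P]_x f x <= \int[P]_x g x.
Proof.
by move=> bf bg fg; apply: le_Rintegral => //; exact: bm_integrable.
Qed.

Lemma bm_Rintegral_le f r : bm f -> (forall x, f x <= r) -> \int[P]_x f x <= r.
Proof.
move=> bf fr; rewrite -[leRHS]RintegralT_cst.
by apply: bm_le_Rintegral => //; exact: bm_cst.
Qed.

Lemma bm_le_Rintegral_cst f r :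
  bm f -> (forall x, r <= f x) -> r <= \int[P]_x f x.
Proof.
move=> bf fr; rewrite -[leLHS]RintegralT_cst.
by apply: bm_le_Rintegral => //; exact: bm_cst.
Qed.

Lemma bm_norm_Rintegral_le f r : bm f -> (forall x, `|f x| <= r) ->
  `|\int[P]_x f x| <= r.
Proof.
move=> bf fr; rewrite ler_norml; apply/andP; split.
  by apply: bm_le_Rintegral_cst => // x; move: (fr x); rewrite ler_norml => /andP[].
by apply: bm_Rintegral_le => // x; exact: le_trans (ler_norm _) (fr x).
Qed.

Lemma bm_EFin_Rintegral f : bm f ->
  (\int[P]_x f x)%:E = (\int[P]_x (f x)%:E)%E.
Proof.
move=> bf; rewrite /Rintegral fineK//.
by apply: integrable_fin_num => //; exact: bm_integrable.
Qed.

Lemma bm_indic (A : set T) : measurable A -> bm (\1_A : T -> R).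
Proof.
move=> mA; split; first exact: measurable_indic.
by exists 1 => x; rewrite indicE; case: (_ \in _); rewrite ?normr0 ?normr1.
Qed.

Lemma Rintegral_indic (A : set T) : measurable A ->
  \int[P]_x \1_A x = fine (P A).
Proof. by move=> mA; rewrite /Rintegral integral_indic// setIT. Qed.

Lemma measurable_ge_set f (e : R) : measurable_fun setT f ->
  measurable [set x | e <= f x].
Proof.
move=> mf; rewrite -[X in measurable X]setTI.
rewrite (_ : [set x | e <= f x] = f @^-1` `[e, +oo[%classic); first exact: mf.
by apply/seteqP; split => x /=; rewrite in_itv/= andbT.
Qed.

Lemma bm_markov f (e : R) : bm f -> (forall x, 0 <= f x) -> 0 < e ->
  (P [set x | (e <= f x)%R] <= (\int[P]_x f x / e)%:E)%E.
Proof.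
move=> bf f0 e0.
have mA : measurable [set x | e <= f x] by apply: measurable_ge_set; case: bf.
rewrite -[leLHS]fineK ?fin_num_measure// lee_fin -Rintegral_indic//.
rewrite ler_pdivlMr// -bm_RintegralZr; last exact: bm_indic.
apply: bm_le_Rintegral => //.
  by apply: bmM; [exact: bm_indic|exact: bm_cst].
move=> x; rewrite indicE; have [|_] := boolP (x \in _).
  by rewrite inE mul1r.
by rewrite mul0r.
Qed.

End bounded_integral.

Section bounded_sections.
Context d1 d2 (T1 : measurableType d1) (T2 : measurableType d2) (R : realType).
Variable F : T1 * T2 -> R.
Hypothesis bF : bm F.

Lemma bm_pair1 x : bm (fun y => F (x, y)).
Proof. exact: (bm_comp bF (measurable_pair1 x)). Qed.

Lemma bm_pair2 y : bm (fun x => F (x, y)).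
Proof. exact: (bm_comp bF (measurable_pair2 y)). Qed.

Lemma bm_Rintegral1 (P2 : probability T2 R) : bm (fun x => \int[P2]_y F (x, y)).
Proof.
have [mF [B FB]] := bF; split; last first.
  by exists B => x; apply: bm_norm_Rintegral_le => //; exact: bm_pair1.
(* Shifted by its bound, [F] is nonnegative, and Tonelli gives the measurability. *)
have -> : (fun x => \int[P2]_y F (x, y)) =
    (fun x => \int[P2]_y (F (x, y) + B) - B).
  apply/funext => x; rewrite bm_RintegralD; [|exact: bm_pair1|exact: bm_cst].
  by rewrite RintegralT_cst addrK.
apply: measurable_funB => //; apply: measurableT_comp => //.
apply: (measurable_fun_fubini_tonelli_F (fun z => (F z + B)%:E)).
- by apply/measurable_EFinP; exact: measurable_funD.
- by move=> z; rewrite lee_fin -lerBlDr sub0r; move: (FB z); rewrite ler_norml => /andP[].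
Qed.

End bounded_sections.

Lemma bm_swap d1 d2 (T1 : measurableType d1) (T2 : measurableType d2)
  (R : realType) (F : T1 * T2 -> R) : bm F -> bm (fun p => F (p.2, p.1)).
Proof. by move=> bF; exact: (bm_comp bF (@measurable_swap _ _ T2 T1)). Qed.

Lemma bm_Rintegral2 d1 d2 (T1 : measurableType d1) (T2 : measurableType d2)
    (R : realType) (F : T1 * T2 -> R) (P1 : probability T1 R) :
  bm F -> bm (fun y => \int[P1]_x F (x, y)).
Proof. by move=> /bm_swap/bm_Rintegral1; exact. Qed.

Section bounded_Fubini.
Context d1 d2 (T1 : measurableType d1) (T2 : measurableType d2) (R : realType).
Context (P1 : probability T1 R) (P2 : probability T2 R).
Variable F : T1 * T2 -> R.
Hypothesis bF : bm F.

Let iF : (P1 \x P2)%E.-integrable setT (EFin \o F).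
Proof.
have mF : measurable_fun setT (EFin \o F) by apply/measurable_EFinP; case: bF.
apply/(integrable12ltyP _ _ mF).
under eq_integral => x _.
  rewrite -(bm_EFin_Rintegral _ (bm_norm (bm_pair1 bF x))).
  over.
rewrite -bm_EFin_Rintegral ?ltry//.
exact: (bm_Rintegral1 (bm_norm bF)).
Qed.

Lemma bm_Fubini :
  \int[P1]_x \int[P2]_y F (x, y) = \int[P2]_y \int[P1]_x F (x, y).
Proof.
have := Fubini iF.
rewrite (eq_integral (fun x => (\int[P2]_y F (x, y))%:E)); last first.
  by move=> x _; rewrite -bm_EFin_Rintegral//; exact: bm_pair1.
rewrite [in RHS](eq_integral (fun y => (\int[P1]_x F (x, y))%:E)); last first.
  by move=> x _; rewrite -bm_EFin_Rintegral//; exact: bm_pair2.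
by rewrite -!bm_EFin_Rintegral; [move=> []|exact: bm_Rintegral2|exact: bm_Rintegral1].
Qed.

Lemma bm_Fubini_prod :
  (\int[P1]_x \int[P2]_y F (x, y))%:E = (\int[P1 \x P2]_z (F z)%:E)%E.
Proof.
rewrite -(integral12_prod_meas1 iF) bm_EFin_Rintegral; last exact: bm_Rintegral1.
by apply: eq_integral => x _; rewrite bm_EFin_Rintegral//; exact: bm_pair1.
Qed.

End bounded_Fubini.

(** * Independence *)

Section independence.
Context d (W : measurableType d) (R : realType) (Pr : probability W R).
Context (I : eqType) d' (T : measurableType d') (Z : I -> W -> T).
Hypothesis mZ : forall i, measurable_fun setT (Z i).
Hypothesis iZ : mutually_independent Pr Z.

(** The pi-system of rectangles in the coordinates of [s]. Functions of these coordinates are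
    handled as functions on [W] itself, measurable for the coarser sigma-algebra that it
    generates. *)
Definition cylinder (s : seq I) : set (set W) :=
  [set B | exists2 A : I -> set T, (forall k, measurable (A k)) &
    B = \bigcap_(k in [set` s]) (Z k @^-1` A k)].

Lemma cylinder_measurable s : cylinder s `<=` measurable.
Proof.
move=> _ [A mA ->]; apply: fin_bigcap_measurable => [|k _]; first exact: finite_seq.
by rewrite -[X in measurable X]setTI; exact: mZ.
Qed.

Lemma setI_closed_cylinder s : setI_closed (cylinder s).
Proof.
move=> _ _ [A mA ->] [B mB ->]; exists (fun k => A k `&` B k).
  by move=> k; exact: measurableI.
by rewrite -bigcapI.
Qed.

Lemma cylinderT s : cylinder s setT.
Proof.
by exists (fun=> setT) => //; apply/seteqP; split.
Qed.

Lemma sigma_cylinder_measurable s B : <<s cylinder s >> B -> measurable B.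
Proof.
by apply: smallest_sub; [exact: sigma_algebra_measurable|exact: cylinder_measurable].
Qed.

(** As functions of [B], both sides are finite measures; mutual independence makes them agree on the
    pi-system, hence on the sigma-algebra it generates. *)
Lemma cylinder_indep (s : seq I) i (B : set W) (A : set T) :
  uniq s -> i \notin s -> <<s cylinder s >> B -> measurable A ->
  Pr (B `&` (Z i @^-1` A)) = (Pr B * Pr (Z i @^-1` A))%E.
Proof.
move=> us nis sB mA.
have mZA : measurable (Z i @^-1` A) by rewrite -[X in measurable X]setTI; exact: mZ.
have fin : Pr (Z i @^-1` A) \is a fin_num by rewrite fin_num_measure.
have pge0 : 0 <= fine (Pr (Z i @^-1` A)) by rewrite fine_ge0.
suff : mrestr Pr mZA B = mscale (NngNum pge0) Pr B.
  by rewrite /mrestr/mscale/= => ->; rewrite fineK// muleC.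
apply: (@g_sigma_algebra_measure_unique _ _ _ (cylinder s) (@cylinder_measurable s)
   (fun=> setT)) => //.
- by move=> _; exact: cylinderT.
- exact: bigcup_const.
- exact: setI_closed_cylinder.
- move=> C [A' mA' CE].
  change (Pr (C `&` (Z i @^-1` A)) = ((fine (Pr (Z i @^-1` A)))%:E * Pr C)%E).
  rewrite fineK//.
  (* One rectangle over [i :: s] carries both events; since [i] is not in [s], its factors over [s]
     are those of [C]. *)
  pose D k := if k == i then A else A' k.
  have mD k : measurable (D k) by rewrite /D; case: ifP.
  have DE k : k \in s -> D k = A' k.
    by rewrite /D; case: eqP => // ->; rewrite (negbTE nis).
  have := iZ (s := i :: s) (A := D); rewrite cons_uniq nis us => /(_ erefl mD).
  have -> : [set` i :: s] = i |` [set` s].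
    by apply/seteqP; split=> k /=; rewrite inE => /predU1P.
  rewrite big_cons bigcap_setU1.
  have -> : D i = A by rewrite /D eqxx.
  rewrite setIC.
  have -> : \bigcap_(k in [set` s]) (Z k @^-1` D k) = C.
    by rewrite CE; apply: eq_bigcapr => k ks; rewrite DE.
  move=> ->; congr (_ * _)%E.
  have := iZ (s := s) (A := A') us mA'; rewrite -CE => ->.
  by rewrite big_seq [RHS]big_seq; apply: eq_bigr => k ks; rewrite DE.
- move=> _; change (Pr (setT `&` (Z i @^-1` A)) < +oo)%E.
  by rewrite setTI (le_lt_trans (probability_le1 _ _))// ltry.
Qed.

Lemma measurable_cylinder (s : seq I) i : i \in s ->
  measurable_fun setT (Z i : g_sigma_algebraType (cylinder s) -> T).
Proof.
move=> si _ A mA; rewrite setTI; apply: sub_sigma_algebra.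
exists (fun k => if k == i then A else setT); first by move=> k; case: ifP.
apply/seteqP; split=> [w /= wA k /= ks|w /(_ i si)]; last by rewrite /= eqxx.
by case: eqP => [->//|].
Qed.

(** Freezing: the map from w to (w, Z i w), with the coarser sigma-algebra on the first factor, has
    a product law, so Fubini integrates [Z i] out while the other variables stay fixed. *)
Lemma indep_Rintegral (s : seq I) i (P : probability T R)
    (F : g_sigma_algebraType (cylinder s) * T -> R) :
  uniq s -> i \notin s -> has_law Pr (Z i) P -> bm F ->
  \int[Pr]_w F (w, Z i w) = \int[Pr]_w \int[P]_z F (w, z).
Proof.
move=> us nis [_ law] bF.
pose S := g_sigma_algebraType (cylinder s).
have mid : measurable_fun setT (id : W -> S).
  by move=> _ A mA; rewrite setTI preimage_id; exact: (sigma_cylinder_measurable (s := s) mA).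
pose PrS : probability S R := distribution Pr (mfun_Sub (mem_set mid)).
have mV : measurable_fun setT (fun w => (w, Z i w) : S * T).
  by apply: measurable_fun_pair => //; exact: mZ.
pose V := mfun_Sub (mem_set mV).
have uni X : measurable X -> (PrS \x P)%E X = distribution Pr V X.
  apply: product_measure_unique => A B mA mB.
  transitivity (Pr A * Pr (Z i @^-1` B))%E; last by congr (_ * _)%E; exact: law.
  exact: (cylinder_indep us nis mA mB).
have iF : Pr.-integrable setT (EFin \o (fun w => F (w, Z i w))).
  by apply: bm_integrable; exact: (bm_comp bF mV).
have mF : measurable_fun setT F by case: bF.
have bFW : @bm _ W R (fun w => \int[P]_z F (w, z)).
  exact: (bm_comp (bm_Rintegral1 bF P) mid).
apply: EFin_inj.
have -> : (\int[Pr]_w F (w, Z i w))%:E = (\int[distribution Pr V]_p (F p)%:E)%E.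
  rewrite bm_EFin_Rintegral; last exact: (bm_comp bF mV).
  rewrite integral_distribution//.
  exact/measurable_EFinP.
rewrite (eq_measure_integral (PrS \x P)%E); last first.
  by move=> A mA _; apply/esym; exact: uni.
rewrite -bm_Fubini_prod// bm_EFin_Rintegral; last exact: bm_Rintegral1.
rewrite integral_distribution//.
- by rewrite bm_EFin_Rintegral.
- by apply/measurable_EFinP; case: (bm_Rintegral1 bF P).
- exact: (bm_integrable _ bFW).
Qed.

End independence.

(** * Moments of the standard normal law *)

Section density.
Context d (T : measurableType d) (R : realType).
Variables (mu : {sigma_finite_measure set T -> \bar R})
  (nu : {finite_measure set T -> \bar R}) (rho : T -> R).
Hypotheses (mrho : measurable_fun setT rho) (rho0 : forall x, 0 <= rho x).
Hypothesis nuE :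
  forall A, measurable A -> nu A = (\int[mu]_(x in A) (rho x)%:E)%E.
Local Open Scope ereal_scope.

Lemma density_dominates : nu `<< mu.
Proof.
apply/null_content_dominatesP => A mA muA.
rewrite nuE//; apply: null_set_integral => //.
by apply/measurable_EFinP; exact: measurable_funTS.
Qed.

Let mrhoE : measurable_fun setT (EFin \o rho).
Proof. exact/measurable_EFinP. Qed.

Lemma ge0_density_integral (f : T -> \bar R) : measurable_fun setT f ->
  (forall x, 0 <= f x) -> \int[nu]_x f x = \int[mu]_x (f x * (rho x)%:E).
Proof.
move=> mf f0.
have dom := density_dominates.
rewrite -(Radon_Nikodym_SigmaFinite.change_of_variables dom)//.
apply: ae_eq_integral => //.
- apply: emeasurable_funM => //.
  exact: measurable_int (Radon_Nikodym_SigmaFinite.f_integrable dom).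
- exact: emeasurable_funM.
- apply: ae_eqe_mul2l.
  apply: integral_ae_eq => //.
  + exact: Radon_Nikodym_SigmaFinite.f_integrable.
  + by move=> A _ mA; rewrite -Radon_Nikodym_SigmaFinite.f_integral// nuE.
Qed.

End density.

Lemma measurable_idR (R : realType) :
  @measurable_fun _ _ (measurableTypeR R) R setT idfun.
Proof. by move=> _ A mA; rewrite setTI. Qed.

(* [normal_prob] lives on [measurableTypeR R], whose display is not the one of
   the canonical measurable structure of [R]. *)
Definition std_normal (R : realType) : probability R R :=
  distribution (normal_prob 0 1)
    (@mfun_Sub _ _ (measurableTypeR R) R idfun (mem_set (@measurable_idR R))).

Lemma Rintegral_std_normal (R : realType) (h : R -> R) : bm h ->
  \int[normal_prob 0 1]_x h x = \int[std_normal R]_x h x.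
Proof.
move=> [mh bh]; congr fine; rewrite integral_distribution//.
  exact/measurable_EFinP.
apply: (@bm_integrable _ (measurableTypeR R)); split => //.
Qed.

Section gaussian.
Variable R : realType.
Local Notation mu := (@lebesgue_measure R).
Local Notation N := (std_normal R).
Implicit Types (m s t x y z : R).

Lemma normal_pdf_gt0E m s x : 0 < s -> normal_pdf m s x =
  (Num.sqrt (pi *+ 2))^-1 * s^-1 * expR (- ((x - m) ^+ 2 / (2 * s ^+ 2))).
Proof.
move=> s0; rewrite normal_pdfE ?gt_eqF// /normal_peak /normal_fun.
rewrite -mulrnAr sqrtrM ?sqr_ge0// sqrtr_sqr gtr0_norm// mulNr mulr_natl invfM.
by rewrite [_^-1 * s^-1]mulrC.
Qed.

(** Completing the square: the joint density of z and w = s y + t z is the marginal of w times the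
    conditional law of z given w. *)
Lemma normal_pdf_conv s t w z : 0 < s ->
  normal_pdf (t * z) s w * normal_pdf 0 1 z =
  normal_pdf 0 (Num.sqrt (s ^+ 2 + t ^+ 2)) w *
  normal_pdf (w * t / (s ^+ 2 + t ^+ 2)) (s / Num.sqrt (s ^+ 2 + t ^+ 2)) z.
Proof.
move=> s0.
have st0 : 0 < s ^+ 2 + t ^+ 2 by rewrite ltr_pwDl ?sqr_ge0// exprn_gt0.
set q := Num.sqrt _.
have q0 : 0 < q by rewrite sqrtr_gt0.
have qE : q ^+ 2 = s ^+ 2 + t ^+ 2 by rewrite sqr_sqrtr// ltW.
rewrite !normal_pdf_gt0E ?divr_gt0//; set k := _^-1.
rewrite mulrACA [RHS]mulrACA -!expRD; congr (_ * expR _).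
  by field; rewrite !gt_eqF.
rewrite expr_div_n qE; field.
by rewrite !gt_eqF.
Qed.

Lemma normal_pdf_scale m s z : 0 < s ->
  normal_pdf m s (s * z + m) * s = normal_pdf 0 1 z.
Proof.
move=> s0; rewrite !normal_pdf_gt0E// invr1 mulr1 mulrAC; congr (_ * expR _).
  by rewrite divfK// gt_eqF.
by rewrite addrK; field; rewrite gt_eqF.
Qed.

Lemma integral_std_normal (f : R -> \bar R) : measurable_fun setT f ->
  (forall x, 0 <= f x)%E ->
  (\int[N]_x f x = \int[mu]_x (f x * (normal_pdf 0 1 x)%:E))%E.
Proof.
move=> mf f0; rewrite ge0_integral_distribution//.
apply: (@ge0_density_integral _ _ _ mu (normal_prob 0 1)) => //.
exact: measurable_normal_pdf.
Qed.

Lemma integral_normal_scale m s (h : R -> R) : 0 < s -> continuous h ->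
  (forall x, 0 <= h x) ->
  (\int[N]_z (h (s * z + m))%:E = \int[mu]_x (h x * normal_pdf m s x)%:E)%E.
Proof.
move=> s0 ch h0; pose F z : R := s * z + m.
have F' : F^`()%classic = cst s.
  apply/funext => z; rewrite /F derive1E deriveD// deriveM//= derive_id !derive_cst.
  by rewrite addr0 scaler0 addr0 /GRing.scale/= mulr1.
rewrite (@increasing_ge0_integration_by_substitutionT _ F).
- rewrite integral_std_normal//; last 2 first.
  + apply/measurable_EFinP; apply: measurableT_comp.
      exact: continuous_measurable_fun.
    by apply: measurable_funD => //; exact: measurable_funM.
  + by move=> x; rewrite lee_fin.
  apply: eq_integral => z _.
  rewrite F' /= -EFinM -(normal_pdf_scale m z s0); congr (_%:E).
  by rewrite !fctE /= mulrA.
- by move=> x y xy; rewrite /F ltrD2r ltr_pM2l.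
- by rewrite F' => ?; exact: cvg_cst.
- by rewrite F'; exact: is_cvg_cst.
- by rewrite F'; exact: is_cvg_cst.
- by move=> x; rewrite /F.
- rewrite /F; apply: (cvg_comp (fun z => s * z) (fun z => z + m)); last exact: cvg_addrr_Ny.
  exact: (gt0_cvgMrNy s0 (@cvg_id _ _)).
- rewrite /F; apply: (cvg_comp (fun z => s * z) (fun z => z + m)); last exact: cvg_addrr.
  exact: (gt0_cvgMry s0 (@cvg_id _ _)).
- move=> x; apply: cvgM; first exact: ch.
  by apply: continuous_normal_pdf; rewrite gt_eqF.
- by move=> x; rewrite mulr_ge0// normal_pdf_ge0.
Qed.

(** After Tonelli, the conditional law of z given the sum integrates to 1 and only the marginal of
    the sum remains. *)
Lemma normal_convolution_ge0 s t (h : R -> R) : 0 < s -> continuous h ->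
  (forall x, 0 <= h x) -> bm h ->
  (\int[N]_z \int[N]_y (h (s * y + t * z))%:E =
   \int[N]_z (h (Num.sqrt (s ^+ 2 + t ^+ 2) * z))%:E)%E.
Proof.
move=> s0 ch h0 bh; set q := Num.sqrt _.
have q0 : 0 < q by rewrite sqrtr_gt0 ltr_pwDl ?sqr_ge0// exprn_gt0.
under eq_integral do rewrite integral_normal_scale//.
have mh : measurable_fun setT h by case: bh.
have mG : measurable_fun setT (fun p : R * R => h p.2 * normal_pdf (t * p.1) s p.2).
  apply: measurable_funM; first exact: measurableT_comp.
  under eq_fun do rewrite normal_pdf_gt0E//.
  apply: measurable_funM => //; apply: measurableT_comp => //.
  apply: measurableT_comp => //; apply: measurable_funM => //.
  apply: measurable_funX; apply: measurable_funB => //.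
  exact: measurable_funM.
have G0 (p : R * R) : 0 <= h p.2 * normal_pdf (t * p.1) s p.2.
  by rewrite mulr_ge0// normal_pdf_ge0.
rewrite [LHS]integral_std_normal//; last 2 first.
- have := @measurable_fun_fubini_tonelli_F _ _ (measurableTypeR R) (measurableTypeR R) R mu
     (fun p : R * R => (h p.2 * normal_pdf (t * p.1) s p.2)%:E).
  apply.
    exact/measurable_EFinP.
  by move=> p; rewrite lee_fin.
- by move=> z; apply: integral_ge0 => x _; rewrite lee_fin; exact: (G0 (z, x)).
transitivity (\int[mu]_z \int[mu]_x
    (h x * normal_pdf 0 q x *
    normal_pdf (x * t / (s ^+ 2 + t ^+ 2)) (s / q) z)%:E)%E.
  apply: eq_integral => z _; rewrite -ge0_integralZr//.
  - apply: eq_integral => x _.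
    by rewrite -EFinM -[in LHS]mulrA normal_pdf_conv// mulrA.
  - apply/measurable_EFinP; apply: measurable_funM => //.
    exact: measurable_normal_pdf.
  - by move=> x _; rewrite lee_fin; exact: (G0 (z, x)).
  - by rewrite lee_fin normal_pdf_ge0.
rewrite (@fubini_tonelli _ _ (measurableTypeR R) (measurableTypeR R) R mu mu
  (fun p => (h p.2 * normal_pdf 0 q p.2 *
    normal_pdf (p.2 * t / (s ^+ 2 + t ^+ 2)) (s / q) p.1)%:E))//=; last 2 first.
- apply/measurable_EFinP; apply: measurable_funM.
    apply: measurable_funM; first exact: measurableT_comp.
    by apply: measurableT_comp => //; exact: measurable_normal_pdf.
  under eq_fun do rewrite normal_pdf_gt0E ?divr_gt0//.
  apply: measurable_funM => //; apply: measurableT_comp => //.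
  apply: measurableT_comp => //; apply: measurable_funM => //.
  apply: measurable_funX; apply: measurable_funB => //.
  by apply: measurable_funM => //; exact: measurable_funM.
- by move=> p; rewrite lee_fin !mulr_ge0// normal_pdf_ge0.
have -> : (\int[N]_z (h (q * z))%:E = \int[N]_z (h (q * z + 0))%:E)%E.
  by under [RHS]eq_integral do rewrite addr0.
rewrite integral_normal_scale//.
apply: eq_integral => x _.
under eq_integral do rewrite EFinM.
rewrite ge0_integralZl//.
- by rewrite integral_normal_pdf mule1.
- by apply/measurable_EFinP; exact: measurable_normal_pdf.
- by move=> z _; rewrite lee_fin normal_pdf_ge0.
- by rewrite lee_fin mulr_ge0// normal_pdf_ge0.
Qed.

Lemma normal_convolution s t (h : R -> R) : 0 < s -> continuous h -> bm h ->
  \int[N]_z \int[N]_y h (s * y + t * z) =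
  \int[N]_z h (Num.sqrt (s ^+ 2 + t ^+ 2) * z).
Proof.
move=> s0 ch bh; have [mh [B hB]] := bh.
pose k x := h x + B.
have k0 x : 0 <= k x.
  by rewrite -lerBlDr sub0r; move: (hB x); rewrite ler_norml => /andP[].
have bk : bm k by apply: bmD => //; exact: bm_cst.
have ck : continuous k by move=> x; apply: cvgD; [exact: ch|exact: cvg_cst].
have baff (f : R -> R) u v : bm f -> bm (fun x : R => f (u * x + v)).
  move=> bf; apply: (bm_comp bf).
  by apply: measurable_funD => //; exact: measurable_funM.
have b2 (f : R -> R) : bm f -> bm (fun p : R * R => f (s * p.2 + t * p.1)).
  move=> bf; apply: (bm_comp bf).
  by apply: measurable_funD => //; exact: measurable_funM.
have bscale (f : R -> R) u : bm f -> bm (fun x : R => f (u * x)).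
  by move=> bf; apply: (bm_comp bf); exact: measurable_funM.
have := normal_convolution_ge0 t s0 ck k0 bk.
rewrite (eq_integral (fun z => (\int[N]_y h (s * y + t * z) + B)%:E)); last first.
  move=> z _; rewrite -bm_EFin_Rintegral; last exact: baff.
  congr (_%:E); rewrite bm_RintegralD ?RintegralT_cst//; first exact: baff.
  exact: bm_cst.
have b2h := bm_Rintegral1 (b2 _ bh) N.
rewrite -bm_EFin_Rintegral; last exact: bscale.
rewrite -bm_EFin_Rintegral; last by apply: bmD => //; exact: bm_cst.
rewrite bm_RintegralD//; last exact: bm_cst.
rewrite bm_RintegralD; [|exact: bscale|exact: bm_cst].
by rewrite !RintegralT_cst => -[] /addIr.
Qed.

(* The density of N(m, s^2) with respect to N(0, 1): its total mass 1, for
   all m and s, determines the moments of N(0, 1). *)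
Let ratio m s z := s^-1 * expR (z ^+ 2 / 2 - (z - m) ^+ 2 / (2 * s ^+ 2)).

Let measurable_ratio m s : measurable_fun setT (ratio m s).
Proof.
apply: measurable_funM => //; apply: measurableT_comp => //.
apply: measurable_funB; first exact: measurable_funM.
by apply: measurable_funM => //; apply: measurable_funX; exact: measurable_funB.
Qed.

Let integral_ratio m s : 0 < s -> (\int[N]_z (ratio m s z)%:E)%E = 1%E.
Proof.
move=> s0; rewrite integral_std_normal; last 2 first.
- exact/measurable_EFinP.
- by move=> x; rewrite lee_fin mulr_ge0 ?expR_ge0// invr_ge0 ltW.
rewrite -(integral_normal_pdf m s); apply: eq_integral => z _.
rewrite -EFinM !normal_pdf_gt0E// /ratio; congr (_%:E).
rewrite invr1 mulr1 subr0 expr1n mulr1 mulrACA -expRD [_^-1 * _]mulrC.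
by rewrite addrAC subrr add0r.
Qed.

Let integrable_ratio m s : 0 < s -> N.-integrable setT (EFin \o ratio m s).
Proof.
move=> s0; apply/integrableP; split; first exact/measurable_EFinP.
under eq_integral.
  move=> z _; rewrite /= ger0_norm ?mulr_ge0 ?expR_ge0 ?invr_ge0 ?(ltW s0)//; over.
by rewrite integral_ratio// ltry.
Qed.

Let Rintegral_ratio m s : 0 < s -> \int[N]_z ratio m s z = 1.
Proof. by move=> s0; rewrite /Rintegral integral_ratio. Qed.

(** Here z^2/4 is the exponent of [ratio 0 (Num.sqrt 2)], which has a finite integral; squaring 1 +
    z^2/8 <= exp(z^2/8) makes it dominate z^4. *)
Let expR_quad z : 1 + z ^+ 2 / 4 + z ^+ 4 / 64 <= expR (z ^+ 2 / 4).
Proof.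
have -> : z ^+ 2 / 4 = z ^+ 2 / 8 + z ^+ 2 / 8 by field.
rewrite expRD -expr2.
apply: (@le_trans _ _ ((1 + z ^+ 2 / 8) ^+ 2)).
  by rewrite le_eqVlt; apply/orP; left; apply/eqP; field.
by rewrite lerXn2r ?nnegrE ?expR_ge0 ?expR_ge1Dx// addr_ge0// divr_ge0// sqr_ge0.
Qed.

Lemma normal_integrable (f : R -> R) C : measurable_fun setT f ->
  (forall z, `|f z| <= C * (1 + z ^+ 2 + z ^+ 4)) ->
  N.-integrable setT (EFin \o f).
Proof.
move=> mf fC.
have s2 : 0 < Num.sqrt 2 :> R by rewrite sqrtr_gt0.
have C0 : 0 <= C.
  by have := le_trans (normr_ge0 _) (fC 0); rewrite !expr0n/= !addr0 mulr1.
apply: (@le_integrable _ _ _ _ _ _ _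
   (EFin \o (fun z => (C * 64 * Num.sqrt 2) * ratio 0 (Num.sqrt 2) z))) => //.
- exact/measurable_EFinP.
- move=> z _; rewrite /= lee_fin; apply: (le_trans (fC z)).
  apply: le_trans (ler_norm _).
  have -> : C * 64 * Num.sqrt 2 * ratio 0 (Num.sqrt 2) z =
      C * (64 * expR (z ^+ 2 / 4)).
    rewrite /ratio subr0 sqr_sqrtr// [LHS]mulrA mulfK ?gt_eqF//.
    by rewrite [RHS]mulrA; congr (_ * expR _); field.
  rewrite ler_wpM2l//.
  apply: (@le_trans _ _ (64 * (1 + z ^+ 2 / 4 + z ^+ 4 / 64))).
    have := sqr_ge0 z; lra.
  by rewrite ler_wpM2l.
- by have := integrableZl measurableT (C * 64 * Num.sqrt 2) (integrable_ratio 0 s2).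
Qed.

Lemma normal_integrableX1 : N.-integrable setT (EFin \o (fun z : R => z)).
Proof.
apply: (@normal_integrable _ 1) => // z; rewrite mul1r ler_norml.
have := sqr_ge0 (z - 1); have := sqr_ge0 (z + 1); have := sqr_ge0 (z ^+ 2).
by rewrite -exprM; nra.
Qed.

Lemma normal_integrableX2 : N.-integrable setT (EFin \o (fun z : R => z ^+ 2)).
Proof.
apply: (@normal_integrable _ 1) => // z; rewrite mul1r ger0_norm ?sqr_ge0//.
by have := sqr_ge0 (z ^+ 2); rewrite -exprM; lra.
Qed.

Lemma normal_integrableX3 :
  N.-integrable setT (EFin \o (fun z : R => `|z| ^+ 3)).
Proof.
apply: (@normal_integrable _ 1) => [|z].
  by apply: measurable_funX; exact: normr_measurable.
rewrite mul1r ger0_norm ?exprn_ge0//.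
have -> : z ^+ 2 = `|z| ^+ 2 by rewrite real_normK ?num_real.
have -> : z ^+ 4 = (`|z| ^+ 2) ^+ 2 by rewrite real_normK ?num_real// -exprM.
have := normr_ge0 z; set a := `|z| => a0.
have := sqr_ge0 (a ^+ 2 - a); have := sqr_ge0 a; nra.
Qed.

(** Since [ratio m 1 z] is exp(m z - m^2/2) and has mean 1, exp x >= 1 + x gives m M <= m^2/2 for
    all m; take m = M. *)
Lemma normal_mean : \int[N]_z z = 0.
Proof.
set M := \int[N]_z z.
have h m : m * M <= m ^+ 2 / 2.
  have ibm := integrableZl measurableT m normal_integrableX1.
  have ic : N.-integrable setT (EFin \o (fun z => 1 - m ^+ 2 / 2)).
    by apply: bm_integrable; exact: bm_cst.
  have : \int[N]_z (m * z + (1 - m ^+ 2 / 2)) <= \int[N]_z ratio m 1 z.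
    apply: le_Rintegral => //.
    - exact: (integrableD measurableT ibm ic).
    - exact: integrable_ratio.
    - move=> z _; rewrite /ratio invr1 mul1r.
      apply: le_trans (expR_ge1Dx _).
      by rewrite le_eqVlt; apply/orP; left; apply/eqP; field.
  rewrite Rintegral_ratio// RintegralD// RintegralT_cst RintegralZl//; last first.
    exact: normal_integrableX1.
  by rewrite -/M; lra.
have h1 := h M; have h2 := sqr_ge0 M.
have : M ^+ 2 <= 0 by move: h1 h2; rewrite expr2; lra.
by move=> M2; apply/eqP; rewrite -(sqrf_eq0 M) eq_le h2 M2.
Qed.

(** For s = 1/r the density ratio divided by r is exp(-(r^2 - 1) z^2/2), with mean 1/r. The bound
    exp x >= 1 + x on both sides of r = 1 squeezes the second moment to 1. *)
Lemma normal_variance : \int[N]_z z ^+ 2 = 1.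
Proof.
set M := \int[N]_z z ^+ 2.
have M0 : 0 <= M by apply: Rintegral_ge0 => z _; exact: sqr_ge0.
have h r : 0 < r -> 1 - (r ^+ 2 - 1) / 2 * M <= r^-1.
  move=> r0; have ri0 : 0 < r^-1 by rewrite invr_gt0.
  have iz2 := integrableZl measurableT (- ((r ^+ 2 - 1) / 2)) normal_integrableX2.
  have ic : N.-integrable setT (EFin \o (fun z : R => 1)).
    by apply: bm_integrable; exact: bm_cst.
  have : \int[N]_z (- ((r ^+ 2 - 1) / 2) * z ^+ 2 + 1) <=
         \int[N]_z (r^-1 * ratio 0 r^-1 z).
    apply: le_Rintegral => //.
    - exact: (integrableD measurableT iz2 ic).
    - by have := integrableZl measurableT r^-1 (integrable_ratio 0 ri0).
    - move=> z _; rewrite /ratio invrK mulKf ?gt_eqF// subr0.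
      apply: le_trans (expR_ge1Dx _).
      by rewrite le_eqVlt; apply/orP; left; apply/eqP; field; rewrite gt_eqF.
  rewrite RintegralZl//; last exact: integrable_ratio.
  rewrite Rintegral_ratio// mulr1 RintegralD// RintegralT_cst RintegralZl//; last first.
    exact: normal_integrableX2.
  by rewrite -/M; lra.
(* This is [h] at r = 1 + d, multiplied by 2 r. Near d = 0 the second factor is close to 2 M - 2, so
   the two signs of d exclude M > 1 and M < 1. *)
have h' d : -1 < d -> 0 <= d * ((1 + d) * (2 + d) * M - 2).
  move=> d1; have r0 : 0 < 1 + d by lra.
  have := h _ r0; rewrite -(ler_pM2r r0) mulVf ?gt_eqF//; nra.
apply/eqP; rewrite eq_le; apply/andP; split; rewrite leNgt; apply/negP => M1.
  have M20 : 0 < M by lra.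
  pose d := - (M - 1) / (2 * M).
  have dM : d * M = - (M - 1) / 2 by rewrite /d; field; rewrite gt_eqF.
  have d0 : d < 0 by rewrite /d mulNr oppr_lt0 divr_gt0 ?mulr_gt0// subr_gt0.
  have d1 : -1 < d by rewrite -(ltr_pM2r M20) dM; lra.
  have := h' d d1; rewrite leNgt => /negP; apply.
  rewrite nmulr_rlt0//.
  have -> : (1 + d) * (2 + d) * M = 2 * M + 3 * (d * M) + d ^+ 2 * M by ring.
  have := mulr_ge0 (sqr_ge0 d) M0; rewrite dM; lra.
pose d := (1 - M) / 4.
have d0 : 0 < d by rewrite /d; lra.
have d1 : -1 < d by lra.
have := h' d d1; rewrite pmulr_rge0// leNgt => /negP; apply.
rewrite /d; nra.
Qed.

Definition normal_abs_moment3 := \int[N]_z `|z| ^+ 3.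

Lemma normal_abs_moment3_ge0 : 0 <= normal_abs_moment3.
Proof. by apply: Rintegral_ge0 => z _; exact: exprn_ge0. Qed.

End gaussian.

(** * Lindeberg's replacement argument *)

Section lindeberg.
Variable R : realType.
Local Notation N := (std_normal R).
Implicit Types (h a b : R -> R) (K t x y z : R).

(** [a] and [b] stand for the first two derivatives, [K] for a sixth of a bound of the third. Only
    the Taylor inequality is recorded, since it passes directly under an integral over shifts. *)
Definition taylor3 h a b K := [/\ bm h, bm a, bm b &
  forall x y, `|h (x + y) - h x - y * a x - y ^+ 2 / 2 * b x| <= K * `|y| ^+ 3].

Definition normal_shift t h x := \int[N]_z h (x + t * z).

Lemma taylor3_ge0 h a b K : taylor3 h a b K -> 0 <= K.
Proof.
move=> [_ _ _ /(_ 0 1)]; rewrite normr1 !expr1n mulr1.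
exact: le_trans.
Qed.

Lemma taylor3_dist h a b K A B x y : taylor3 h a b K ->
  (forall x, `|a x| <= A) -> (forall x, `|b x| <= B) ->
  `|h (x + y) - h x| <= A * `|y| + B * `|y| ^+ 2 + K * `|y| ^+ 3.
Proof.
move=> [_ _ _ hT] aA bB.
have -> : h (x + y) - h x = y * a x + y ^+ 2 / 2 * b x +
  (h (x + y) - h x - y * a x - y ^+ 2 / 2 * b x) by ring.
apply: (le_trans (ler_normD _ _)); rewrite lerD//.
apply: (le_trans (ler_normD _ _)); apply: lerD.
  by rewrite normrM mulrC ler_wpM2r.
rewrite normrM mulrC normrM normrX ler_pM//.
by rewrite normfV ler_piMr ?sqr_ge0// invf_le1 ger0_norm// lerDl.
Qed.

Lemma taylor3_continuous h a b K : taylor3 h a b K -> continuous h.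
Proof.
move=> hT x; have K0 := taylor3_ge0 hT.
have [_ [_ [A aA]] [_ [B bB]] _] := hT.
have A0 : 0 <= A := le_trans (normr_ge0 _) (aA 0).
have B0 : 0 <= B := le_trans (normr_ge0 _) (bB 0).
have C0 : 0 < A + B + K + 1 by lra.
apply/cvgrPdist_le => e e0; near=> y.
rewrite distrC; have := taylor3_dist x (y - x) hT aA bB.
rewrite (addrC x) subrK => /le_trans; apply.
have y1 : `|y - x| <= 1.
  rewrite distrC; near: y.
  by have /cvgrPdist_le/(_ _ ltr01) := @cvg_id _ (nbhs x).
have ye : `|y - x| <= e / (A + B + K + 1).
  rewrite distrC; near: y.
  by have /cvgrPdist_le/(_ _ (divr_gt0 e0 C0)) := @cvg_id _ (nbhs x).
move: (normr_ge0 (y - x)) y1 ye; set u := `|y - x| => u0 u1.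
rewrite ler_pdivlMr// => ue; apply: le_trans ue.
have u2 : u ^+ 2 <= u by rewrite expr2 ler_piMr.
have u3 : u ^+ 3 <= u by rewrite exprS ler_piMr// exprn_ile1.
nra.
Unshelve. all: by end_near. Qed.

Let bm_shift t h : bm h -> bm (fun p : R * R => h (p.1 + t * p.2)).
Proof.
move=> bh; apply: (bm_comp bh).
by apply: measurable_funD => //; exact: measurable_funM.
Qed.

Let bm_shift1 t h x : bm h -> bm (fun z : R => h (x + t * z)).
Proof. by move=> bh; exact: (bm_pair1 (bm_shift t bh) x). Qed.

Lemma bm_normal_shift t h : bm h -> bm (normal_shift t h).
Proof. by move=> bh; exact: (bm_Rintegral1 (bm_shift t bh) N). Qed.

(** The constant [K] does not grow under Gaussian smoothing, so every replacement in the induction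
    is charged with the same constant. *)
Lemma taylor3_normal_shift t h a b K : taylor3 h a b K ->
  taylor3 (normal_shift t h) (normal_shift t a) (normal_shift t b) K.
Proof.
move=> [bh ba bb hT]; split; [exact: bm_normal_shift..|].
move=> x y.
have b1 := bm_shift1 t (x + y) bh; have b2 := bm_shift1 t x bh.
have b3 := bmM (bm_cst _ y) (bm_shift1 t x ba).
have b4 := bmM (bm_cst _ (y ^+ 2 / 2)) (bm_shift1 t x bb).
rewrite /normal_shift -bm_RintegralB// -bm_RintegralZl//; last exact: bm_shift1.
rewrite -bm_RintegralB//; last exact: bmB.
rewrite -bm_RintegralZl; last exact: bm_shift1.
rewrite -bm_RintegralB//; last by apply: bmB => //; exact: bmB.
apply: bm_norm_Rintegral_le => [|z].
  by apply: bmB => //; apply: bmB => //; exact: bmB.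
by rewrite (addrAC x); exact: hT.
Qed.

Lemma normal_shift_expansion t h a b K x : taylor3 h a b K ->
  `|normal_shift t h x - h x - t ^+ 2 / 2 * b x| <=
  K * `|t| ^+ 3 * normal_abs_moment3 R.
Proof.
move=> [bh ba bb hT].
have i1 : N.-integrable setT (EFin \o (fun z => h (x + t * z) - h x)).
  by apply: bm_integrable; apply: bmB; [exact: bm_shift1|exact: bm_cst].
have i2 : N.-integrable setT (EFin \o (fun z => (t * a x) * z)).
  by have := integrableZl measurableT (t * a x) (@normal_integrableX1 R).
have i3 : N.-integrable setT (EFin \o (fun z => (t ^+ 2 / 2 * b x) * z ^+ 2)).
  by have := integrableZl measurableT (t ^+ 2 / 2 * b x) (@normal_integrableX2 R).
have i12 : N.-integrable setT
    (EFin \o (fun z => h (x + t * z) - h x - (t * a x) * z)).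
  exact: (integrableB measurableT i1 i2).
have i123 : N.-integrable setT (EFin \o (fun z =>
    h (x + t * z) - h x - (t * a x) * z - (t ^+ 2 / 2 * b x) * z ^+ 2)).
  exact: (integrableB measurableT i12 i3).
have i4 : N.-integrable setT (EFin \o (fun z => K * `|t| ^+ 3 * `|z| ^+ 3)).
  by have := integrableZl measurableT (K * `|t| ^+ 3) (@normal_integrableX3 R).
have -> : normal_shift t h x - h x - t ^+ 2 / 2 * b x =
  \int[N]_z (h (x + t * z) - h x - (t * a x) * z - (t ^+ 2 / 2 * b x) * z ^+ 2).
  rewrite RintegralB// RintegralB// !RintegralZl//; last 2 first.
  - exact: normal_integrableX2.
  - exact: normal_integrableX1.
  rewrite normal_mean normal_variance mulr0 mulr1 subr0.
  by rewrite bm_RintegralB ?RintegralT_cst//; [exact: bm_shift1|exact: bm_cst].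
apply: (le_trans (le_normr_Rintegral measurableT i123)).
rewrite /normal_abs_moment3 -RintegralZl//; last exact: normal_integrableX3.
apply: le_Rintegral => //.
  by have := integrable_norm i123.
move=> z _; have := hT x (t * z).
rewrite [`|t * z|]normrM [(`|t| * _) ^+ 3]exprMn mulrA; apply: le_trans.
by rewrite le_eqVlt; apply/orP; left; apply/eqP; congr `|_|; ring.
Qed.

Lemma normal_shift_semigroup s t h x : continuous h -> bm h ->
  0 <= s -> 0 <= t -> normal_shift t (normal_shift s h) x =
  normal_shift (Num.sqrt (s ^+ 2 + t ^+ 2)) h x.
Proof.
(* The case s = 0 is separate: that Gaussian has no density, and the convolution formula requires
   [0 < s]. *)
move=> ch bh; rewrite le_eqVlt => /predU1P[<-|s0] t0.
  rewrite expr0n/= add0r sqrtr_sqr ger0_norm// /normal_shift.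
  by apply: eq_Rintegral => z _; under eq_Rintegral do rewrite mul0r addr0;
    rewrite RintegralT_cst.
rewrite /normal_shift -(@normal_convolution _ s t (fun y => h (x + y)))//.
- apply: eq_Rintegral => z _; apply: eq_Rintegral => y _.
  by rewrite addrAC addrA.
- move=> y; apply: continuous_comp; last exact: ch.
  by apply: cvgD; [exact: cvg_cst|exact: cvg_id].
- exact: (bm_comp bh (measurable_funD _ _)).
Qed.

Section sum.
Context d (W : measurableType d) (Pr : probability W R).

(** Around [S], the variable [zeta] and a centered Gaussian of variance [v] have the same expected
    expansion up to second order; each leaves a remainder of order [del ^+ 3]. *)
Lemma lindeberg_step h a b K (S zeta : W -> R) del v : taylor3 h a b K ->
  bm S -> bm zeta -> (forall w, `|zeta w| <= del) -> 0 <= v <= del ^+ 2 ->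
  \int[Pr]_w (zeta w * a (S w)) = 0 ->
  \int[Pr]_w (zeta w ^+ 2 * b (S w)) = v * \int[Pr]_w b (S w) ->
  `|\int[Pr]_w h (S w + zeta w) - \int[Pr]_w normal_shift (Num.sqrt v) h (S w)|
  <= K * (1 + normal_abs_moment3 R) * del ^+ 3.
Proof.
move=> hT bS bz zd /andP[v0 vd] Ea Eb.
have K0 := taylor3_ge0 hT.
have [bh ba bb hTT] := hT.
have mS : measurable_fun setT S by case: bS.
have bhS := bm_comp bh mS; have baS := bm_comp ba mS; have bbS := bm_comp bb mS.
have bhz : bm (fun w => h (S w + zeta w)).
  by apply: (bm_comp bh); apply: measurable_funD => //; case: bz.
have bGS := bm_comp (bm_normal_shift (Num.sqrt v) bh) mS.
have bza := bmM bz baS.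
have bzb : bm (fun w => zeta w ^+ 2 / 2 * b (S w)).
  by apply: bmM => //; apply: bmM; [exact: bmX|exact: bm_cst].
have d0 (w : W) : 0 <= del := le_trans (normr_ge0 _) (zd w).
have e1 : `|\int[Pr]_w (h (S w + zeta w) - h (S w) - zeta w * a (S w)
    - zeta w ^+ 2 / 2 * b (S w))| <= K * del ^+ 3.
  apply: bm_norm_Rintegral_le => [|w].
    by apply: bmB => //; apply: bmB => //; exact: bmB.
  by apply: le_trans (hTT _ _) _; rewrite ler_wpM2l// lerXn2r ?nnegrE// (d0 w).
have e2 : `|\int[Pr]_w (normal_shift (Num.sqrt v) h (S w) - h (S w)
    - v / 2 * b (S w))| <= K * del ^+ 3 * normal_abs_moment3 R.
  apply: bm_norm_Rintegral_le => [|w].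
    by apply: bmB; [exact: bmB|apply: bmM => //; exact: bm_cst].
  have := normal_shift_expansion (Num.sqrt v) (S w) hT.
  rewrite sqr_sqrtr// => /le_trans; apply.
  apply: ler_wpM2r; first exact: normal_abs_moment3_ge0.
  rewrite ler_wpM2l// lerXn2r ?nnegrE ?(d0 w)// ger0_norm ?sqrtr_ge0//.
  by rewrite -(ler_sqr (sqrtr_ge0 _) (d0 w)) sqr_sqrtr.
have b12 := bmB bhz bhS; have b123 := bmB b12 bza.
have bGh := bmB bGS bhS; have bvb := bmM (bm_cst _ (v / 2)) bbS.
move: e1; rewrite bm_RintegralB//.
rewrite bm_RintegralB// bm_RintegralB// Ea subr0.
have -> : \int[Pr]_w (zeta w ^+ 2 / 2 * b (S w)) = v / 2 * \int[Pr]_w b (S w).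
  rewrite mulrAC -Eb -bm_RintegralZr; last by apply: bmM => //; exact: bmX.
  by apply: eq_Rintegral => w _; rewrite mulrAC.
move: e2; rewrite bm_RintegralB//.
rewrite bm_RintegralB// bm_RintegralZl//.
move=> e2 e1; rewrite mulrDr mulr1 mulrDl.
rewrite -[X in `|X|](subrKA (\int[Pr]_w h (S w) + v / 2 * \int[Pr]_w b (S w))).
apply: (le_trans (ler_normD _ _)); apply: lerD.
  by rewrite opprD addrA.
by rewrite distrC opprD addrA (mulrAC K).
Qed.

(** The last summand is replaced first and the induction is applied to the smoothed function; the
    semigroup law merges the Gaussian parts. Independence enters only as two moment identities
    against functions of the partial sum. *)
Lemma lindeberg (zeta : nat -> W -> R) (v del : nat -> R) n :
  (forall i, (i < n)%N -> bm (zeta i)) ->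
  (forall i, (i < n)%N -> forall w, `|zeta i w| <= del i) ->
  (forall i, (i < n)%N -> 0 <= v i <= del i ^+ 2) ->
  (forall i, (i < n)%N -> forall f, bm f ->
     let S w := \sum_(j < i) zeta j w in
     \int[Pr]_w (zeta i w * f (S w)) = 0 /\
     \int[Pr]_w (zeta i w ^+ 2 * f (S w)) = v i * \int[Pr]_w f (S w)) ->
  forall h a b K, taylor3 h a b K ->
  `|\int[Pr]_w h (\sum_(j < n) zeta j w) -
    normal_shift (Num.sqrt (\sum_(j < n) v j)) h 0| <=
  K * (1 + normal_abs_moment3 R) * \sum_(j < n) del j ^+ 3.
Proof.
elim: n => [|n IH] bz zd vd ind h a b K hT.
  rewrite !big_ord0 sqrtr0 mulr0 /normal_shift.
  under eq_Rintegral do rewrite big_ord0.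
  rewrite RintegralT_cst; under eq_Rintegral do rewrite mul0r addr0.
  by rewrite RintegralT_cst subrr normr0.
have {}IH := IH (fun i hi => bz i (ltnW hi)) (fun i hi => zd i (ltnW hi))
  (fun i hi => vd i (ltnW hi)) (fun i hi => ind i (ltnW hi)).
have [bh ba bb _] := hT.
have bS : bm (fun w => \sum_(j < n) zeta j w).
  by apply: bm_sum => j; apply: bz; exact: ltn_trans (ltn_ord j) _.
have step := lindeberg_step hT bS (bz _ (ltnSn n)) (zd _ (ltnSn n))
  (vd _ (ltnSn n)) (ind _ (ltnSn n) _ ba).1 (ind _ (ltnSn n) _ bb).2.
have vn0 : 0 <= v n by case/andP: (vd _ (ltnSn n)).
have v0 : 0 <= \sum_(j < n) v j.
  apply: sumr_ge0 => j _; have : (j < n.+1)%N by exact: ltn_trans (ltn_ord j) _.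
  by move=> /vd/andP[].
have := IH _ _ _ _ (taylor3_normal_shift (Num.sqrt (v n)) hT).
rewrite normal_shift_semigroup ?sqrtr_ge0//; last exact: taylor3_continuous hT.
rewrite !sqr_sqrtr// (addrC (v n)) => IH'.
under eq_Rintegral do rewrite big_ord_recr/=.
rewrite !big_ord_recr/= mulrDr.
rewrite -[X in `|X|](subrKA
  (\int[Pr]_w normal_shift (Num.sqrt (v n)) h (\sum_(j < n) zeta j w))).
by rewrite [leRHS]addrC; apply: (le_trans (ler_normD _ _)); exact: lerD.
Qed.

End sum.
End lindeberg.

(** * Smooth test functions *)

Section smooth.
Variable R : realType.
Implicit Types (h k a b : R -> R) (K t x y z : R).

Definition smooth h := exists a b K, taylor3 h a b K.

Lemma smooth_bm h : smooth h -> bm h.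
Proof. by move=> [a [b [K []]]]. Qed.

Lemma smooth_cst c : smooth (fun=> c).
Proof.
exists (fun=> 0), (fun=> 0), 0; split; [exact: bm_cst..|move=> x y].
by rewrite !mulr0 !subr0 subrr normr0 mul0r.
Qed.

Lemma smoothD h k : smooth h -> smooth k -> smooth (fun x => h x + k x).
Proof.
move=> [a [b [K [bh ba bb hT]]]] [a' [b' [K' [bh' ba' bb' hT']]]].
exists (fun x => a x + a' x), (fun x => b x + b' x), (K + K').
split; [exact: bmD..|move=> x y].
rewrite mulrDl; apply: le_trans (lerD (hT x y) (hT' x y)).
apply: le_trans (ler_normD _ _).
by rewrite le_eqVlt; apply/orP; left; apply/eqP; congr `|_|; ring.
Qed.

Lemma smoothZ r h : smooth h -> smooth (fun x => r * h x).
Proof.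
move=> [a [b [K [bh ba bb hT]]]].
exists (fun x => r * a x), (fun x => r * b x), (`|r| * K).
split; [by apply: bmM => //; exact: bm_cst..|move=> x y].
rewrite -[leRHS]mulrA; apply: le_trans (ler_wpM2l (normr_ge0 r) (hT x y)).
rewrite -normrM.
by rewrite le_eqVlt; apply/orP; left; apply/eqP; congr `|_|; ring.
Qed.

Lemma smooth_affine r s h : smooth h -> smooth (fun x => h (r * x + s)).
Proof.
move=> [a [b [K [bh ba bb hT]]]].
have mrs : measurable_fun setT (fun x : R => r * x + s).
  by apply: measurable_funD => //; exact: measurable_funM.
exists (fun x => r * a (r * x + s)), (fun x => r ^+ 2 * b (r * x + s)),
  (K * `|r| ^+ 3).
split; [exact: (bm_comp bh mrs)| | |move=> x y].
- by apply: bmM; [exact: bm_cst|exact: (bm_comp ba mrs)].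
- by apply: bmM; [exact: bm_cst|exact: (bm_comp bb mrs)].
rewrite -[leRHS]mulrA -exprMn -normrM.
apply: le_trans (hT (r * x + s) (r * y)).
rewrite le_eqVlt; apply/orP; left; apply/eqP; congr `|_|.
rewrite (_ : r * (x + y) + s = r * x + s + r * y); last by ring.
by ring.
Qed.

Let pos x := (x + `|x|) / 2.

Let posE x : 0 <= x -> pos x = x.
Proof. by move=> x0; rewrite /pos ger0_norm//; field. Qed.

Let neg_posE x : x <= 0 -> pos x = 0.
Proof. by move=> x0; rewrite /pos ler0_norm// subrr mul0r. Qed.

Let measurable_pos : measurable_fun setT pos.
Proof.
by apply: measurable_funM => //; apply: measurable_funD => //; exact: normr_measurable.
Qed.

(** If x and x + y have opposite signs, the remainder lies between 0 and y^3 by monotonicity of the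
    cube; otherwise it is y^3 or 0. *)
Let pos_taylor x y : `|pos (x + y) ^+ 3 - pos x ^+ 3 - y * (3 * pos x ^+ 2) -
  y ^+ 2 / 2 * (6 * pos x)| <= `|y| ^+ 3.
Proof.
rewrite -normrX.
have cube (u v : R) : u <= v -> u ^+ 3 <= v ^+ 3.
  move=> uv; rewrite -subr_ge0.
  have -> : v ^+ 3 - u ^+ 3 = (v - u) * ((v + u / 2) ^+ 2 + 3 / 4 * u ^+ 2).
    by field.
  rewrite mulr_ge0 ?subr_ge0//.
  by have := sqr_ge0 (v + u / 2); have := sqr_ge0 u; lra.
have [x0|x0] := leP 0 x; have [xy0|xy0] := leP 0 (x + y).
- by rewrite !posE// le_eqVlt; apply/orP; left; apply/eqP; congr `|_|; field.
- rewrite (posE x0) (neg_posE (ltW xy0)).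
  have -> : 0 ^+ 3 - x ^+ 3 - y * (3 * x ^+ 2) - y ^+ 2 / 2 * (6 * x) =
    y ^+ 3 - (x + y) ^+ 3 by field.
  have h1 : y ^+ 3 <= (x + y) ^+ 3 by apply: cube; lra.
  have h2 : (x + y) ^+ 3 <= 0.
    by have := cube _ _ (ltW xy0); rewrite expr0n.
  rewrite !ler0_norm; lra.
- rewrite (posE xy0) (neg_posE (ltW x0)).
  have h1 : (x + y) ^+ 3 <= y ^+ 3 by apply: cube; lra.
  have h2 : 0 <= (x + y) ^+ 3 by rewrite exprn_ge0.
  rewrite !expr0n/= !mulr0 !subr0 !ger0_norm//; lra.
- rewrite (neg_posE (ltW x0)) (neg_posE (ltW xy0)).
  rewrite (_ : _ - _ = 0); last by ring.
  by rewrite normr0.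
Qed.

Let third_difference h x := (h x - 3 * h (x - 1) + 3 * h (x - 2) - h (x - 3)) / 6.

(* The distribution function of the sum of three independent uniform variables. *)
Definition smooth_step := third_difference (fun x => pos x ^+ 3).

Lemma smooth_step0 x : x <= 0 -> smooth_step x = 0.
Proof.
move=> x0; rewrite /smooth_step /third_difference !neg_posE; lra.
Qed.

Lemma smooth_step1 x : 3 <= x -> smooth_step x = 1.
Proof.
move=> x3; rewrite /smooth_step /third_difference !posE; first by field.
all: lra.
Qed.

Lemma smooth_step_ge0le1 x : 0 <= smooth_step x <= 1.
Proof.
have [x0|x0] := leP x 0; first by rewrite smooth_step0// lexx ler01.
have [x3|x3] := leP 3 x; first by rewrite smooth_step1// lexx ler01.
rewrite /smooth_step /third_difference (posE (ltW x0)) (@neg_posE (x - 3)); last by lra.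
have [x1|x1] := leP x 1.
  rewrite (@neg_posE (x - 1)) ?(@neg_posE (x - 2)); [|lra..].
  have h1 : x ^+ 3 <= 1 by rewrite exprn_ile1// ltW.
  have h2 : 0 <= x ^+ 3 by rewrite exprn_ge0// ltW.
  lra.
rewrite (@posE (x - 1)); last by lra.
have [x2|x2] := leP x 2.
  rewrite (@neg_posE (x - 2)); last by lra.
  rewrite !expr0n/=.
  pose u := x - 1; have u0 : 0 <= u by rewrite /u; lra.
  have u1 : u <= 1 by rewrite /u; lra.
  have -> : x ^+ 3 = (1 + u) ^+ 3 by rewrite /u; ring.
  rewrite -/u.
  have h3 : 0 <= u ^+ 3 by rewrite exprn_ge0.
  have h4 : 0 <= u ^+ 2 by rewrite exprn_ge0.
  have h5 : u ^+ 3 <= u ^+ 2 by rewrite (exprS _ 2) ler_piMl.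
  have h6 : 0 <= (1 - u) ^+ 2 * (1 + 2 * u) by rewrite mulr_ge0 ?sqr_ge0//; lra.
  move: h6; rewrite (_ : _ * _ = 1 - 3 * u ^+ 2 + 2 * u ^+ 3); last by ring.
  have -> : (1 + u) ^+ 3 = 1 + 3 * u + 3 * u ^+ 2 + u ^+ 3 by ring.
  lra.
rewrite (@posE (x - 2)); last by lra.
pose u := 3 - x; have u0 : 0 <= u by rewrite /u; lra.
have u1 : u <= 1 by rewrite /u; lra.
have h2 : u ^+ 3 <= 1 by rewrite exprn_ile1.
have h3 : 0 <= u ^+ 3 by rewrite exprn_ge0.
have -> : (x ^+ 3 - 3 * (x - 1) ^+ 3 + 3 * (x - 2) ^+ 3 - 0 ^+ 3) / 6 = 1 - u ^+ 3 / 6.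
  by rewrite /u; field.
lra.
Qed.

Let bm_third_difference h : measurable_fun setT h -> (forall x, x <= 0 -> h x = 0) ->
  (forall x, 3 <= x -> third_difference h x = 0) ->
  (forall x, 0 <= x <= 3 -> `|h x| <= 27) -> bm (third_difference h).
Proof.
move=> mh h0 h3 hB; split.
  have m r : measurable_fun setT (fun x => h (x - r)).
    by apply: measurableT_comp => //; exact: measurable_funB.
  apply: measurable_funM => //; apply: measurable_funB => //.
  apply: measurable_funD => //; last exact: measurable_funM.
  by apply: measurable_funB => //; exact: measurable_funM.
(* Below 3 each value of [h] is at most 27; the weights 1, 3, 3, 1 over 6 even give 36. *)
exists 108 => x.
have [x0|x0] := leP x 0.
  by rewrite /third_difference !h0 ?(mulr0,subr0,addr0,mul0r,normr0)//; lra.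
have [x3|x3] := leP 3 x; first by rewrite h3// normr0.
have B y : y <= 3 -> `|h y| <= 27.
  by move=> y3; have [y0|y0] := leP y 0; [rewrite h0// normr0|apply: hB; rewrite ltW].
have h00 := B x (ltW x3).
have h1 : `|h (x - 1)| <= 27 by apply: B; lra.
have h2 : `|h (x - 2)| <= 27 by apply: B; lra.
have h4 : `|h (x - 3)| <= 27 by apply: B; lra.
move: h00 h1 h2 h4; rewrite /third_difference !ler_norml.
move=> /andP[? ?] /andP[? ?] /andP[? ?] /andP[? ?]; lra.
Qed.

Lemma smooth_smooth_step : smooth smooth_step.
Proof.
(* 8/6 is the sum 1 + 3 + 3 + 1 of the weights of the third difference, over 6. *)
exists (third_difference (fun x => 3 * pos x ^+ 2)),
  (third_difference (fun x => 6 * pos x)), (8 / 6); split.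
- split.
    have m r : measurable_fun setT (fun x => pos (x - r) ^+ 3).
      by apply: measurable_funX; apply: measurableT_comp => //; exact: measurable_funB.
    apply: measurable_funM => //; apply: measurable_funB => //.
    apply: measurable_funD => //; last exact: measurable_funM.
    apply: measurable_funB; [exact: measurable_funX|exact: measurable_funM].
  exists 1 => x; have /andP[s0 s1] := smooth_step_ge0le1 x.
  by rewrite ger0_norm.
- apply: bm_third_difference.
  + by apply: measurable_funM => //; exact: measurable_funX.
  + by move=> x x0; rewrite neg_posE// expr0n mulr0.
  + move=> x x3; rewrite /third_difference (@posE x) ?(@posE (x - 1))
      ?(@posE (x - 2)) ?(@posE (x - 3)); [by field|lra..].
  + move=> x /andP[x0 x3]; rewrite posE// ger0_norm ?mulr_ge0 ?sqr_ge0//; nra.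
- apply: bm_third_difference.
  + exact: measurable_funM.
  + by move=> x x0; rewrite neg_posE// mulr0.
  + move=> x x3; rewrite /third_difference (@posE x) ?(@posE (x - 1))
      ?(@posE (x - 2)) ?(@posE (x - 3)); [by field|lra..].
  + move=> x /andP[x0 x3]; rewrite posE// ger0_norm ?mulr_ge0//; lra.
- move=> x y; have h0 := pos_taylor x y; have h1 := pos_taylor (x - 1) y.
  have h2 := pos_taylor (x - 2) y; have h3 := pos_taylor (x - 3) y.
  rewrite /smooth_step /third_difference.
  rewrite !(addrAC x y).
  move: h0 h1 h2 h3; rewrite !ler_norml.
  move=> /andP[? ?] /andP[? ?] /andP[? ?] /andP[? ?]; lra.
Qed.

End smooth.

(** * Approximation of continuous functions on compact intervals *)

Section smooth_approximation.
Variable R : realType.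
Implicit Types (h k : R -> R) (x y r B eps : R).

(** The last clause, constancy beyond [r], is what allows a smooth step glued at [r] to extend the
    approximation to the right. *)
Let approx h B eps l r := exists k, [/\ smooth k, forall x, `|k x| <= B,
  forall x, l <= x <= r -> `|k x - h x| <= eps & forall x, r <= x -> k x = h r].

Let approx_extend h B eps l r r' : (forall x, `|h x| <= B) -> 0 < eps ->
  l <= r -> r < r' -> (forall x, r <= x <= r' -> `|h x - h r| <= eps / 2) ->
  approx h B eps l r -> approx h B eps l r'.
Proof.
move=> hB e0 lr rr' osc [k [sk kB kh kr]].
have r'r0 : 0 < r' - r by rewrite subr_gt0.
pose th x := smooth_step (3 / (r' - r) * x + - (3 / (r' - r) * r)).
have thE x : th x = smooth_step (3 / (r' - r) * (x - r)).
  by rewrite /th -mulrBr.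
have c0 : 0 < 3 / (r' - r) by rewrite divr_gt0.
have th0 x : x <= r -> th x = 0.
  by move=> xr; rewrite thE smooth_step0// pmulr_rle0// subr_le0.
have th1 x : r' <= x -> th x = 1.
  move=> xr; rewrite thE smooth_step1// mulrAC ler_pdivlMr// ler_wpM2l//.
  by rewrite lerD2r.
have th01 x : 0 <= th x <= 1 by exact: smooth_step_ge0le1.
exists (fun x => k x + (h r' - h r) * th x); split.
- apply: smoothD => //; apply: smoothZ; apply: smooth_affine.
  exact: smooth_smooth_step.
- move=> x; have [xr|xr] := leP x r; first by rewrite th0// mulr0 addr0.
  rewrite kr ?(ltW xr)//; have /andP[t0 t1] := th01 x.
  move: (hB r) (hB r'); rewrite !ler_norml => /andP[a1 a2] /andP[b1 b2].
  by apply/andP; split; nra.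
- move=> x /andP[lx xr']; have [xr|xr] := leP x r.
    by rewrite th0// mulr0 addr0 kh// lx.
  rewrite kr ?(ltW xr)//; have /andP[t0 t1] := th01 x.
  have := osc x; have := osc r'; rewrite (ltW xr) xr' (ltW rr') lexx.
  move=> /(_ isT) + /(_ isT); rewrite !ler_norml => /andP[a1 a2] /andP[b1 b2].
  by apply/andP; split; nra.
- move=> x xr'; rewrite th1// mulr1 kr; first by rewrite addrC subrK.
  exact: le_trans (ltW rr') xr'.
Qed.

(** Continuous induction: let [s] be the supremum of the right ends that can be reached. Continuity
    at [s] alone gives an extension from just before [s] to beyond it, so [r] itself is reached. *)
Lemma smooth_approximation h B eps l r : continuous h -> (forall x, `|h x| <= B) ->
  0 < eps -> l <= r -> exists k, [/\ smooth k, forall x, `|k x| <= B &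
    forall x, l <= x <= r -> `|k x - h x| <= eps].
Proof.
move=> ch hB e0 lr.
suff [k [sk kB kh _]] : approx h B eps l r by exists k.
pose A := [set x | l <= x <= r /\ approx h B eps l x].
have Al : A l.
  split; first by rewrite lexx.
  exists (fun=> h l); split => //; first exact: smooth_cst.
  move=> x /andP[lx xl]; have -> : x = l by apply/eqP; rewrite eq_le xl lx.
  by rewrite subrr normr0 ltW.
have hA : has_sup A by split; [exists l|exists r => x [/andP[]]].
pose s := sup A.
have ls : l <= s by apply: sup_ubound => //; case: hA.
have /cvgrPdist_le/(_ (eps / 4)) := ch s.
rewrite divr_gt0// => /(_ isT) [/= del d0 hdel].
have osc x y : s - del < x -> x < s + del -> s - del < y -> y < s + del ->
    `|h x - h y| <= eps / 2.
  move=> x1 x2 y1 y2.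
  have /= hx : `|h s - h x| <= eps / 4 by apply: hdel => /=; rewrite ltr_norml; lra.
  have /= hy : `|h s - h y| <= eps / 4 by apply: hdel => /=; rewrite ltr_norml; lra.
  by move: hx hy; rewrite !ler_norml; lra.
have [q [/andP[lq qr] Aq] sq] := sup_adherent d0 hA.
have qs : q <= s by apply: sup_ubound; [case: hA|split => //; rewrite lq].
have ext q' : q < q' -> q' < s + del -> approx h B eps l q'.
  move=> qq' q's; apply: (approx_extend hB e0 lq qq' _ Aq) => x /andP[qx xq'].
  by apply: osc; rewrite -/s in sq; lra.
have [qr'|rq] := ltP q r; last first.
  by have <- : q = r by apply/eqP; rewrite eq_le qr rq.
have [rs|sr] := ltP r (s + del); first exact: ext.
have : s + del / 2 <= s.
  apply: sup_ubound; first by case: hA.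
  by split; [lra|apply: ext; lra].
lra.
Qed.

End smooth_approximation.

(** * Convergence to the standard normal law through smooth test functions *)

Section weak_convergence.
Context (R : realType) d (W : measurableType d) (Pr : probability W R).
Local Notation N := (std_normal R).

(** A smooth substitute for a tail indicator: at least 1 where |x| >= L + 3, and at most x^2/L^2, so
    that the normal variance bounds its mean. *)
Let cutoff (L x : R) := smooth_step (x - L) + smooth_step (- x - L).

Let smooth_cutoff L : smooth (cutoff L).
Proof.
apply: smoothD.
  have -> : (fun x : R => smooth_step (x - L)) = (fun x => smooth_step (1 * x + - L)).
    by apply/funext => x; rewrite mul1r.
  exact/smooth_affine/smooth_smooth_step.
have -> : (fun x : R => smooth_step (- x - L)) =
    (fun x => smooth_step (- 1 * x + - L)).
  by apply/funext => x; rewrite mulN1r.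
exact/smooth_affine/smooth_smooth_step.
Qed.

Let cutoff_ge0 L x : 0 <= cutoff L x.
Proof.
have /andP[? _] := smooth_step_ge0le1 (x - L).
by have /andP[? _] := smooth_step_ge0le1 (- x - L); rewrite addr_ge0.
Qed.

Let cutoff_ge1 L x : 0 <= L -> L + 3 <= `|x| -> 1 <= cutoff L x.
Proof.
move=> L0; rewrite ler_normr => /orP[] h; rewrite /cutoff.
  rewrite (@smooth_step1 _ (x - L)) ?lerBrDl//.
  by rewrite lerDl; case/andP: (smooth_step_ge0le1 (- x - L)).
rewrite (@smooth_step1 _ (- x - L)) ?lerBrDl//.
by rewrite lerDr; case/andP: (smooth_step_ge0le1 (x - L)).
Qed.

Let cutoff_le L x : 0 < L -> cutoff L x <= L ^- 2 * x ^+ 2.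
Proof.
move=> L0; have [xL|xL] := leP `|x| L.
  move: xL; rewrite ler_norml => /andP[x1 x2].
  rewrite /cutoff !smooth_step0 ?addr0; [|lra..].
  by rewrite mulr_ge0 ?invr_ge0 ?sqr_ge0.
apply: (@le_trans _ _ 1); last first.
  rewrite mulrC ler_pdivlMr ?exprn_gt0// mul1r -(real_normK (num_real x)).
  by rewrite lerXn2r ?nnegrE ?(ltW L0) ?(ltW xL).
rewrite /cutoff; move: xL; rewrite ltr_normr => /orP[] h.
  rewrite (@smooth_step0 _ (- x - L)) ?addr0; last by lra.
  by case/andP: (smooth_step_ge0le1 (x - L)).
rewrite (@smooth_step0 _ (x - L)) ?add0r; last by lra.
by case/andP: (smooth_step_ge0le1 (- x - L)).
Qed.

Let cutoff_normal L : 0 < L -> \int[N]_x cutoff L x <= L ^- 2.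
Proof.
move=> L0; rewrite -[leRHS]mulr1 -normal_variance -RintegralZl//; last first.
  exact: normal_integrableX2.
apply: le_Rintegral => //.
- exact/bm_integrable/smooth_bm/smooth_cutoff.
- by have := integrableZl measurableT (L ^- 2) (@normal_integrableX2 R).
- by move=> x _; exact: cutoff_le.
Qed.

(** Tightness is extracted from the hypothesis itself, applied to [cutoff L]: the smoothed tail mass
    of [Z k] converges to a normal integral that is at most L^-2. On the remaining compact interval
    [h] is replaced by a smooth function. *)
Lemma smooth_cvg_in_distribution (Z : nat -> W -> R) :
  (forall k, measurable_fun setT (Z k)) ->
  (forall h, smooth h ->
    (\int[Pr]_w h (Z k w)) @[k --> \oo] --> \int[N]_x h x) ->
  cvg_in_distribution Pr Z (normal_prob 0 1).
Proof.
move=> mZ Zh; split => // h ch /(bm_bounded_fun (continuous_measurable_fun ch)) bh.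
rewrite Rintegral_std_normal//.
have [_ [B0 hB0]] := bh.
pose B := B0 + 1.
have hB x : `|h x| <= B by rewrite (le_trans (hB0 x))// lerDl.
have B1 : 0 < B by rewrite ltr_pwDr// (le_trans _ (hB0 0)).
apply/cvgrPdist_le => e e0.
(* L^2 >= 16 B/e makes the tail term [B * L ^- 2] at most e/16; the added 1 keeps [L] positive. *)
pose L := Num.sqrt (16 * B / e) + 1.
have L0 : 0 < L by rewrite ltr_pwDr// sqrtr_ge0.
have LB : B * L ^- 2 <= e / 16.
  rewrite ler_pdivrMr ?exprn_gt0//.
  have : 16 * B / e <= L ^+ 2.
    have q0 : 0 <= 16 * B / e by rewrite divr_ge0 ?mulr_ge0 ?ltW.
    by have := sqrtr_ge0 (16 * B / e); have := sqr_sqrtr q0; rewrite /L; nra.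
  rewrite ler_pdivrMr// => hh.
  lra.
have [k [sk kB kh]] : exists k, [/\ smooth k, forall x, `|k x| <= B &
    forall x, - (L + 3) <= x <= L + 3 -> `|k x - h x| <= e / 16].
  by apply: smooth_approximation => //; [rewrite divr_gt0|lra].
have bk := smooth_bm sk; have bc := smooth_bm (smooth_cutoff L).
have khc x : `|k x - h x| <= e / 16 + 2 * B * cutoff L x.
  have [xL|xL] := leP `|x| (L + 3).
    apply: (le_trans (kh _ _)); first by rewrite -ler_norml.
    by rewrite lerDl !mulr_ge0// ltW.
  have c1 := cutoff_ge1 (ltW L0) (ltW xL).
  apply: (le_trans (ler_normB _ _)).
  have := kB x; have := hB x; nra.
have bR := bmD (bm_cst _ (e / 16)) (bmM (bm_cst _ (2 * B)) bc).
have bkh := bmB bk bh.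
have EN : `|\int[N]_x k x - \int[N]_x h x| <= e / 16 + 2 * B * L ^- 2.
  rewrite -bm_RintegralB//; apply: (le_trans (le_normr_Rintegral _ _)) => //.
    exact: bm_integrable.
  apply: (@le_trans _ _ (\int[N]_x (e / 16 + 2 * B * cutoff L x))).
    by apply: bm_le_Rintegral => //; exact: bm_norm.
  rewrite bm_RintegralD//; [|exact: bm_cst|exact: bmM (bm_cst _ _) bc].
  rewrite RintegralT_cst lerD2l bm_RintegralZl// ler_wpM2l//.
    by rewrite mulr_ge0// ltW.
  exact: cutoff_normal.
have EZ j : `|\int[Pr]_w k (Z j w) - \int[Pr]_w h (Z j w)| <=
    e / 16 + 2 * B * \int[Pr]_w cutoff L (Z j w).
  have bkZ := bm_comp bk (mZ j); have bhZ := bm_comp bh (mZ j).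
  have bcZ := bm_comp bc (mZ j).
  rewrite -bm_RintegralB//; apply: (le_trans (le_normr_Rintegral _ _)) => //.
    by apply: bm_integrable; exact: bmB.
  apply: (@le_trans _ _ (\int[Pr]_w (e / 16 + 2 * B * cutoff L (Z j w)))).
    apply: bm_le_Rintegral => //; first exact/bm_norm/bmB.
    exact: (bmD (bm_cst _ _) (bmM (bm_cst _ _) bcZ)).
  rewrite bm_RintegralD//; [|exact: bm_cst|exact: bmM (bm_cst _ _) bcZ].
  by rewrite RintegralT_cst bm_RintegralZl.
have e16 : 0 < e / 16 by rewrite divr_gt0.
have eB : 0 < e / 16 / B by rewrite divr_gt0.
have /cvgrPdist_le/(_ _ e16) := Zh k sk.
have /cvgrPdist_le/(_ _ eB) := Zh _ (smooth_cutoff L).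
move=> Hc Hk; near=> j.
have hk : `|\int[N]_x k x - \int[Pr]_w k (Z j w)| <= e / 16 by near: j.
have hc : `|\int[N]_x cutoff L x - \int[Pr]_w cutoff L (Z j w)| <= e / 16 / B.
  by near: j.
have hc' : B * \int[Pr]_w cutoff L (Z j w) <= e / 8.
  have cN := cutoff_normal L0.
  move: hc; rewrite ler_norml => /andP[hc _].
  have h1 : \int[Pr]_w cutoff L (Z j w) <= e / 16 / B + L ^- 2 by lra.
  have := ler_wpM2l (ltW B1) h1; rewrite mulrDr mulrCA mulfV ?gt_eqF//; lra.
move: (EZ j) EN hk; rewrite !ler_norml; lra.
Unshelve. all: by end_near. Qed.

Lemma smooth_slutsky (Z T : nat -> W -> R) :
  (forall k, measurable_fun setT (Z k)) -> (forall k, measurable_fun setT (T k)) ->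
  (forall e, 0 < e -> Pr [set w | e <= `|T k w - Z k w|] @[k --> \oo] --> 0%E) ->
  forall h, smooth h -> (\int[Pr]_w h (Z k w)) @[k --> \oo] --> \int[N]_x h x ->
  (\int[Pr]_w h (T k w)) @[k --> \oo] --> \int[N]_x h x.
Proof.
move=> mZ mT TZ h [a [b [K hT]]] hZ.
have K0 := taylor3_ge0 hT.
have [bh [_ [A aA]] [_ [B bB]] _] := hT.
have [_ [H hH]] := bh.
have A0 : 0 <= A := le_trans (normr_ge0 _) (aA 0).
have B0 : 0 <= B := le_trans (normr_ge0 _) (bB 0).
have H0 : 0 <= H := le_trans (normr_ge0 _) (hH 0).
apply/cvgrPdist_le => e e0.
have C0 : 0 < 3 * (A + B + K + 1) by rewrite mulr_gt0//; lra.
(* For a distance below 1, its square and cube are at most the distance itself, so the Taylor bound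
   becomes linear. *)
pose eta := Num.min 1 (e / (3 * (A + B + K + 1))).
have eta0 : 0 < eta by rewrite lt_min ltr01 divr_gt0.
have eta1 : eta <= 1 by rewrite ge_min lexx.
have etae : (A + B + K) * eta <= e / 3.
  have : eta <= e / (3 * (A + B + K + 1)) by rewrite ge_min lexx orbT.
  by rewrite ler_pdivlMr// => ?; nra.
have hdist k w : `|h (T k w) - h (Z k w)| <=
    e / 3 + 2 * H * \1_[set w | eta <= `|T k w - Z k w|] w.
  rewrite indicE; have [_|] := boolP (w \in _).
    rewrite mulr1; apply: (le_trans (ler_normB _ _)).
    by have := hH (T k w); have := hH (Z k w); lra.
  rewrite notin_setE /= => /negP; rewrite -ltNge mulr0 addr0 => tz.
  have := taylor3_dist (Z k w) (T k w - Z k w) hT aA bB.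
  rewrite (addrC (Z k w)) subrK => /le_trans; apply; apply: le_trans etae.
  move: (normr_ge0 (T k w - Z k w)) (ltW tz); set u := `|_| => u0 ue.
  have u1 : u <= 1 := le_trans ue eta1.
  have u2 : u ^+ 2 <= u by rewrite expr2 ler_piMr.
  have u3 : u ^+ 3 <= u by rewrite exprS ler_piMr// exprn_ile1.
  nra.
have mTZ k : measurable [set w | eta <= `|T k w - Z k w|].
  apply: measurable_ge_set; apply: measurableT_comp => //.
  exact: measurable_funB.
have He0 : 0 < e / (6 * (H + 1)) by rewrite divr_gt0// mulr_gt0// ltr_pwDr.
have e3 : 0 < e / 3 by rewrite divr_gt0.
have /cvgrPdist_le/(_ _ e3) hZe := hZ.
have /fine_cvgP[_ /cvgrPdist_le/(_ _ He0) hTZ] := TZ _ eta0.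
near=> k.
have h1 : `|\int[N]_x h x - \int[Pr]_w h (Z k w)| <= e / 3 by near: k.
have h2 : fine (Pr [set w | eta <= `|T k w - Z k w|]) <= e / (6 * (H + 1)).
  apply: le_trans (ler_norm _) _.
  rewrite -normrN -sub0r; near: k; exact: hTZ.
have bi := bm_indic R (mTZ k).
have bhT := bm_comp bh (mT k); have bhZ := bm_comp bh (mZ k).
have h3 : `|\int[Pr]_w h (T k w) - \int[Pr]_w h (Z k w)| <=
    e / 3 + 2 * H * fine (Pr [set w | eta <= `|T k w - Z k w|]).
  rewrite -bm_RintegralB//; apply: (le_trans (le_normr_Rintegral _ _)) => //.
    by apply: bm_integrable; exact: bmB.
  rewrite -Rintegral_indic// -bm_RintegralZl//.
  rewrite -{1}(RintegralT_cst Pr (e / 3)) -bm_RintegralD//; last 2 first.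
  - exact: bm_cst.
  - exact: bmM (bm_cst _ _) bi.
  apply: bm_le_Rintegral => //; first exact/bm_norm/bmB.
  exact: (bmD (bm_cst _ _) (bmM (bm_cst _ _) bi)).
have h4 : 2 * H * fine (Pr [set w | eta <= `|T k w - Z k w|]) <= e / 3.
  move: h2; rewrite ler_pdivlMr; last by lra.
  have := fine_ge0 (measure_ge0 Pr [set w | eta <= `|T k w - Z k w|]); nra.
move: h1 h3; rewrite !ler_norml; lra.
Unshelve. all: by end_near. Qed.

End weak_convergence.

(** * Schroedinger potentials *)

Section oscillation.
Context (R : realType) (T : Type).
Implicit Types (u v : T -> R) (D : R).

(** A seminorm modulo constants: shifting one potential shifts its soft minimum oppositely, so only
    oscillations can contract. *)
Definition osc_le u D := forall x y, u x - u y <= D.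

Lemma osc_le_norm u D : (forall x, `|u x| <= D) -> osc_le u (2 * D).
Proof.
move=> uD x y; have := uD x; have := uD y.
rewrite !ler_norml => /andP[? ?] /andP[? ?]; lra.
Qed.

Lemma osc_le0 u x0 : osc_le u 0 -> forall x, u x = u x0.
Proof. by move=> u0 x; have := u0 x x0; have := u0 x0 x; lra. Qed.

Lemma osc_le_ge0 u D (x0 : T) : osc_le u D -> 0 <= D.
Proof. by move=> /(_ x0 x0); rewrite subrr. Qed.

Lemma osc_le_bounds u D (x0 : T) :
  osc_le u D -> exists m, forall x, m <= u x <= m + D.
Proof.
move=> uD; have hI : has_inf (range u).
  split; first by exists (u x0), x0.
  by exists (u x0 - D) => _ [x _ <-]; have := uD x0 x; lra.
exists (inf (range u)) => x; apply/andP; split.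
  by apply: inf_lbound; [case: hI|exists x].
rewrite -lerBlDr; apply: lb_le_inf; first by case: hI.
by move=> _ [y _ <-]; have := uD x y; lra.
Qed.

End oscillation.

(** Nested intervals: with the geometric tail [D / (1 - q) * q ^+ n] added the sequence decreases,
    with it subtracted it increases. *)
Lemma geometric_cauchy_lim (R : realType) (u : nat -> R) D q : 0 <= q < 1 ->
  (forall n, `|u n.+1 - u n| <= D * q ^+ n) ->
  exists l, forall n, `|l - u n| <= D / (1 - q) * q ^+ n.
Proof.
move=> /andP[q0 q1] uD.
have q10 : 0 < 1 - q by lra.
have qE n : D / (1 - q) * q ^+ n - D / (1 - q) * q ^+ n.+1 = D * q ^+ n.
  by rewrite exprS; field; rewrite gt_eqF.
have D0 : 0 <= D by have := le_trans (normr_ge0 _) (uD 0%N); rewrite expr0 mulr1.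
pose v n := u n + D / (1 - q) * q ^+ n.
pose w n := u n - D / (1 - q) * q ^+ n.
have vd : {homo v : m n / (m <= n)%N >-> n <= m}.
  apply/nonincreasing_seqP => n; have := uD n.
  by rewrite ler_norml /v -(qE n) => /andP[? ?]; lra.
have wi : {homo w : m n / (m <= n)%N >-> m <= n}.
  apply/nondecreasing_seqP => n; have := uD n.
  by rewrite ler_norml /w -(qE n) => /andP[? ?]; lra.
have wv m n : w m <= v n.
  apply: (le_trans (wi _ _ (leq_maxl m n))).
  apply: le_trans (vd _ _ (leq_maxr m n)).
  rewrite /w /v; have : 0 <= D / (1 - q) * q ^+ maxn m n.
    by rewrite mulr_ge0 ?exprn_ge0// divr_ge0// ltW.
  by lra.
have hS : has_sup (range w).
  by split; [exists (w 0%N), 0%N|exists (v 0%N) => _ [n _ <-]].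
exists (sup (range w)) => n; rewrite ler_norml.
have h1 : w n <= sup (range w) by apply: sup_ubound; [case: hS|exists n].
have h2 : sup (range w) <= v n by apply: ge_sup; [case: hS|move=> _ [m _ <-]].
by move: h1 h2; rewrite /w /v; lra.
Qed.

(** Concavity of ln between 1 and X, obtained from ln z >= 1 - 1/z at p and at p/X with weights 1 -
    th and th. *)
Lemma ln_weighted (R : realType) (th X : R) : 0 <= th <= 1 -> 1 <= X ->
  th * ln X <= ln (1 + th * (X - 1)).
Proof.
move=> /andP[t0 t1] X1; set p := 1 + _.
have X0 : 0 < X by lra.
have p0 : 0 < p by have := mulr_ge0 t0 (_ : 0 <= X - 1); rewrite /p; lra.
have lnge (z : R) : 0 < z -> 1 - z^-1 <= ln z.
  move=> z0; have zi0 : 0 < z^-1 by rewrite invr_gt0.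
  have := @le_ln1Dx R (z^-1 - 1); rewrite [1 + _]addrC subrK.
  rewrite lnV ?posrE// => h; have h1 : -1 < z^-1 - 1 by lra.
  by have := h h1; lra.
have h1 := lnge _ p0.
have pX0 : 0 < p / X by rewrite divr_gt0.
have h2 := lnge _ pX0.
move: h2; rewrite ln_div ?posrE// invf_div => h2.
have h3 : th * (1 - X / p) + (1 - th) * (1 - p^-1) = 0.
  by rewrite /p; field; rewrite gt_eqF.
have h4 := ler_wpM2l t0 h2.
have h5 : (1 - th) * (1 - p^-1) <= (1 - th) * ln p by rewrite ler_wpM2l// subr_ge0.
lra.
Qed.

(** [u], [v] and [u'], [v'] will be the kernel integrals of [f] and [f'] at y and y', with [e] =
    exp(2 M) and [th] = exp(-4 M). A relative excess X - 1 at y' forces at least th (X - 1) at y;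
    concavity of ln turns this into the factor 1 - th. *)
Lemma contraction_arithmetic (R : realType) (th e m D u v u' v' : R) :
  0 <= th -> th <= 1 -> 0 <= e -> th * (e * e) = 1 ->
  0 < u -> 0 < v -> 0 < u' -> 0 < v' ->
  v' - expR m * v <= e * (u' - expR m * u) -> u <= e * v ->
  0 <= u' - expR m * u -> 0 <= v' - expR m * v -> v' <= expR D * (expR m * v) ->
  (ln v' - ln v) - (ln u' - ln u) <= (1 - th) * D.
Proof.
move=> th0 th1 e0 th4 u0 v0 u'0 v'0 cmp uv du dv v'D.
have em0 : 0 < expR m := expR_gt0 m.
pose X := v' / (expR m * v).
have X1 : 1 <= X by rewrite ler_pdivlMr ?mulr_gt0// mul1r -subr_ge0.
have XD : X <= expR D by rewrite ler_pdivrMr ?mulr_gt0.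
have key : 1 + th * (X - 1) <= u' / (expR m * u).
  rewrite ler_pdivlMr ?mulr_gt0//.
  have -> : X - 1 = (v' - expR m * v) / (expR m * v).
    by rewrite /X; field; rewrite !gt_eqF.
  rewrite mulrDl mul1r -lerBrDl.
  have -> : th * ((v' - expR m * v) / (expR m * v)) * (expR m * u) =
      th * (v' - expR m * v) * (u / v).
    by field; rewrite !gt_eqF.
  have r1 : u / v <= e by rewrite ler_pdivrMr.
  have r0 : 0 <= u / v by rewrite divr_ge0// ltW.
  apply: (@le_trans _ _ (th * (e * (u' - expR m * u)) * e)).
    by apply: ler_pM => //; [rewrite mulr_ge0|rewrite ler_wpM2l].
  rewrite (_ : _ * e = th * (e * e) * (u' - expR m * u)); last by ring.
  by rewrite th4 mul1r.
have lnX : ln X <= D by rewrite -ler_expR lnK// posrE (lt_le_trans ltr01).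
have p0 : 0 < 1 + th * (X - 1) by rewrite ltr_pwDl// mulr_ge0// subr_ge0.
have th01 : 0 <= th <= 1 by rewrite th0.
have lnw := ln_weighted th01 X1.
have lnk : ln (1 + th * (X - 1)) <= ln (u' / (expR m * u)).
  by rewrite ler_ln ?posrE// (lt_le_trans p0).
have h : (1 - th) * ln X <= (1 - th) * D by rewrite ler_wpM2l// subr_ge0.
move: lnk lnw h; rewrite /X !ln_div ?posrE ?mulr_gt0// !lnM ?posrE// expRK.
set p := ln (1 + _).
move: (ln u) (ln v) (ln u') (ln v') p => a b a' b' p.
by lra.
Qed.

(* Locked, since unification would otherwise unfold the integral and [ln]. *)
HB.lock Definition softmin d1 d2 (T1 : measurableType d1) (T2 : measurableType d2)
    (R : realType) (k : T1 * T2 -> R) (P : probability T1 R) (f : T1 -> R)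
    (y : T2) : R :=
  - ln (\int[P]_x (expR (- k (x, y)) * expR (f x))).

Section softmin.
Context d1 d2 (T1 : measurableType d1) (T2 : measurableType d2) (R : realType).
Variables (k : T1 * T2 -> R) (M : R).
Hypotheses (bk : bm k) (kM : forall z, `|k z| <= M).
Variable P : probability T1 R.
Implicit Types f u : T1 -> R.

Local Notation softmin := (softmin k P).

Lemma softminE f y :
  softmin f y = - ln (\int[P]_x (expR (- k (x, y)) * expR (f x))).
Proof. by rewrite softmin.unlock. Qed.

Let bm_kernel2 f : bm f -> bm (fun p : T1 * T2 => expR (- k p) * expR (f p.1)).
Proof.
move=> bf; apply: bmM; first exact/bm_expR/bmN.
by apply: bm_expR; exact: (bm_comp bf measurable_fst).
Qed.

Lemma bm_kernel f y : bm f -> bm (fun x => expR (- k (x, y)) * expR (f x)).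
Proof. by move=> bf; exact: (bm_pair2 (bm_kernel2 bf) y). Qed.

Lemma kernel_ge f y B : bm f -> (forall x, - B <= f x) ->
  expR (- (M + B)) <= \int[P]_x (expR (- k (x, y)) * expR (f x)).
Proof.
move=> bf fB; apply: bm_le_Rintegral_cst; first exact: bm_kernel.
move=> x; rewrite -expRD ler_expR opprD lerD//.
by rewrite lerN2; exact: le_trans (ler_norm _) (kM _).
Qed.

Lemma kernel_gt0 f y : bm f -> 0 < \int[P]_x (expR (- k (x, y)) * expR (f x)).
Proof.
move=> bf; have [_ [B fB]] := bf.
apply: lt_le_trans (kernel_ge y bf (B := B) _); first exact: expR_gt0.
by move=> x; move: (fB x); rewrite ler_norml => /andP[].
Qed.

Lemma expR_softmin f y : bm f ->
  expR (- softmin f y) = \int[P]_x (expR (- k (x, y)) * expR (f x)).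
Proof. by move=> bf; rewrite softminE opprK lnK// posrE kernel_gt0. Qed.

Lemma bm_softmin f : bm f -> bm (softmin f).
Proof.
move=> bf; have [_ [B fB]] := bf.
rewrite softmin.unlock; apply: bmN; apply: (bm_ln (a := expR (- (M + B)))).
- exact: expR_gt0.
- by move=> y; apply: kernel_ge => // x; move: (fB x); rewrite ler_norml => /andP[].
- exact: (bm_Rintegral2 P (bm_kernel2 bf)).
Qed.

Lemma softmin_bound f B y : bm f -> (forall x, `|f x| <= B) ->
  `|softmin f y| <= M + B.
Proof.
move=> bf fB; rewrite softminE normrN ler_norml.
have h0 := kernel_gt0 y bf.
apply/andP; split.
  rewrite -ler_expR lnK ?posrE//; apply: kernel_ge => // x.
  by move: (fB x); rewrite ler_norml => /andP[].
rewrite -ler_expR lnK ?posrE//; apply: bm_Rintegral_le; first exact: bm_kernel.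
move=> x; rewrite -expRD ler_expR lerD//.
  by rewrite (le_trans (ler_norm _))// normrN.
exact: le_trans (ler_norm _) (fB x).
Qed.

Lemma softmin_shift f t y : bm f ->
  softmin (fun x => f x + t) y = softmin f y - t.
Proof.
move=> bf; rewrite !softminE.
have -> : \int[P]_x (expR (- k (x, y)) * expR (f x + t)) =
    \int[P]_x (expR (- k (x, y)) * expR (f x)) * expR t.
  rewrite -bm_RintegralZr; last exact: bm_kernel.
  by apply: eq_Rintegral => x _; rewrite expRD mulrA.
by rewrite lnM ?posrE ?expR_gt0 ?kernel_gt0// expRK opprD.
Qed.

Let kernel_compare y y' x : expR (- k (x, y)) <= expR (2 * M) * expR (- k (x, y')).
Proof.
rewrite -expRD ler_expR; move: (kM (x, y)) (kM (x, y')); rewrite !ler_norml; lra.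
Qed.

Lemma softmin_osc f : bm f -> osc_le (softmin f) (2 * M).
Proof.
move=> bf y y'; rewrite !softminE.
have h0 := kernel_gt0 y bf; have h0' := kernel_gt0 y' bf.
have : \int[P]_x (expR (- k (x, y')) * expR (f x)) <=
    expR (2 * M) * \int[P]_x (expR (- k (x, y)) * expR (f x)).
  rewrite -bm_RintegralZl; last exact: bm_kernel.
  apply: bm_le_Rintegral; first exact: bm_kernel.
    by apply: bmM; [exact: bm_cst|exact: bm_kernel].
  by move=> x; rewrite mulrA ler_wpM2r ?expR_ge0//; exact: kernel_compare.
move: h0 h0'; move: (Rintegral _ _ _) (Rintegral _ _ _) => v u u0 v0 vu.
have : ln v <= ln (expR (2 * M) * u) by rewrite ler_ln ?posrE ?mulr_gt0 ?expR_gt0//.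
by rewrite lnM ?posrE ?expR_gt0// expRK; lra.
Qed.

(* The Gibbs measures with densities proportional to [exp (- k(., y) + f)] are
   mutually comparable with constant [exp (- 4 M)], which yields contraction. *)
Lemma softmin_contraction f f' D (x0 : T1) : bm f -> bm f' ->
  osc_le (fun x => f' x - f x) D ->
  osc_le (fun y => softmin f' y - softmin f y) ((1 - expR (- (4 * M))) * D).
Proof.
move=> bf bf' oD y y'.
have M0 : 0 <= M := le_trans (normr_ge0 _) (kM (x0, y)).
have [m mu] := osc_le_bounds x0 oD.
have bu : bm (fun x => expR (f' x) - expR m * expR (f x)).
  by apply: bmB; [exact: bm_expR|apply: bmM; [exact: bm_cst|exact: bm_expR]].
pose J z := \int[P]_x (expR (- k (x, z)) * expR (f x)).
pose J' z := \int[P]_x (expR (- k (x, z)) * expR (f' x)).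
have J0 z : 0 < J z by exact: kernel_gt0.
have J'0 z : 0 < J' z by exact: kernel_gt0.
have f'm x : expR m * expR (f x) <= expR (f' x).
  by rewrite -expRD ler_expR; have /andP[] := mu x; lra.
have f'M x : expR (f' x) <= expR (D + m) * expR (f x).
  by rewrite -expRD ler_expR; have /andP[] := mu x; lra.
have J'JE z : J' z - expR m * J z =
    \int[P]_x (expR (- k (x, z)) * (expR (f' x) - expR m * expR (f x))).
  rewrite -bm_RintegralZl; last exact: bm_kernel.
  rewrite -bm_RintegralB; first by apply: eq_Rintegral => x _; ring.
    exact: bm_kernel.
  by apply: bmM; [exact: bm_cst|exact: bm_kernel].
have bku z :
    bm (fun x => expR (- k (x, z)) * (expR (f' x) - expR m * expR (f x))).
  by apply: bmM => //; apply/bm_expR/bmN; exact: (bm_pair2 bk).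
have cmp : J' y' - expR m * J y' <= expR (2 * M) * (J' y - expR m * J y).
  rewrite !J'JE -bm_RintegralZl//; apply: bm_le_Rintegral => //.
    by apply: bmM => //; exact: bm_cst.
  by move=> x; rewrite mulrA ler_wpM2r ?subr_ge0.
have cmpJ : J y <= expR (2 * M) * J y'.
  rewrite -bm_RintegralZl; last exact: bm_kernel.
  apply: bm_le_Rintegral; first exact: bm_kernel.
    by apply: bmM; [exact: bm_cst|exact: bm_kernel].
  by move=> x; rewrite mulrA ler_wpM2r ?expR_ge0.
have J'J0 z : 0 <= J' z - expR m * J z.
  by rewrite J'JE; apply: Rintegral_ge0 => x _; rewrite mulr_ge0 ?expR_ge0// subr_ge0.
have J'D : J' y' <= expR D * (expR m * J y').
  rewrite mulrA -expRD -bm_RintegralZl; last exact: bm_kernel.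
  apply: bm_le_Rintegral; first exact: bm_kernel.
    by apply: bmM; [exact: bm_cst|exact: bm_kernel].
  by move=> x; rewrite mulrCA ler_wpM2l ?expR_ge0.
have th4 : expR (- (4 * M)) * (expR (2 * M) * expR (2 * M)) = 1.
  by rewrite -!expRD -[RHS]expR0; congr expR; ring.
have th1 : expR (- (4 * M)) <= 1 by rewrite -expR0 ler_expR oppr_le0 mulr_ge0.
have aux (a b a' b' r : R) : b' - b - (a' - a) <= r ->
  - a' - - a - (- b' - - b) <= r by lra.
rewrite !softminE; apply: aux.
exact: (contraction_arithmetic (expR_ge0 _) th1 (expR_ge0 _) th4
  (J0 y) (J0 y') (J'0 y) (J'0 y') cmp cmpJ (J'J0 y) (J'J0 y') J'D).
Qed.

End softmin.

(** Squared because a Sinkhorn sweep composes two soft minima, each contracting oscillations by 1 -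
    exp(-4 M). *)
HB.lock Definition contraction_factor (R : realType) (M : R) : R :=
  (1 - expR (- (4 * M))) ^+ 2.

(** * Existence and uniform bounds for solutions of the Schroedinger system *)

Section schrodinger_system.
Context d (T : measurableType d) (R : realType).
Variables (c : T * T -> R) (M : R).
Hypotheses (bc : bm c) (cM : forall z, `|c z| <= M).
Variables P Q : probability T R.
Implicit Types f g : T -> R.

Let c' (p : T * T) := c (p.2, p.1).

Let bc' : bm c'.
Proof. exact: bm_swap. Qed.

Let c'M z : `|c' z| <= M.
Proof. exact: cM. Qed.

Definition sinkhorn_g f := softmin c P f.

Definition sinkhorn_f g := softmin c' Q g.

Definition schrodinger f g :=
  [/\ bm f, bm g, forall x, f x = sinkhorn_f g x & forall y, g y = sinkhorn_g f y].

Lemma bm_sinkhorn_g f : bm f -> bm (sinkhorn_g f).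
Proof. exact: bm_softmin. Qed.

Lemma bm_sinkhorn_f g : bm g -> bm (sinkhorn_f g).
Proof. exact: bm_softmin. Qed.

Local Notation contraction_factor := (contraction_factor M).

Let M0 : 0 <= M.
Proof. exact: le_trans (normr_ge0 _) (cM point). Qed.

Lemma contraction_factor_itv : 0 <= contraction_factor < 1.
Proof.
have h1 : expR (- (4 * M)) <= 1.
  by rewrite -expR0 ler_expR oppr_le0 mulr_ge0.
have h2 := expR_gt0 (- (4 * M)).
rewrite contraction_factor.unlock sqr_ge0/= expr_lt1//; lra.
Qed.

Lemma sinkhorn_contraction f f' D : bm f -> bm f' ->
  osc_le (fun x => f' x - f x) D ->
  osc_le (fun x => sinkhorn_f (sinkhorn_g f') x - sinkhorn_f (sinkhorn_g f) x)
    (contraction_factor * D).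
Proof.
move=> bf bf' oD; rewrite contraction_factor.unlock expr2 -mulrA.
apply: softmin_contraction => //; [exact: point|exact: bm_sinkhorn_g..|].
by apply: softmin_contraction => //; exact: point.
Qed.

Lemma sinkhorn_g_shift f t y :
  bm f -> sinkhorn_g (fun x => f x + t) y = sinkhorn_g f y - t.
Proof. exact: softmin_shift. Qed.

Lemma sinkhorn_f_shift g t x :
  bm g -> sinkhorn_f (fun y => g y + t) x = sinkhorn_f g x - t.
Proof. exact: softmin_shift. Qed.

Definition gibbs f g (p : T * T) : R := expR (f p.1 + g p.2 - c p).

Lemma bm_gibbs f g : bm f -> bm g -> bm (gibbs f g).
Proof.
move=> bf bg; apply: bm_expR; apply: bmB => //; apply: bmD.
  exact: (bm_comp bf measurable_fst).
exact: (bm_comp bg measurable_snd).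
Qed.

Lemma gibbs_mass_g f g y : bm f ->
  \int[P]_x gibbs f g (x, y) = expR (g y - sinkhorn_g f y).
Proof.
move=> bf; rewrite expRD (expR_softmin bc cM)// -bm_RintegralZl; last exact: bm_kernel.
by apply: eq_Rintegral => x _; rewrite /gibbs/= -!expRD; congr expR; ring.
Qed.

Lemma gibbs_mass_f f g x : bm g ->
  \int[Q]_y gibbs f g (x, y) = expR (f x - sinkhorn_f g x).
Proof.
move=> bg; rewrite expRD (expR_softmin bc' c'M)// -bm_RintegralZl; last exact: bm_kernel.
by apply: eq_Rintegral => y _; rewrite /gibbs/= -!expRD; congr expR; rewrite /c'/=; ring.
Qed.

Lemma is_potentialsP f g :
  is_potentials c P Q (f, g) <-> schrodinger f g /\ \int[Q]_y g y = 0.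
Proof.
split.
  move=> [[mf bf] [mg bg] fE gE g0]; split => //.
  by split; [exact: bm_bounded_fun..| |] => x;
    rewrite /sinkhorn_f /sinkhorn_g softminE.
move=> [[bf bg fE gE] g0]; split => //.
- by split; [case: bf|exact: bounded_fun_bm].
- by split; [case: bg|exact: bounded_fun_bm].
- by move=> x; rewrite fE /sinkhorn_f softminE.
- by move=> y; rewrite gE /sinkhorn_g softminE.
Qed.

Lemma sinkhorn_g_osc f : bm f -> osc_le (sinkhorn_g f) (2 * M).
Proof. exact: softmin_osc. Qed.

Lemma sinkhorn_f_bound g B x : bm g -> (forall y, `|g y| <= B) ->
  `|sinkhorn_f g x| <= M + B.
Proof. exact: softmin_bound. Qed.

Definition sinkhorn_iter n : T -> R :=
  iter n (fun f => sinkhorn_f (sinkhorn_g f)) (fun=> 0).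

Lemma sinkhorn_iter0 x : sinkhorn_iter 0 x = 0. Proof. by []. Qed.

Lemma sinkhorn_iterS n :
  sinkhorn_iter n.+1 = sinkhorn_f (sinkhorn_g (sinkhorn_iter n)).
Proof. by []. Qed.

Lemma bm_sinkhorn_iter n : bm (sinkhorn_iter n).
Proof.
elim: n => [|n IH].
  have -> : sinkhorn_iter 0 = (fun=> 0) by exact/funext/sinkhorn_iter0.
  exact: bm_cst.
rewrite sinkhorn_iterS; exact/bm_sinkhorn_f/bm_sinkhorn_g.
Qed.

Lemma schrodingerK f g : schrodinger f g -> sinkhorn_f (sinkhorn_g f) = f.
Proof.
move=> [_ _ fE gE].
have -> : sinkhorn_g f = g by apply/funext => y; rewrite gE.
by apply/funext => x; rewrite fE.
Qed.

Lemma sinkhorn_iter_osc f g D n : schrodinger f g -> osc_le f D ->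
  osc_le (fun x => f x - sinkhorn_iter n x) (contraction_factor ^+ n * D).
Proof.
move=> s fD; have [bf _ _ _] := s; elim: n => [|n IH].
  by rewrite expr0 mul1r => x y; rewrite !sinkhorn_iter0 !subr0; exact: fD.
rewrite exprS -mulrA sinkhorn_iterS.
have := sinkhorn_contraction (bm_sinkhorn_iter n) bf IH.
by rewrite (schrodingerK s).
Qed.

Lemma contraction_cvg0 D : D * contraction_factor ^+ n @[n --> \oo] --> 0.
Proof.
have /andP[q0 q1] := contraction_factor_itv.
rewrite -(mulr0 D); apply: cvgM; first exact: cvg_cst.
by apply: cvg_expr; rewrite ger0_norm.
Qed.

Lemma contraction_le0 x D : (forall n, x <= D * contraction_factor ^+ n) -> x <= 0.
Proof.
move=> xD; apply: (cvgr_to_ge (contraction_cvg0 D)).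
by apply: nearW => n; exact: xD.
Qed.

Lemma contraction_cvg (u : nat -> R) l D :
  (forall n, `|l - u n| <= D * contraction_factor ^+ n) -> u n @[n --> \oo] --> l.
Proof.
move=> uD; apply/cvgrPdist_le => e e0.
have /cvgrPdist_le/(_ _ e0) := contraction_cvg0 D.
apply: filterS => n; rewrite sub0r normrN => h.
exact: le_trans (uD n) (le_trans (ler_norm _) h).
Qed.

Lemma bm_osc f : bm f -> exists D, osc_le f D.
Proof. by move=> [_ [B fB]]; exists (2 * B); exact: osc_le_norm. Qed.

(** Contraction gives convergence only modulo constants, so the iterates are pinned at [point]. The
    limit solves the system up to a constant [tau], and the total mass of the Gibbs density,
    computed in both orders, forces exp(- tau) = 1. *)
Lemma schrodinger_exists :
  exists f g, schrodinger f g /\ \int[Q]_y g y = 0.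
Proof.
have /andP[q0 q1] := contraction_factor_itv; set q := contraction_factor in q0 q1 *.
have [D0 oD0] := bm_osc (bm_sinkhorn_iter 1).
have oit n : osc_le (fun x => sinkhorn_iter n.+1 x - sinkhorn_iter n x) (D0 * q ^+ n).
  elim: n => [|n IH].
    move=> x y; rewrite expr0 mulr1 !sinkhorn_iter0 !subr0; exact: oD0.
  rewrite exprS mulrCA.
  have := sinkhorn_contraction (bm_sinkhorn_iter n) (bm_sinkhorn_iter n.+1) IH.
  by rewrite -!sinkhorn_iterS.
pose a n x := sinkhorn_iter n x - sinkhorn_iter n point.
have aD x n : `|a n.+1 x - a n x| <= D0 * q ^+ n.
  rewrite /a ler_norml; have := oit n x point; have := oit n point x; lra.
have q01 : 0 <= q < 1 by rewrite q0.
have [l lD] : {l : T -> R | forall x n, `|l x - a n x| <= D0 / (1 - q) * q ^+ n}.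
  pose ex x := cid (geometric_cauchy_lim q01 (aD x)).
  by exists (fun x => sval (ex x)) => x; exact: svalP (ex x).
have bl : bm l.
  split.
    apply: (@measurable_fun_cvg _ _ _ _ a) => [n|x _].
      by apply: measurable_funB => //; case: (bm_sinkhorn_iter n).
    exact: (contraction_cvg (lD x)).
  exists (D0 / (1 - q)) => x; have := lD x 0%N.
  by rewrite /a !sinkhorn_iter0 subrr subr0 expr0 mulr1.
set D := D0 / (1 - q) in lD.
have ol n : osc_le (fun x => l x - sinkhorn_iter n x) (2 * (D * q ^+ n)).
  move=> x y; have := lD x n; have := lD y n; rewrite /a !ler_norml; lra.
(* Limit and iterates stay close in oscillation before and after a sweep, so a sweep moves the limit
   only by a constant; the factor 4 D q collects two errors 2 D q^(n+1). *)
have oPl : osc_le (fun x => sinkhorn_f (sinkhorn_g l) x - l x) 0.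
  move=> x y; apply: (@contraction_le0 _ (4 * D * q)) => n.
  have := sinkhorn_contraction (bm_sinkhorn_iter n) bl (ol n) x y.
  have := ol n.+1 y x; rewrite -/q !exprS sinkhorn_iterS; lra.
pose tau := sinkhorn_f (sinkhorn_g l) point - l point.
have lE x : sinkhorn_f (sinkhorn_g l) x = l x + tau.
  by rewrite /tau -(osc_le0 point oPl x) addrC subrK.
have bgl := bm_sinkhorn_g bl.
have tau0 : tau = 0.
  have bG := bm_gibbs bl bgl.
  have := bm_Fubini P Q bG.
  under eq_Rintegral do rewrite gibbs_mass_f// lE opprD addrA subrr add0r.
  under [in RHS]eq_Rintegral do rewrite gibbs_mass_g// subrr expR0.
  rewrite !RintegralT_cst -[RHS]expR0 => /expR_inj /eqP.
  by rewrite oppr_eq0 => /eqP.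
pose s := \int[Q]_y sinkhorn_g l y.
exists (fun x => l x + s), (fun y => sinkhorn_g l y - s).
have bgs : bm (fun y => sinkhorn_g l y - s) by apply: bmB => //; exact: bm_cst.
split; first split => //.
- by apply: bmD => //; exact: bm_cst.
- by move=> x; rewrite sinkhorn_f_shift// lE tau0 addr0 opprK.
- by move=> y; rewrite sinkhorn_g_shift.
- by rewrite bm_RintegralB ?RintegralT_cst ?subrr//; exact: bm_cst.
Qed.

(** A function of mean 0 and oscillation at most 2 M is bounded by 2 M, and a further soft minimum
    adds [M]. The bounds are the same for all measures, in particular for the empirical ones. *)
Lemma schrodinger_bound f g : schrodinger f g -> \int[Q]_y g y = 0 ->
  (forall x, `|f x| <= 3 * M) /\ (forall y, `|g y| <= 2 * M).
Proof.
move=> [bf bg fE gE] g0.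
have og : osc_le g (2 * M).
  by move=> y y'; rewrite !gE; exact: sinkhorn_g_osc.
have gM y : `|g y| <= 2 * M.
  have -> : g y = \int[Q]_y' (g y - g y').
    by rewrite bm_RintegralB ?RintegralT_cst ?g0 ?subr0//; exact: bm_cst.
  apply: bm_norm_Rintegral_le.
    by apply: bmB => //; exact: bm_cst.
  by move=> y'; rewrite ler_norml; have := og y y'; have := og y' y; lra.
split => // x; rewrite fE.
have -> : 3 * M = M + 2 * M by ring.
exact: sinkhorn_f_bound.
Qed.

Lemma schrodinger_mass f g : schrodinger f g ->
  (forall x, \int[Q]_y gibbs f g (x, y) = 1) /\
  (forall y, \int[P]_x gibbs f g (x, y) = 1).
Proof.
move=> [bf bg fE gE]; split => [x|y].
  by rewrite gibbs_mass_f// -fE subrr expR0.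
by rewrite gibbs_mass_g// -gE subrr expR0.
Qed.

Lemma potentialsP :
  schrodinger (potential_f c P Q) (potential_g c P Q) /\
  \int[Q]_y potential_g c P Q y = 0.
Proof.
apply/is_potentialsP; rewrite /potential_f /potential_g -surjective_pairing.
have [f [g fg]] := schrodinger_exists.
apply: (xgetPex (cst 0, cst 0) (P := [set fg | is_potentials c P Q fg])).
by exists (f, g); exact/is_potentialsP.
Qed.

End schrodinger_system.

(** * Duality *)

Section density_measure.
Context d (U : measurableType d) (R : realType).
Variables (mu : probability U R) (rho : U -> R).
Hypotheses (mrho : measurable_fun setT rho) (rho0 : forall x, 0 <= rho x).
Hypothesis rho1 : (\int[mu]_x (rho x)%:E = 1)%E.

(** The proofs are arguments so that the set function determines them and can carry the structure of
    a probability. *)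
Definition density_measure of measurable_fun setT rho & (forall x, 0 <= rho x)
    & (\int[mu]_x (rho x)%:E = 1)%E : set U -> \bar R :=
  fun A => (\int[mu]_(x in A) (rho x)%:E)%E.

Local Notation nu := (density_measure mrho rho0 rho1).

Let nu_set0 : nu set0 = 0%E.
Proof. by rewrite /density_measure integral_set0. Qed.

Let nu_ge0 A : (0 <= nu A)%E.
Proof. by apply: integral_ge0 => x _; rewrite lee_fin. Qed.

Let nu_sigma_additive : semi_sigma_additive nu.
Proof.
move=> F mF tF mUF; rewrite /density_measure ge0_integral_bigcup//; last first.
- by move=> x _; rewrite lee_fin.
- by apply/measurable_EFinP; exact: measurable_funTS.
by apply: is_cvg_ereal_nneg_natsum_cond => n _ _; exact: nu_ge0.
Qed.

HB.instance Definition _ := isMeasure.Build _ _ _ nu nu_set0 nu_ge0 nu_sigma_additive.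

Let nu_setT : nu setT = 1%E.
Proof. exact: rho1. Qed.

HB.instance Definition _ := Measure_isProbability.Build _ _ _ nu nu_setT.

End density_measure.

(** * Relative entropy and its variational lower bound *)

Section relative_entropy.
Context d (U : measurableType d) (R : realType).
Local Open Scope ereal_scope.
Implicit Types (alpha beta : probability U R) (rho : U -> R).

Lemma measurable_lne_EFin rho : measurable_fun setT rho ->
  measurable_fun setT (fun z => lne (rho z)%:E).
Proof.
move=> mrho; rewrite /lne; apply: measurable_fun_ifT => //.
- exact: measurable_fun_ler.
- apply/measurable_EFinP; apply: measurableT_comp => //; exact: measurable_ln.
Qed.

(** A density equals the chosen Radon-Nikodym derivative [beta]-almost everywhere, hence by
    domination [alpha]-almost everywhere, which is what the integral sees. *)
Lemma KL_density alpha beta rho : measurable_fun setT rho ->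
  (forall x, (0 <= rho x)%R) ->
  (forall A, measurable A -> alpha A = \int[beta]_(x in A) (rho x)%:E) ->
  KL alpha beta = \int[alpha]_z lne (rho z)%:E.
Proof.
move=> mrho rho0 alphaE.
have dom : alpha `<< beta by exact: (density_dominates mrho alphaE).
rewrite /KL asboolT//.
set f := Radon_Nikodym _ _.
have ffin z : f z \is a fin_num.
  exact: (Radon_Nikodym_fin_num (nu := charge_of_finite_measure alpha)).
have fi : beta.-integrable setT f.
  exact: (Radon_Nikodym_integrable (nu := charge_of_finite_measure alpha)).
have mf : measurable_fun setT f by exact: measurable_int fi.
have fE : f = fun z => (fine (f z))%:E by apply/funext => z; rewrite fineK.
have frho : ae_eq alpha setT f (EFin \o rho).
  apply: (null_dominates_ae_eq _ dom) => //.
  apply: integral_ae_eq => //; first exact/measurable_EFinP.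
  move=> A _ mA; rewrite -alphaE//.
  by rewrite -(Radon_Nikodym_integral (nu := charge_of_finite_measure alpha)).
apply: ae_eq_integral => //.
- rewrite fE; apply: measurable_lne_EFin.
  exact: measurableT_comp.
- exact: measurable_lne_EFin.
- by apply: filterS frho => z fz Dz; rewrite /= fz.
Qed.

Lemma KL_alternative alpha beta : KL alpha beta = +oo \/
  exists rho, [/\ measurable_fun setT rho, forall x, (0 <= rho x)%R &
    forall A, measurable A -> alpha A = \int[beta]_(x in A) (rho x)%:E].
Proof.
have [dom|ndom] := pselect (alpha `<< beta); last first.
  by left; rewrite /KL asboolF.
right; pose f := Radon_Nikodym_SigmaFinite.f alpha beta.
have ffin z : f z \is a fin_num by exact: Radon_Nikodym_SigmaFinite.f_fin_num.
exists (fine \o f); split.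
- apply: measurableT_comp => //.
  exact: measurable_int (Radon_Nikodym_SigmaFinite.f_integrable dom).
- by move=> x; apply: fine_ge0; exact: Radon_Nikodym_SigmaFinite.f_ge0.
- move=> A mA; rewrite (Radon_Nikodym_SigmaFinite.f_integral dom mA).
  by apply: eq_integral => x _; rewrite /= fineK.
Qed.

(** Only [f] is integrable: the right side may be infinite, as an entropy can be. *)
Lemma le_integrable_integral (mu : {measure set U -> \bar R}) (f g : U -> \bar R) :
  mu.-integrable setT f -> measurable_fun setT g -> (forall x, f x <= g x) ->
  \int[mu]_x f x <= \int[mu]_x g x.
Proof.
move=> fi mg fg; have mf := measurable_int _ fi.
rewrite integralE [leRHS]integralE leeB//.
  apply: ge0_le_integral => //.
  - exact: measurable_funepos.
  - exact: measurable_funepos.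
  - by move=> x _; apply: (@funepos_le _ _ setT f g) => //; rewrite inE.
apply: ge0_le_integral => //.
- exact: measurable_funeneg.
- exact: measurable_funeneg.
- by move=> x _; apply: (@funeneg_le _ _ setT f g) => //; rewrite inE.
Qed.

(* Gibbs' variational principle: [ln r >= h + 1 - exp h / r] pointwise. *)
Lemma KL_ge alpha beta (h : U -> R) : bm h -> \int[beta]_z (expR (h z))%:E <= 1 ->
  \int[alpha]_z (h z)%:E <= KL alpha beta.
Proof.
move=> bh h1; have [->|[rho [mrho rho0 alphaE]]] := KL_alternative alpha beta.
  by rewrite leey.
have mh : measurable_fun setT h by case: bh.
(* This is exp h / rho where rho > 0; its [alpha]-integral is the [beta]-integral of exp h over that
   set, hence at most 1. *)
pose F z := (if rho z <= 0 then 0 else expR (h z - ln (rho z)))%R.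
have F0 z : (0 <= F z)%R by rewrite /F; case: ifP => // _; exact: expR_ge0.
have mF : measurable_fun setT F.
  apply: measurable_fun_ifT => //; first exact: measurable_fun_ler.
  apply: measurableT_comp => //; apply: measurable_funB => //.
  by apply: measurableT_comp => //; exact: measurable_ln.
have F1 : \int[alpha]_z (F z)%:E <= 1.
  rewrite (ge0_density_integral mrho alphaE)//; last exact/measurable_EFinP.
  apply: le_trans h1; apply: ge0_le_integral => //.
  - by move=> x _; rewrite -EFinM lee_fin mulr_ge0.
  - by apply: emeasurable_funM; exact/measurable_EFinP.
  - by apply/measurable_EFinP; exact: measurableT_comp.
  move=> x _; rewrite -EFinM lee_fin /F; case: ifPn => [_|].
    by rewrite mul0r expR_ge0.
  by rewrite -ltNge => r0; rewrite expRB lnK ?posrE// divfK ?gt_eqF.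
have Fi : alpha.-integrable setT (EFin \o F).
  apply/integrableP; split; first exact/measurable_EFinP.
  under eq_integral do rewrite /= ger0_norm//.
  by rewrite (le_lt_trans F1)// ltry.
pose w z := (h z + 1 - F z)%R.
have h1i : alpha.-integrable setT (EFin \o (fun z => h z + 1)%R).
  by apply: bm_integrable; apply: bmD => //; exact: bm_cst.
have wi : alpha.-integrable setT (EFin \o w).
  exact: (integrableB measurableT h1i Fi).
have mw : measurable_fun setT w.
  by apply: measurable_funB => //; apply: measurable_funD.
(* [lne] is [-oo] where [rho] vanishes; on that [alpha]-null set [w] is substituted, so that w <= l
   holds everywhere. *)
pose l z := if (rho z <= 0)%R then (w z)%:E else (ln (rho z))%:E.
have ml : measurable_fun setT l.
  apply: measurable_fun_ifT => //; [exact: measurable_fun_ler|exact/measurable_EFinP|].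
  by apply/measurable_EFinP; apply: measurableT_comp => //; exact: measurable_ln.
rewrite (KL_density mrho rho0 alphaE).
have -> : \int[alpha]_z lne (rho z)%:E = \int[alpha]_z l z.
  apply: ae_eq_integral => //; first exact: measurable_lne_EFin.
  have mN : measurable [set z | (rho z <= 0)%R].
    rewrite -[X in measurable X]setTI; exact: measurable_fun_le.
  exists [set z | (rho z <= 0)%R]; split => //.
    apply: etrans (alphaE _ mN) _; apply: integral0_eq => z /= rz.
    by congr (_%:E); apply/eqP; rewrite eq_le rz rho0.
  move=> z /=; apply: contra_notP => /negP; rewrite -ltNge => rz _.
  by rewrite /lne /l leNgt rz.
apply: (@le_trans _ _ (\int[alpha]_z (w z)%:E)); last first.
  apply: le_integrable_integral => // z; rewrite /l.
  case: ifPn => //; rewrite -ltNge => rz; rewrite lee_fin /w /F.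
  by rewrite [(rho z <= 0)%R]leNgt rz /=; have := expR_ge1Dx (h z - ln (rho z)); lra.
have -> : \int[alpha]_z (w z)%:E =
    \int[alpha]_z (h z + 1)%:E - \int[alpha]_z (F z)%:E by rewrite integralB_EFin.
have -> : \int[alpha]_z (h z + 1)%:E = \int[alpha]_z (h z)%:E + 1.
  rewrite -!bm_EFin_Rintegral//; last by apply: bmD => //; exact: bm_cst.
  by rewrite bm_RintegralD ?RintegralT_cst//; exact: bm_cst.
rewrite -bm_EFin_Rintegral//.
have : \int[alpha]_z (F z)%:E \is a fin_num by exact: integrable_fin_num.
move: F1 => /[swap]; case: (\int[alpha]_z (F z)%:E) => // r _; rewrite !lee_fin; lra.
Qed.

End relative_entropy.

Section duality.
Context d (T : measurableType d) (R : realType).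
Variables (c : T * T -> R) (M : R).
Hypotheses (bc : bm c) (cM : forall z, `|c z| <= M).
Variables P Q : probability T R.
Local Open Scope ereal_scope.

Lemma coupling_integral (pi : probability (T * T)%type R) (f g : T -> R) :
  coupling P Q pi -> bm f -> bm g ->
  (\int[pi]_z (f z.1 + g z.2) = \int[P]_x f x + \int[Q]_y g y)%R.
Proof.
move=> cpi bf bg.
have marginal (phi : T * T -> T) (mu : probability T R) (h : T -> R) :
    measurable_fun setT phi -> bm h ->
    (forall A, measurable A -> pi (phi @^-1` A) = mu A) ->
    (\int[pi]_z h (phi z) = \int[mu]_x h x)%R.
  move=> mphi bh E; pose X := mfun_Sub (mem_set mphi).
  have bhX := bm_comp bh mphi.
  transitivity (\int[distribution pi X]_x h x)%R.
    congr fine; rewrite integral_distribution//.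
      by apply/measurable_EFinP; case: bh.
    exact: bm_integrable.
  by congr fine; apply: eq_measure_integral => A mA _; exact: E.
rewrite bm_RintegralD; last 2 first.
- exact: (bm_comp bf measurable_fst).
- exact: (bm_comp bg measurable_snd).
congr (_ + _)%R; apply: marginal => // A mA.
- rewrite -(cpi A mA).1; congr (pi _).
  by apply/seteqP; split => z //= -[].
- rewrite -(cpi A mA).2; congr (pi _).
  by apply/seteqP; split => z //= -[].
Qed.

Variables f g : T -> R.
Hypothesis fg : schrodinger c P Q f g.

Let bf : bm f. Proof. by case: fg. Qed.
Let bg : bm g. Proof. by case: fg. Qed.
Let bG : bm (gibbs c f g). Proof. exact: bm_gibbs. Qed.

Let h z := (f z.1 + g z.2 - c z)%R.

Let bfg : bm (fun z : T * T => f z.1 + g z.2)%R.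
Proof.
apply: bmD; first exact: (bm_comp bf measurable_fst).
exact: (bm_comp bg measurable_snd).
Qed.

Let bh : bm h.
Proof. exact: bmB. Qed.

Let gibbs_prod (F : T * T -> R) : bm F ->
  \int[product_probability P Q]_z (F z)%:E = (\int[P]_x \int[Q]_y F (x, y))%R%:E.
Proof. by move=> bF; rewrite bm_Fubini_prod. Qed.

Let gibbs1 : \int[product_probability P Q]_z (gibbs c f g z)%:E = 1.
Proof.
rewrite gibbs_prod//; congr (_%:E).
under eq_Rintegral do rewrite (schrodinger_mass bc cM fg).1.
by rewrite RintegralT_cst.
Qed.

(** Couplings fix the integral of f + g, so minimizing cost plus entropy means minimizing the
    entropy minus the integral of [h]. *)
Let cost_split (pi : probability (T * T)%type R) : coupling P Q pi ->
  \int[pi]_z (c z)%:E + \int[pi]_z (h z)%:E =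
  (\int[P]_x f x + \int[Q]_y g y)%R%:E.
Proof.
move=> cpi; rewrite -!bm_EFin_Rintegral// -EFinD -bm_RintegralD//.
rewrite -(coupling_integral cpi)//; congr (_%:E).
by apply: eq_Rintegral => z _; rewrite /h addrC subrK.
Qed.

Let gibbs_measurable : measurable_fun setT (gibbs c f g).
Proof. by case: bG. Qed.

Let gibbs_ge0 z : (0 <= gibbs c f g z)%R.
Proof. exact: expR_ge0. Qed.

Let optimal : probability (T * T)%type R :=
  density_measure gibbs_measurable gibbs_ge0 gibbs1.

Let optimal_coupling : coupling P Q optimal.
Proof.
move=> A mA.
have bA : bm (\1_A : T -> R) by exact: bm_indic.
have E (B : set (T * T)) : measurable B ->
    optimal B = (\int[P]_x \int[Q]_y (gibbs c f g (x, y) * \1_B (x, y)))%R%:E.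
  move=> mB; rewrite -(@gibbs_prod (fun z => gibbs c f g z * \1_B z)%R); last first.
    by apply: bmM => //; exact: bm_indic.
  rewrite /optimal /= /density_measure integral_mkcond.
  by apply: eq_integral => z _; rewrite epatch_indic EFinM.
split.
  rewrite E; last exact: measurableX.
  transitivity ((\int[P]_x \1_A x)%R%:E); last first.
    by rewrite bm_EFin_Rintegral// integral_indic// setIT.
  congr (_%:E); apply: eq_Rintegral => x _.
  transitivity (\int[Q]_y (gibbs c f g (x, y) * \1_A x))%R.
    apply: eq_Rintegral => y _; congr (_ * _)%R.
    by rewrite !indicE in_setX in_setT andbT.
  rewrite bm_RintegralZr; last exact: (bm_pair1 bG).
  by rewrite (schrodinger_mass bc cM fg).1 mul1r.
rewrite E; last exact: measurableX.
have bGA : bm (fun z => gibbs c f g z * \1_(setT `*` A) z)%R.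
  by apply: bmM => //; apply: bm_indic; exact: measurableX.
rewrite (bm_Fubini P Q bGA).
transitivity ((\int[Q]_y \1_A y)%R%:E); last first.
  by rewrite bm_EFin_Rintegral// integral_indic// setIT.
congr (_%:E); apply: eq_Rintegral => y _.
transitivity (\int[P]_x (gibbs c f g (x, y) * \1_A y))%R.
  apply: eq_Rintegral => x _; congr (_ * _)%R.
  by rewrite !indicE in_setX in_setT.
rewrite bm_RintegralZr; last exact: (bm_pair2 bG).
by rewrite (schrodinger_mass bc cM fg).2 mul1r.
Qed.

(** Since exp h has mass 1 under the product measure, the variational principle bounds the entropy
    below by the integral of [h]; the coupling with density exp h attains the bound. *)
Lemma entropic_costE :
  entropic_cost c P Q = (\int[P]_x f x + \int[Q]_y g y)%R%:E.
Proof.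
apply/eqP; rewrite eq_le; apply/andP; split.
  apply: ereal_inf_lbound; exists optimal; first exact: optimal_coupling.
  rewrite (@KL_density _ _ _ _ _ (gibbs c f g))//.
  rewrite -(cost_split optimal_coupling); congr (_ + _).
  by apply: eq_integral => z _; rewrite lne_EFin ?expR_gt0// expRK.
apply: le_ereal_inf_tmp => _ [pi cpi <-].
rewrite -(cost_split cpi) leeD2l//; apply: KL_ge => //.
by rewrite gibbs1.
Qed.

End duality.

(** * Stability of the potentials *)

Section variance.
Context d (T : measurableType d) (R : realType) (P : probability T R).
Implicit Types h u : T -> R.

Definition var h := \int[P]_x (h x - \int[P]_y h y) ^+ 2.

Lemma fine_variance h : bm h -> fine 'V_P[h] = var h.
Proof.
move=> bh; rewrite /variance covariance.unlock expectation.unlock.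
by congr fine; apply: eq_integral => x _; rewrite !fctE /= -expr2.
Qed.

Lemma var_ge0 h : 0 <= var h.
Proof. by apply: Rintegral_ge0 => x _; exact: sqr_ge0. Qed.

Lemma bm_center h r : bm h -> bm (fun x => h x - r).
Proof. by move=> bh; apply: bmB => //; exact: bm_cst. Qed.

Lemma var_eq h : bm h -> var h = \int[P]_x h x ^+ 2 - (\int[P]_x h x) ^+ 2.
Proof.
move=> bh; rewrite /var; set m := Rintegral _ _ h.
transitivity (\int[P]_x (h x ^+ 2 - 2 * m * h x + m ^+ 2)).
  by apply: eq_Rintegral => x _; ring.
have bmh : bm (fun x => 2 * m * h x) by apply: bmM => //; exact: bm_cst.
rewrite bm_RintegralD; [|by apply: bmB => //; exact: bmX|exact: bm_cst].
rewrite bm_RintegralB//; last exact: bmX.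
by rewrite RintegralT_cst bm_RintegralZl// -/m; ring.
Qed.

Lemma var_shift h t : bm h -> var (fun x => h x + t) = var h.
Proof.
move=> bh; rewrite /var bm_RintegralD ?RintegralT_cst//; last exact: bm_cst.
by apply: eq_Rintegral => x _; congr (_ ^+ 2); ring.
Qed.

(** The linear term is handled by |u| <= eta + u^2/eta; [eta] stays free, to be balanced later
    against the L^2 size of [u]. *)
Lemma var_perturbation h u B eta : bm h -> bm u -> (forall x, `|h x| <= B) ->
  0 < eta ->
  `|var (fun x => h x + u x) - var h| <=
  4 * B * eta + (4 * B / eta + 1) * \int[P]_x u x ^+ 2.
Proof.
move=> bh bu hB eta0; have B0 : 0 <= B := le_trans (normr_ge0 _) (hB point).
pose m := \int[P]_x h x; pose r := \int[P]_x u x.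
have mB : `|m| <= B by exact: bm_norm_Rintegral_le.
have bX2 : bm (fun x => u x ^+ 2) by exact: bmX.
have cov : var (fun x => h x + u x) - var h =
    2 * \int[P]_x ((h x - m) * u x) + var u.
  rewrite !var_eq//; last exact: bmD.
  rewrite -/m -/r bm_RintegralD// -/m -/r.
  have -> : \int[P]_x (h x + u x) ^+ 2 = \int[P]_x h x ^+ 2 +
      2 * \int[P]_x (h x * u x) + \int[P]_x u x ^+ 2.
    rewrite -bm_RintegralZl; last exact: bmM.
    rewrite -bm_RintegralD; [|exact: bmX|exact: bmM (bm_cst _ _) (bmM bh bu)].
    rewrite -bm_RintegralD//; last first.
      by apply: bmD; [exact: bmX|exact: bmM (bm_cst _ _) (bmM bh bu)].
    by apply: eq_Rintegral => x _; ring.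
  have -> : \int[P]_x ((h x - m) * u x) = \int[P]_x (h x * u x) - m * r.
    rewrite -bm_RintegralZl// -bm_RintegralB; [|exact: bmM|exact: bmM (bm_cst _ _) bu].
    by apply: eq_Rintegral => x _; ring.
  by ring.
have vu : `|var u| <= \int[P]_x u x ^+ 2.
  rewrite ger0_norm ?var_ge0// var_eq// lerBlDr lerDl; exact: sqr_ge0.
have c1 : `|\int[P]_x ((h x - m) * u x)| <= 2 * B * (eta + \int[P]_x u x ^+ 2 / eta).
  have bhm : bm (fun x => (h x - m) * u x) by apply: bmM => //; exact: bm_center.
  apply: (le_trans (le_normr_Rintegral _ _)) => //; first exact: bm_integrable.
  rewrite mulrC [_ / eta]mulrC -bm_RintegralZl//.
  have b2 : bm (fun x => eta^-1 * u x ^+ 2) by apply: bmM => //; exact: bm_cst.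
  rewrite -{1}(RintegralT_cst P eta) -bm_RintegralD//; last exact: bm_cst.
  have b3 : bm (fun x => eta + eta^-1 * u x ^+ 2) by apply: bmD => //; exact: bm_cst.
  rewrite -bm_RintegralZr//; apply: bm_le_Rintegral.
  - exact: bm_norm.
  - by apply: bmM => //; exact: bm_cst.
  move=> x; rewrite normrM mulrC ler_pM//.
    have -> : u x ^+ 2 = `|u x| ^+ 2 by rewrite real_normK ?num_real.
    have [le|gt] := leP `|u x| eta.
      by rewrite (le_trans le)// lerDl mulr_ge0 ?invr_ge0 ?sqr_ge0// ltW.
    rewrite -[leLHS]add0r lerD ?(ltW eta0)// mulrC ler_pdivlMr// expr2.
    by rewrite ler_wpM2l// ltW.
  by rewrite (le_trans (ler_normB _ _))// mulr2n mulrDl mul1r lerD.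
rewrite cov; apply: (le_trans (ler_normD _ _)).
rewrite normrM (ger0_norm (_ : 0 <= 2))//.
rewrite (_ : _ + _ * _ = 2 * (2 * B * (eta + \int[P]_x u x ^+ 2 / eta)) +
  \int[P]_x u x ^+ 2); last by field; rewrite gt_eqF.
by apply: lerD => //; rewrite ler_wpM2l.
Qed.

End variance.

(** For w >= -2, square 1 + w/2 <= exp(w/2). For w < -2 the left side is negative: the constant 4 +
    2 L keeps the quadratic term below -w/2. *)
Lemma expR_quadratic (R : realType) (L w : R) : 0 <= L -> `|w| <= L ->
  1 + w + (4 + 2 * L)^-1 * w ^+ 2 <= expR w.
Proof.
move=> L0; rewrite ler_norml => /andP[Lw wL].
have L4 : 0 < 4 + 2 * L by lra.
have [w2|w2] := leP (-2) w.
  have e0 : 0 <= 1 + w / 2 by lra.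
  have e1 : 1 + w / 2 <= expR (w / 2) by exact: expR_ge1Dx.
  have -> : expR w = expR (w / 2) ^+ 2.
    by rewrite expr2 -expRD; congr expR; field.
  apply: (@le_trans _ _ ((1 + w / 2) ^+ 2)); last by rewrite lerXn2r ?nnegrE ?expR_ge0.
  have -> : (1 + w / 2) ^+ 2 = 1 + w + 4^-1 * w ^+ 2 by field.
  rewrite lerD2l ler_wpM2r ?sqr_ge0// lef_pV2 ?posrE//; lra.
apply: (@le_trans _ _ 0); last exact: expR_ge0.
have : (4 + 2 * L)^-1 * w ^+ 2 <= - w / 2.
  rewrite mulrC ler_pdivrMr//; nra.
lra.
Qed.

Section product_Rintegral.
Context d (T : measurableType d) (R : realType) (P Q : probability T R).
Variable F : T * T -> R.
Hypothesis bF : bm F.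

Lemma product_Rintegral12 :
  \int[product_probability P Q]_z F z = \int[P]_x \int[Q]_y F (x, y).
Proof. by rewrite /Rintegral -(bm_Fubini_prod P Q bF). Qed.

Lemma product_Rintegral21 :
  \int[product_probability P Q]_z F z = \int[Q]_y \int[P]_x F (x, y).
Proof. by rewrite product_Rintegral12 bm_Fubini. Qed.

End product_Rintegral.

(** 7 M = 3 M + 3 M + M bounds the exponent of a Gibbs density with potentials at most 3 M, and 12 M
    bounds the change of f + g between two such pairs. *)
Definition convexity_modulus (R : realType) (M : R) : R :=
  expR (- (7 * M)) * (4 + 2 * (12 * M))^-1.

Section perturbation.
Context d (T : measurableType d) (R : realType).
Variables (c : T * T -> R) (M : R).
Hypotheses (bc : bm c) (cM : forall z, `|c z| <= M).
Variables (f g : T -> R) (P' Q' : probability T R) (f' g' : T -> R).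
Hypotheses (bf : bm f) (bg : bm g).
Hypotheses (fM : forall x, `|f x| <= 3 * M) (gM : forall x, `|g x| <= 3 * M).
Hypotheses (fM' : forall x, `|f' x| <= 3 * M) (gM' : forall x, `|g' x| <= 3 * M).
Hypothesis fg' : schrodinger c P' Q' f' g'.

(** Marginal defects of the density of [(f, g)] for [P'] and [Q']. These measures have [(f', g')] as
    potentials; in the application [(f, g)] is the population pair. *)
Definition gibbs_defect_f x := 1 - \int[Q']_y gibbs c f g (x, y).
Definition gibbs_defect_g y := 1 - \int[P']_x gibbs c f g (x, y).
Definition gibbs_defect :=
  1 - \int[P']_x \int[Q']_y gibbs c f g (x, y).

Local Notation PQ := (product_probability P' Q').
Local Notation kap := (convexity_modulus M).
Local Notation A := gibbs_defect_f.
Local Notation B := gibbs_defect_g.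

Let xi := gibbs c f g.
Let xi' := gibbs c f' g'.
Let u x := f' x - f x.
Let v y := g' y - g y.
Let w z := u z.1 + v z.2.
Let G := \int[P']_x u x + \int[Q']_y v y.

Let M0 : 0 <= M.
Proof. exact: le_trans (normr_ge0 _) (cM point). Qed.

Lemma convexity_modulus_gt0 : 0 < kap.
Proof. by rewrite mulr_gt0 ?expR_gt0// invr_gt0; have := M0; lra. Qed.

Let bf' : bm f'. Proof. by case: fg'. Qed.
Let bg' : bm g'. Proof. by case: fg'. Qed.
Let bu : bm u. Proof. exact: bmB. Qed.
Let bv : bm v. Proof. exact: bmB. Qed.
Let b1 (h : T -> R) : bm h -> bm (fun z : T * T => h z.1).
Proof. by move=> bh; exact: (bm_comp bh measurable_fst). Qed.
Let b2 (h : T -> R) : bm h -> bm (fun z : T * T => h z.2).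
Proof. by move=> bh; exact: (bm_comp bh measurable_snd). Qed.
Let bw : bm w. Proof. by apply: bmD; [exact: b1|exact: b2]. Qed.
Let bxi : bm xi. Proof. exact: bm_gibbs. Qed.
Let bxi' : bm xi'. Proof. exact: bm_gibbs. Qed.

Let bA : bm A.
Proof. by apply: bmB; [exact: bm_cst|exact: bm_Rintegral1]. Qed.

Let bB : bm B.
Proof. by apply: bmB; [exact: bm_cst|exact: bm_Rintegral2]. Qed.

Let wM z : `|w z| <= 12 * M.
Proof.
have h1 := fM z.1; have h2 := gM z.2; have h3 := fM' z.1; have h4 := gM' z.2.
by move: h1 h2 h3 h4; rewrite /w /u /v !ler_norml; lra.
Qed.

Let gibbs_ge (h k : T -> R) z : (forall x, `|h x| <= 3 * M) ->
  (forall x, `|k x| <= 3 * M) -> expR (- (7 * M)) <= gibbs c h k z.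
Proof.
move=> hM kM; rewrite ler_expR; have := hM z.1; have := kM z.2; have := cM z.
by rewrite !ler_norml; lra.
Qed.

(** Strong convexity of the exponential, uniform because a Gibbs density with bounded potentials is
    bounded below. It is used from [xi] to [xi'] and from [xi'] to [xi]. *)
Let strong (h k h' k' : T -> R) z (r : R) : (forall x, `|h x| <= 3 * M) ->
  (forall x, `|k x| <= 3 * M) -> `|r| <= 12 * M ->
  h' z.1 + k' z.2 = h z.1 + k z.2 + r ->
  gibbs c h k z + gibbs c h k z * r + kap * r ^+ 2 <= gibbs c h' k' z.
Proof.
move=> hM kM rM E.
have -> : gibbs c h' k' z = gibbs c h k z * expR r.
  by rewrite /gibbs -expRD; congr expR; rewrite E; ring.
have M12 : 0 <= 12 * M by rewrite mulr_ge0.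
have := expR_quadratic M12 rM; have := gibbs_ge z hM kM; have := expR_gt0 (- (7 * M)).
rewrite /kap; set a := expR _; set b := gibbs _ _ _ _; set e := expR r.
have : 0 <= (4 + 2 * (12 * M))^-1 * r ^+ 2.
  by rewrite mulr_ge0 ?sqr_ge0// invr_ge0; have := M0; lra.
rewrite -[a * _ * _]mulrA; set q := _^-1 * _ => q0 a0 ab qe.
have h1 : b * (1 + r + q) <= b * e by rewrite ler_wpM2l//; lra.
have h2 : a * q <= b * q by rewrite ler_wpM2r.
lra.
Qed.

Let W2 := \int[PQ]_z w z ^+ 2.

Let E1 : \int[PQ]_z xi' z = 1.
Proof.
rewrite product_Rintegral12//; under eq_Rintegral do rewrite (schrodinger_mass bc cM fg').1.
exact: RintegralT_cst.
Qed.

Let E1w : \int[PQ]_z (xi' z * w z) = G.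
Proof.
rewrite /G /w; transitivity (\int[PQ]_z (xi' z * u z.1 + xi' z * v z.2)).
  by apply: eq_Rintegral => z _; rewrite mulrDr.
rewrite bm_RintegralD; [|exact: bmM (b1 bu)|exact: bmM (b2 bv)].
congr (_ + _).
  rewrite product_Rintegral12; last exact: bmM (b1 bu).
  apply: eq_Rintegral => x _ /=; rewrite bm_RintegralZr; last exact: (bm_pair1 bxi').
  by rewrite (schrodinger_mass bc cM fg').1 mul1r.
rewrite product_Rintegral21; last exact: bmM (b2 bv).
apply: eq_Rintegral => y _ /=; rewrite bm_RintegralZr; last exact: (bm_pair2 bxi').
by rewrite (schrodinger_mass bc cM fg').2 mul1r.
Qed.

Let E2w : \int[PQ]_z (xi z * w z) =
  G - \int[P']_x (u x * A x) - \int[Q']_y (v y * B y).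
Proof.
rewrite /G /w; transitivity (\int[PQ]_z (xi z * u z.1 + xi z * v z.2)).
  by apply: eq_Rintegral => z _; rewrite mulrDr.
rewrite bm_RintegralD; [|exact: bmM (b1 bu)|exact: bmM (b2 bv)].
have aux (p q r s : R) : p + q - r - s = (p - r) + (q - s) by ring.
rewrite aux -bm_RintegralB//; last exact: bmM.
rewrite -bm_RintegralB//; last exact: bmM.
congr (_ + _).
  rewrite product_Rintegral12; last exact: bmM (b1 bu).
  apply: eq_Rintegral => x _ /=; rewrite bm_RintegralZr; last exact: (bm_pair1 bxi).
  by rewrite /gibbs_defect_f; move: (u x) (Rintegral _ _ _) => p q; ring.
rewrite product_Rintegral21; last exact: bmM (b2 bv).
apply: eq_Rintegral => y _ /=; rewrite bm_RintegralZr; last exact: (bm_pair2 bxi).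
by rewrite /gibbs_defect_g; move: (v y) (Rintegral _ _ _) => p q; ring.
Qed.

Let E2 : \int[PQ]_z xi z = 1 - gibbs_defect.
Proof. by rewrite /gibbs_defect -product_Rintegral12// opprB addrCA subrr addr0. Qed.

Let bkw : bm (fun z => kap * w z ^+ 2).
Proof. by apply: bmM; [exact: bm_cst|exact: bmX]. Qed.

Let upper : 1 - gibbs_defect +
  (G - \int[P']_x (u x * A x) - \int[Q']_y (v y * B y)) + kap * W2 <= 1.
Proof.
rewrite -E2 -E2w /W2 -bm_RintegralZl; last exact: bmX.
rewrite -bm_RintegralD//; last exact: bmM.
rewrite -bm_RintegralD//; last by apply: bmD => //; exact: bmM.
rewrite -[leRHS]E1; apply: bm_le_Rintegral => //.
  by apply: bmD => //; apply: bmD => //; exact: bmM.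
by move=> z; apply: strong => //; rewrite /w /u /v; ring.
Qed.

Let lower : 1 - G + kap * W2 <= 1 - gibbs_defect.
Proof.
rewrite -E2 -{1}E1 -E1w /W2 -bm_RintegralZl; last exact: bmX.
rewrite -bm_RintegralB//; last exact: bmM.
rewrite -bm_RintegralD//; last by apply: bmB => //; exact: bmM.
apply: bm_le_Rintegral => //.
  by apply: bmD => //; apply: bmB => //; exact: bmM.
move=> z; have := @strong f' g' f g z (- w z) fM' gM'.
rewrite normrN mulrN sqrrN; apply => //.
by rewrite /w /u /v; ring.
Qed.

Let t := \int[Q']_y v y.

(** [v - t] has mean 0 under [Q'], so the cross term vanishes under the product measure: the L^2
    norm of [w] controls both potentials modulo one common constant. *)
Let W2E : W2 = \int[P']_x (u x + t) ^+ 2 + \int[Q']_y (v y - t) ^+ 2.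
Proof.
have but : bm (fun x => u x + t) by apply: bmD => //; exact: bm_cst.
have bvt : bm (fun y => v y - t) by exact: bm_center.
transitivity (\int[PQ]_z ((u z.1 + t) ^+ 2 + (v z.2 - t) ^+ 2 +
    2 * ((u z.1 + t) * (v z.2 - t)))).
  by apply: eq_Rintegral => z _; rewrite /w; ring.
have bx : bm (fun z : T * T => (u z.1 + t) * (v z.2 - t)).
  by apply: bmM; [exact: (b1 but)|exact: (b2 bvt)].
have bX1 : bm (fun z : T * T => (u z.1 + t) ^+ 2) by exact: (b1 (bmX 2 but)).
have bX2 : bm (fun z : T * T => (v z.2 - t) ^+ 2) by exact: (b2 (bmX 2 bvt)).
rewrite bm_RintegralD; [|exact: bmD|exact: bmM (bm_cst _ _) bx].
rewrite bm_RintegralD// bm_RintegralZl//.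
have -> : \int[PQ]_z ((u z.1 + t) * (v z.2 - t)) = 0.
  rewrite product_Rintegral12//= -[RHS](RintegralT_cst P').
  apply: eq_Rintegral => x _; rewrite bm_RintegralZl//.
  by rewrite bm_RintegralB ?RintegralT_cst ?subrr ?mulr0//; exact: bm_cst.
rewrite mulr0 addr0; congr (_ + _).
  rewrite product_Rintegral12//=.
  by apply: eq_Rintegral => x _; exact: RintegralT_cst.
rewrite product_Rintegral21//=.
by apply: eq_Rintegral => x _; exact: RintegralT_cst.
Qed.

Let Delta := \int[P']_x A x ^+ 2 + \int[Q']_y B y ^+ 2.

(** [A] and [B] have the same mean [gibbs_defect], so u can be shifted by t and v by -t without
    changing the sum. This matches the two squares in [W2E], and a weighted arithmetic-geometric
    mean inequality applies to each. *)
Let defect_bound : \int[P']_x (u x * A x) + \int[Q']_y (v y * B y) <=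
  kap * W2 + Delta / (4 * kap).
Proof.
have k0 := convexity_modulus_gt0.
have but : bm (fun x => u x + t) by apply: bmD => //; exact: bm_cst.
have bvt : bm (fun y => v y - t) by exact: bm_center.
have IA : \int[P']_x A x = gibbs_defect.
  rewrite bm_RintegralB ?RintegralT_cst//; [exact: bm_cst|exact: bm_Rintegral1].
have IB : \int[Q']_y B y = gibbs_defect.
  rewrite bm_RintegralB ?RintegralT_cst//; [|exact: bm_cst|exact: bm_Rintegral2].
  by rewrite /gibbs_defect bm_Fubini.
have -> : \int[P']_x (u x * A x) = \int[P']_x ((u x + t) * A x) - t * gibbs_defect.
  rewrite -IA -bm_RintegralZl// -bm_RintegralB; [|exact: bmM|exact: bmM (bm_cst _ _) bA].
  by apply: eq_Rintegral => x _; ring.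
have -> : \int[Q']_y (v y * B y) = \int[Q']_y ((v y - t) * B y) + t * gibbs_defect.
  rewrite -IB -bm_RintegralZl// -bm_RintegralD; [|exact: bmM|exact: bmM (bm_cst _ _) bB].
  by apply: eq_Rintegral => x _; ring.
rewrite addrACA addNr addr0 W2E /Delta mulrDl mulrDr addrACA.
have amgm (S : probability T R) (p q : T -> R) : bm p -> bm q ->
    \int[S]_x (p x * q x) <=
    kap * \int[S]_x p x ^+ 2 + (\int[S]_x q x ^+ 2) / (4 * kap).
  move=> bp bq; rewrite -bm_RintegralZl; last exact: bmX.
  rewrite -bm_RintegralZr; last exact: bmX.
  have bp2 : bm (fun x => kap * p x ^+ 2) by apply: bmM (bm_cst _ _) _; exact: bmX.
  have bq2 : bm (fun x => q x ^+ 2 / (4 * kap)) by apply: bmM _ (bm_cst _ _); exact: bmX.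
  rewrite -bm_RintegralD//; apply: bm_le_Rintegral; [exact: bmM|exact: bmD|].
  move=> x; rewrite -subr_ge0.
  have -> : kap * p x ^+ 2 + q x ^+ 2 / (4 * kap) - p x * q x =
      (2 * kap * p x - q x) ^+ 2 / (4 * kap) by field; rewrite gt_eqF.
  by rewrite divr_ge0 ?sqr_ge0// mulr_ge0// ltW.
by apply: lerD; exact: amgm.
Qed.

(** [lower] makes the gap nonnegative; in [upper] the quadratic term cancels that of [defect_bound],
    leaving an error quadratic in the defects. *)
Lemma dual_gap_bound :
  0 <= G - gibbs_defect <= Delta / (4 * kap).
Proof.
have k0 := convexity_modulus_gt0.
have W0 : 0 <= kap * W2.
  by rewrite mulr_ge0 ?(ltW k0)//; apply: Rintegral_ge0 => z _; exact: sqr_ge0.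
have := upper; have := lower; have := defect_bound; lra.
Qed.

(** Adding [upper] and [lower] produces the quadratic term twice, and [defect_bound] uses up only
    one copy. *)
Lemma potential_perturbation : exists s,
  \int[P']_x (u x + s) ^+ 2 <= Delta / (4 * kap ^+ 2) /\
  \int[Q']_y (v y - s) ^+ 2 <= Delta / (4 * kap ^+ 2).
Proof.
have k0 := convexity_modulus_gt0.
exists t.
have I1 : 0 <= \int[P']_x (u x + t) ^+ 2 by apply: Rintegral_ge0 => x _; exact: sqr_ge0.
have I2 : 0 <= \int[Q']_y (v y - t) ^+ 2 by apply: Rintegral_ge0 => x _; exact: sqr_ge0.
have W2D : W2 <= Delta / (4 * kap ^+ 2).
  rewrite -(ler_pM2l k0) (_ : kap * (Delta / _) = Delta / (4 * kap)); last first.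
    by field; rewrite gt_eqF.
  by have := upper; have := lower; have := defect_bound; lra.
by move: W2D; rewrite W2E; split; lra.
Qed.

End perturbation.

(** * Moments of empirical averages *)

Lemma Rintegral_empirical d (T : measurableType d) (R : realType) n
    (n_gt0 : (0 < n)%N) (x : nat -> T) (h : T -> R) : bm h ->
  \int[empirical n_gt0 x]_z h z = n%:R^-1 * \sum_(i < n) h (x i).
Proof.
move=> bh; pose P : probability T R := empirical n_gt0 x.
have ge0 (k : T -> R) : bm k -> (forall z, 0 <= k z) ->
    \int[P]_z k z = n%:R^-1 * \sum_(i < n) k (x i).
  move=> bk k0; have mk : measurable_fun setT (EFin \o k).
    by apply/measurable_EFinP; case: bk.
  rewrite /Rintegral ge0_integral_mscale//; last by move=> z _; rewrite lee_fin.
  rewrite ge0_integral_measure_sum//; last by move=> z _; rewrite lee_fin.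
  rewrite (eq_bigr (fun i : 'I_n => (k (x i))%:E)).
    by rewrite sumEFin -EFinM.
  by move=> i _; rewrite integral_dirac// diracT mul1e.
have [_ [B hB]] := bh.
have := ge0 (fun z => h z + B) (bmD bh (bm_cst _ _)).
rewrite bm_RintegralD//; last exact: bm_cst.
rewrite RintegralT_cst big_split/= sumr_const card_ord mulrDr => E.
apply: (addIr B); rewrite E; last first.
  by move=> z; move: (hB z); rewrite ler_norml; lra.
congr (_ + _); rewrite -[B *+ n]mulr_natl mulrA mulVf ?mul1r//.
by rewrite pnatr_eq0 -lt0n.
Qed.

Lemma second_moment_sum d (W : measurableType d) (R : realType)
    (Pr : probability W R) (I : finType) (a : I -> W -> R) B :
  (forall k, bm (a k)) -> (forall k w, `|a k w| <= B) ->
  (forall k l, k != l -> \int[Pr]_w (a k w * a l w) = 0) ->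
  \int[Pr]_w (\sum_k a k w) ^+ 2 <= #|I|%:R * B ^+ 2.
Proof.
move=> ba aB orth.
have baa k l : bm (fun w => a k w * a l w) by exact: bmM.
have -> : \int[Pr]_w (\sum_k a k w) ^+ 2 = \sum_k \int[Pr]_w (a k w * a k w).
  transitivity (\int[Pr]_w \sum_k \sum_l (a k w * a l w)).
    apply: eq_Rintegral => w _; rewrite expr2 big_distrl/=.
    by apply: eq_bigr => k _; rewrite big_distrr.
  rewrite bm_Rintegral_sum; last by move=> k; exact: bm_sum.
  apply: eq_bigr => k _; rewrite bm_Rintegral_sum//.
  rewrite (bigD1 k)//= big1 ?addr0// => l lk.
  by apply: orth; rewrite eq_sym.
apply: (@le_trans _ _ (\sum_(k : I) B ^+ 2)); last by rewrite sumr_const mulr_natl.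
apply: ler_sum => k _; apply: bm_Rintegral_le => // w.
rewrite -expr2 -(real_normK (num_real _)) lerXn2r ?nnegrE//.
exact: le_trans (aB k w).
Qed.

(** * Orthogonality of functions of sample pairs *)

Section samples.
Context d (W : measurableType d) (R : realType) (Pr : probability W R).
Context d' (T : measurableType d') (Z : nat + nat -> W -> T).
Variables P Q : probability T R.
Hypothesis lawX : forall i, has_law Pr (Z (inl i)) P.
Hypothesis lawY : forall j, has_law Pr (Z (inr j)) Q.
Hypothesis iZ : mutually_independent Pr Z.

Lemma measurable_sample k : measurable_fun setT (Z k).
Proof. by case: k => k; [case: (lawX k)|case: (lawY k)]. Qed.

Let mZ := measurable_sample.

Lemma indep_factor k (s : seq (nat + nat)) (S : probability T R) (phi : T -> R)
    (y : g_sigma_algebraType (cylinder Z s) -> R) :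
  k \notin s -> uniq s -> has_law Pr (Z k) S -> bm phi -> bm y ->
  \int[Pr]_w (phi (Z k w) * y w) = \int[S]_z phi z * \int[Pr]_w y w.
Proof.
move=> ks us lawk bphi by_.
have bF : bm (fun p : g_sigma_algebraType (cylinder Z s) * T => phi p.2 * y p.1).
  by apply: bmM; [exact: (bm_comp bphi measurable_snd)|exact: (bm_comp by_ measurable_fst)].
rewrite (indep_Rintegral mZ iZ us ks lawk bF) /=.
under eq_Rintegral do rewrite bm_RintegralZr//.
have [my By] := by_.
rewrite bm_RintegralZl//; split => // _ A mA.
rewrite setTI; have := my measurableT A mA; rewrite setTI.
exact: sigma_cylinder_measurable.
Qed.

Variable eta : T * T -> R.
Hypothesis beta : bm eta.

Let e (k : nat * nat) w := eta (Z (inl k.1) w, Z (inr k.2) w).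

Lemma bm_sample_pair k : bm (e k).
Proof. by apply: (bm_comp beta); exact: measurable_fun_pair. Qed.

Lemma cross_moment_x k l : (forall y, \int[P]_x eta (x, y) = 0) ->
  k.1 != l.1 -> \int[Pr]_w (e k w * e l w) = 0.
Proof.
(* [undup] because [k.2] and [l.2] may coincide; [Z (inl k.1)] differs from all listed variables and
   is integrated out first. *)
move=> eta0 kl; pose s : seq (nat + nat) := undup [:: inr k.2; inl l.1; inr l.2].
have ks : inl k.1 \notin s.
  by rewrite mem_undup !inE /= orbF; apply: contra kl => /eqP[->].
have mS i : i \in s -> measurable_fun setT (Z i : g_sigma_algebraType (cylinder Z s) -> T).
  exact: measurable_cylinder.
have bF : bm (fun p : g_sigma_algebraType (cylinder Z s) * T =>
    eta (p.2, Z (inr k.2) p.1) * eta (Z (inl l.1) p.1, Z (inr l.2) p.1)).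
  apply: bmM; apply: (bm_comp beta); apply: measurable_fun_pair => //;
    (apply: (measurableT_comp (mS _ _)); last exact: measurable_fst);
    by rewrite mem_undup !inE eqxx ?orbT.
rewrite (indep_Rintegral mZ iZ (undup_uniq _) ks (lawX k.1) bF) /=.
rewrite -[RHS](RintegralT_cst Pr); apply: eq_Rintegral => w _.
by rewrite bm_RintegralZr ?eta0 ?mul0r//; exact: bm_pair2.
Qed.

Lemma cross_moment_y k l : (forall x, \int[Q]_y eta (x, y) = 0) ->
  k.2 != l.2 -> \int[Pr]_w (e k w * e l w) = 0.
Proof.
move=> eta0 kl; pose s : seq (nat + nat) := undup [:: inl k.1; inl l.1; inr l.2].
have ks : inr k.2 \notin s.
  by rewrite mem_undup !inE /=; apply: contra kl => /eqP[->].
have mS i : i \in s -> measurable_fun setT (Z i : g_sigma_algebraType (cylinder Z s) -> T).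
  exact: measurable_cylinder.
have bF : bm (fun p : g_sigma_algebraType (cylinder Z s) * T =>
    eta (Z (inl k.1) p.1, p.2) * eta (Z (inl l.1) p.1, Z (inr l.2) p.1)).
  apply: bmM; apply: (bm_comp beta); apply: measurable_fun_pair => //;
    (apply: (measurableT_comp (mS _ _)); last exact: measurable_fst);
    by rewrite mem_undup !inE eqxx ?orbT.
rewrite (indep_Rintegral mZ iZ (undup_uniq _) ks (lawY k.2) bF) /=.
rewrite -[RHS](RintegralT_cst Pr); apply: eq_Rintegral => w _.
by rewrite bm_RintegralZr ?eta0 ?mul0r//; exact: bm_pair1.
Qed.

End samples.

(** * Measurability of the statistics *)

Section softmin_lipschitz.
Context d1 d2 (T1 : measurableType d1) (T2 : measurableType d2) (R : realType).
Variables (k : T1 * T2 -> R) (M : R).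
Hypotheses (bk : bm k) (kM : forall z, `|k z| <= M).
Variable P : probability T1 R.
Implicit Types f : T1 -> R.

Lemma softmin_le f f' y : bm f -> bm f' -> (forall x, f x <= f' x) ->
  softmin k P f' y <= softmin k P f y.
Proof.
move=> bf bf' ff'; rewrite !softminE lerN2.
have h0 := kernel_gt0 bk kM P y bf; have h0' := kernel_gt0 bk kM P y bf'.
have : \int[P]_x (expR (- k (x, y)) * expR (f x)) <=
    \int[P]_x (expR (- k (x, y)) * expR (f' x)).
  apply: bm_le_Rintegral; [exact: bm_kernel..|].
  by move=> x; rewrite ler_wpM2l ?expR_ge0// ler_expR.
by move: h0 h0'; move: (\int[P]_x _) (\int[P]_x _) => a b a0 b0 ab; rewrite ler_ln.
Qed.

(** Order reversal and compatibility with constants imply nonexpansiveness for the supremum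
    distance. *)
Lemma softmin_lipschitz f f' eps y : bm f -> bm f' ->
  (forall x, `|f x - f' x| <= eps) ->
  `|softmin k P f y - softmin k P f' y| <= eps.
Proof.
move=> bf bf' ff'.
have half g g' : bm g -> bm g' -> (forall x, `|g x - g' x| <= eps) ->
    softmin k P g' y - eps <= softmin k P g y.
  move=> bg bg' gg'; rewrite -(softmin_shift bk kM P eps y bg').
  apply: softmin_le => //; first by apply: bmD => //; exact: bm_cst.
  by move=> x; have := gg' x; rewrite ler_norml; lra.
have h1 := half _ _ bf bf' ff'.
have h2 : softmin k P f y - eps <= softmin k P f' y.
  by apply: half => // x; rewrite distrC.
by move: h1 h2; move: (softmin _ _ _ _) (softmin _ _ _ _) => a b; rewrite ler_norml; lra.
Qed.

End softmin_lipschitz.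

(** A shift of [k] turns the oscillation bound into a supremum bound; then [var_perturbation]
    applies with eta = eps. It requires a positive eta, so eps = 0 is treated apart. *)
Lemma var_lipschitz d (T : measurableType d) (R : realType) (P : probability T R)
    (h k : T -> R) B eps : bm h -> bm k -> (forall x, `|h x| <= B) ->
  osc_le (fun x => h x - k x) eps ->
  `|var P h - var P k| <= 8 * B * eps + eps ^+ 2.
Proof.
move=> bh bk hB osc; pose r := h point - k point.
have e0 : 0 <= eps := osc_le_ge0 point osc.
pose u x := k x + r - h x.
have bkr : bm (fun x => k x + r) by apply: bmD => //; exact: bm_cst.
have bu : bm u by exact: bmB.
have ue x : `|u x| <= eps.
  by have := osc x point; have := osc point x; rewrite /u /r ler_norml; lra.
have kE : var P k = var P (fun x => h x + u x).
  rewrite -(var_shift P r bk); congr (var P _).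
  by apply/funext => x; rewrite /u; ring.
have B0 : 0 <= B := le_trans (normr_ge0 _) (hB point).
rewrite kE distrC; move: e0; rewrite le_eqVlt => /predU1P[e0|e0].
  have -> : (fun x => h x + u x) = h.
    apply/funext => x; have := ue x; rewrite -e0 normr_le0 => /eqP ->.
    by rewrite addr0.
  by rewrite subrr normr0 -e0 mulr0 expr0n addr0.
apply: (le_trans (var_perturbation P bh bu hB e0)).
have u2 : \int[P]_x u x ^+ 2 <= eps ^+ 2.
  apply: bm_Rintegral_le; first exact: bmX.
  move=> x; rewrite -(real_normK (num_real (u x))) lerXn2r ?nnegrE ?(ltW e0)//.
have c0 : 0 <= 4 * B / eps + 1 by rewrite addr_ge0// divr_ge0 ?mulr_ge0// ltW.
apply: (@le_trans _ _ (4 * B * eps + (4 * B / eps + 1) * eps ^+ 2)).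
  by rewrite lerD2l ler_wpM2l.
by rewrite le_eqVlt; apply/orP; left; apply/eqP; field; rewrite gt_eqF.
Qed.

Section sinkhorn_limits.
Context d (T : measurableType d) (R : realType).
Variables (c : T * T -> R) (M : R).
Hypotheses (bc : bm c) (cM : forall z, `|c z| <= M).
Variables P Q : probability T R.
Variables f g : T -> R.
Hypothesis fg : schrodinger c P Q f g.

Local Notation it := (sinkhorn_iter c P Q).
Local Notation q := (contraction_factor M).

Let bf : bm f. Proof. by case: fg. Qed.
Let bg : bm g. Proof. by case: fg. Qed.
Let bit k : bm (it k). Proof. exact: (bm_sinkhorn_iter bc cM). Qed.
Let bgit k : bm (sinkhorn_g c P (it k)).
Proof. exact: (bm_sinkhorn_g bc cM). Qed.

Let q0 : 0 <= q. Proof. by case/andP: (contraction_factor_itv cM). Qed.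
Let q1 : q < 1. Proof. by case/andP: (contraction_factor_itv cM). Qed.

Let osc_f : exists D, forall k, osc_le (fun x => f x - it k x) (D * q ^+ k).
Proof.
have [D oD] := bm_osc bf; exists D => k.
by rewrite mulrC; exact: (sinkhorn_iter_osc bc cM k fg oD).
Qed.

Let osc_g : exists D, forall k, osc_le (fun y => g y - sinkhorn_g c P (it k) y) (D * q ^+ k).
Proof.
have [D oD] := osc_f; exists D => k x y.
have [_ _ _ gE] := fg; rewrite !gE.
have e0 : 0 <= D * q ^+ k := osc_le_ge0 point (oD k).
apply: le_trans (softmin_contraction bc cM P point (bit k) bf (oD k) x y) _.
by rewrite ler_piMl// gerBl expR_ge0.
Qed.

Let var_cvg (S : probability T R) (h : T -> R) (hk : nat -> T -> R) D : bm h ->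
  (forall k, bm (hk k)) -> (forall k, osc_le (fun x => h x - hk k x) (D * q ^+ k)) ->
  var S (hk k) @[k --> \oo] --> var S h.
Proof.
move=> bh bhk oD; have [_ [B hB]] := bh.
have D0 : 0 <= D.
  by have := osc_le_ge0 point (oD 0%N); rewrite expr0 mulr1.
apply: (contraction_cvg cM (D := 8 * B * D + D ^+ 2)) => k.
apply: (le_trans (var_lipschitz S bh (bhk k) hB (oD k))).
have : 0 <= q ^+ k <= 1 by rewrite exprn_ge0//= exprn_ile1// ltW.
move: (q ^+ k) => t /andP[t0 t1].
have Dt : D ^+ 2 * (t * t) <= D ^+ 2 * t by rewrite ler_wpM2l ?sqr_ge0// ler_piMl.
by rewrite exprMn (expr2 t); lra.
Qed.

Lemma var_sinkhorn_f_cvg : var P (it k) @[k --> \oo] --> var P f.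
Proof. by have [D oD] := osc_f; have := @var_cvg P f it D bf bit oD. Qed.

Lemma var_sinkhorn_g_cvg :
  var Q (sinkhorn_g c P (it k)) @[k --> \oo] --> var Q g.
Proof.
by have [D oD] := osc_g; have := @var_cvg Q g (fun k => sinkhorn_g c P (it k)) D bg bgit oD.
Qed.

(** Each integral may drift by a constant. The iterate [it k.+1] is computed from the very g whose
    integral is added, so the two drifts are opposite and cancel. *)
Lemma cost_sinkhorn_cvg :
  \int[P]_x it k.+1 x + \int[Q]_y sinkhorn_g c P (it k) y @[k --> \oo] -->
  \int[P]_x f x + \int[Q]_y g y.
Proof.
have [D oD] := osc_g; apply: (contraction_cvg cM (D := D)) => k.
pose gk := sinkhorn_g c P (it k); pose r := \int[Q]_y g y - \int[Q]_y gk y.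
have bgk : bm gk := bgit k.
have bgr : bm (fun y => gk y + r) by apply: bmD => //; exact: bm_cst.
have gr y : `|g y - (gk y + r)| <= D * q ^+ k.
  have -> : g y - (gk y + r) = \int[Q]_y' (g y - gk y - (g y' - gk y')).
    rewrite bm_RintegralB; [|exact: bm_cst|exact: bmB].
    by rewrite RintegralT_cst bm_RintegralB// opprD addrA.
  apply: bm_norm_Rintegral_le.
    by apply: bmB; [exact: bm_cst|exact: bmB].
  move=> y'; have h1 := oD k y y'; have h2 := oD k y' y.
  by move: h1 h2; rewrite -/gk ler_norml; lra.
have [_ _ fE _] := fg.
have fr x : `|f x - (it k.+1 x - r)| <= D * q ^+ k.
  rewrite fE sinkhorn_iterS -(sinkhorn_f_shift bc cM Q r x bgk).
  apply: (softmin_lipschitz (bm_swap bc) _ Q x bg bgr gr).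
  by move=> z; exact: cM.
have -> : \int[P]_x f x + \int[Q]_y g y - (\int[P]_x it k.+1 x + \int[Q]_y gk y) =
    \int[P]_x (f x - (it k.+1 x - r)).
  rewrite bm_RintegralB//; last exact: bm_center.
  by rewrite bm_RintegralB ?RintegralT_cst// /r; [ring|exact: bm_cst].
apply: bm_norm_Rintegral_le => //.
by apply: bmB => //; exact: bm_center.
Qed.

End sinkhorn_limits.

Section empirical_measurability.
Context d (W : measurableType d) d' (T : measurableType d') (R : realType).
Variables (c : T * T -> R) (M : R).
Hypotheses (bc : bm c) (cM : forall z, `|c z| <= M).
Variables (X Y : nat -> W -> T) (n m : nat) (n_gt0 : (0 < n)%N) (m_gt0 : (0 < m)%N).
Hypotheses (mX : forall i, measurable_fun setT (X i)).
Hypotheses (mY : forall j, measurable_fun setT (Y j)).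

Local Notation Pn w := (empirical n_gt0 (fun i => X i w) : probability T R).
Local Notation Qm w := (empirical m_gt0 (fun j => Y j w) : probability T R).
Local Notation it k w := (sinkhorn_iter c (Pn w) (Qm w) k).

Let mc i j : measurable_fun setT (fun w => c (X i w, Y j w)).
Proof.
by apply: measurableT_comp; [case: bc|exact: measurable_fun_pair].
Qed.

Let msum (F : nat -> W -> R) N : (forall i, measurable_fun setT (F i)) ->
  measurable_fun setT (fun w => N%:R^-1 * \sum_(i < N) F i w).
Proof. by move=> mF; apply: measurable_funM => //; exact: measurable_sum. Qed.

Let bit k w : bm (it k w). Proof. exact: (bm_sinkhorn_iter bc cM). Qed.

(** Evaluated at a sample point, a soft minimum under an empirical measure is a finite expression in
    the [c (X i w, Y j w)] and the values of [F w] at the sample; joint measurability in w and the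
    point never comes up. *)
Let mg (F : W -> T -> R) : (forall w, bm (F w)) ->
  (forall i, measurable_fun setT (fun w => F w (X i w))) ->
  forall j, measurable_fun setT (fun w => sinkhorn_g c (Pn w) (F w) (Y j w)).
Proof.
move=> bF mF j.
have gE w : sinkhorn_g c (Pn w) (F w) (Y j w) =
    - ln (n%:R^-1 * \sum_(i < n) (expR (- c (X i w, Y j w)) * expR (F w (X i w)))).
  by rewrite /sinkhorn_g softminE; congr (- ln _); rewrite Rintegral_empirical//; exact: bm_kernel.
rewrite (funext gE).
apply: measurableT_comp => //; apply: measurableT_comp; first exact: measurable_ln.
apply: (msum (F := fun i w => expR (- c (X i w, Y j w)) * expR (F w (X i w)))) => i.
apply: measurable_funM; apply: measurableT_comp => //.
exact: measurableT_comp.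
Qed.

Let mf (F : W -> T -> R) : (forall w, bm (F w)) ->
  (forall j, measurable_fun setT (fun w => F w (Y j w))) ->
  forall i, measurable_fun setT (fun w => sinkhorn_f c (Qm w) (F w) (X i w)).
Proof.
move=> bF mF i.
have fE w : sinkhorn_f c (Qm w) (F w) (X i w) =
    - ln (m%:R^-1 * \sum_(j < m) (expR (- c (X i w, Y j w)) * expR (F w (Y j w)))).
  rewrite /sinkhorn_f softminE; congr (- ln _); rewrite Rintegral_empirical//.
  by apply: (bm_kernel (k := fun z : T * T => c (z.2, z.1))) => //; exact: bm_swap.
rewrite (funext fE).
apply: measurableT_comp => //; apply: measurableT_comp; first exact: measurable_ln.
apply: (msum (F := fun j w => expR (- c (X i w, Y j w)) * expR (F w (Y j w)))) => j.
apply: measurable_funM; apply: measurableT_comp => //.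
exact: measurableT_comp.
Qed.

Let mit k i : measurable_fun setT (fun w => it k w (X i w)).
Proof.
elim: k i => [|k IH] i.
  by under eq_fun do rewrite sinkhorn_iter0; exact: measurable_cst.
under eq_fun do rewrite sinkhorn_iterS.
apply: mf => [w|j]; first by apply: (bm_sinkhorn_g bc cM).
by apply: mg.
Qed.

Let mgit k j : measurable_fun setT (fun w => sinkhorn_g c (Pn w) (it k w) (Y j w)).
Proof. by apply: mg => // i; exact: mit. Qed.

Let mvar (F : W -> T -> R) N (N_gt0 : (0 < N)%N) (U : nat -> W -> T) :
  (forall w, bm (F w)) -> (forall i, measurable_fun setT (fun w => F w (U i w))) ->
  measurable_fun setT
    (fun w => var (empirical N_gt0 (fun i => U i w) : probability T R) (F w)).
Proof.
move=> bF mF.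
have vE w : var (empirical N_gt0 (fun i => U i w) : probability T R) (F w) =
    N%:R^-1 * \sum_(i < N) F w (U i w) ^+ 2 - (N%:R^-1 * \sum_(i < N) F w (U i w)) ^+ 2.
  by rewrite var_eq//; congr (_ - _ ^+ 2); rewrite Rintegral_empirical//; exact: bmX.
rewrite (funext vE).
apply: measurable_funB.
  by apply: (msum (F := fun i w => F w (U i w) ^+ 2)) => i; exact: measurable_funX.
by apply: measurable_funX; exact: (msum (F := fun i w => F w (U i w))).
Qed.

Variables f g : W -> T -> R.
Hypothesis fg : forall w, schrodinger c (Pn w) (Qm w) (f w) (g w).

Lemma measurable_var_empirical_f : measurable_fun setT (fun w => var (Pn w) (f w)).
Proof.
apply: (@measurable_fun_cvg _ _ _ _ (fun k w => var (Pn w) (it k w))) => [k|w _].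
  by apply: mvar => // i; exact: mit.
exact: (var_sinkhorn_f_cvg bc cM).
Qed.

Lemma measurable_var_empirical_g : measurable_fun setT (fun w => var (Qm w) (g w)).
Proof.
apply: (@measurable_fun_cvg _ _ _ _
  (fun k w => var (Qm w) (sinkhorn_g c (Pn w) (it k w)))) => [k|w _].
  by apply: mvar => [w|j]; [exact: (bm_sinkhorn_g bc cM)|exact: mgit].
exact: (var_sinkhorn_g_cvg bc cM).
Qed.

Lemma measurable_cost_empirical : measurable_fun setT
  (fun w => \int[Pn w]_x f w x + \int[Qm w]_y g w y).
Proof.
apply: (@measurable_fun_cvg _ _ _ _ (fun k w => \int[Pn w]_x it k.+1 w x +
   \int[Qm w]_y sinkhorn_g c (Pn w) (it k w) y)) => [k|w _]; last first.
  exact: (cost_sinkhorn_cvg bc cM).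
apply: measurable_funD.
  have iE w : \int[Pn w]_x it k.+1 w x = n%:R^-1 * \sum_(i < n) it k.+1 w (X i w).
    by rewrite Rintegral_empirical.
  rewrite (funext iE).
  by apply: (msum (F := fun i w => it k.+1 w (X i w))) => i; exact: mit.
have iE w : \int[Qm w]_y sinkhorn_g c (Pn w) (it k w) y =
    m%:R^-1 * \sum_(j < m) sinkhorn_g c (Pn w) (it k w) (Y j w).
  by rewrite Rintegral_empirical//; exact: (bm_sinkhorn_g bc cM).
rewrite (funext iE).
by apply: (msum (F := fun j w => sinkhorn_g c (Pn w) (it k w) (Y j w))) => j; exact: mgit.
Qed.

End empirical_measurability.

Section sample_moments.
Context d (W : measurableType d) (R : realType) (Pr : probability W R).
Context d' (T : measurableType d') (Z : nat + nat -> W -> T).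
Variables P Q : probability T R.
Hypothesis lawX : forall i, has_law Pr (Z (inl i)) P.
Hypothesis lawY : forall j, has_law Pr (Z (inr j)) Q.
Hypothesis iZ : mutually_independent Pr Z.
Implicit Types n m : nat.

Let X i := Z (inl i).
Let Y j := Z (inr j).
Let bcross := bm_sample_pair lawX lawY.

Section eta.
Variables (eta : T * T -> R) (B : R).
Hypotheses (beta : bm eta) (etaB : forall z, `|eta z| <= B).

Let e k w := eta (Z (inl k.1) w, Z (inr k.2) w).
Let be (k : nat * nat) : bm (e k). Proof. exact: bcross. Qed.

(** For fixed i the variables eta(X_i, Y_j) are orthogonal in j, so each inner average has second
    moment at most B^2/m. *)
Lemma moment_avg_sqr_avg_y n m : (0 < n)%N -> (0 < m)%N ->
  (forall x, \int[Q]_y eta (x, y) = 0) ->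
  \int[Pr]_w (n%:R^-1 * \sum_(i < n)
    (m%:R^-1 * \sum_(j < m) eta (X i w, Y j w)) ^+ 2) <= B ^+ 2 / m%:R.
Proof.
move=> n0 m0 eta0.
have mi0 : 0 < m%:R :> R by rewrite ltr0n.
have ni0 : 0 < n%:R :> R by rewrite ltr0n.
have bs i : bm (fun w => (m%:R^-1 * \sum_(j < m) eta (X i w, Y j w)) ^+ 2).
  apply: bmX; apply: bmM; [exact: bm_cst|apply: bm_sum => j].
  exact: (be (i, nat_of_ord j)).
rewrite bm_RintegralZl; last exact: bm_sum.
rewrite bm_Rintegral_sum// mulrC ler_pdivrMr//.
apply: (@le_trans _ _ (\sum_(i < n) B ^+ 2 / m%:R)); last first.
  by rewrite sumr_const card_ord mulr_natr.
apply: ler_sum => i _.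
under eq_Rintegral do rewrite exprMn.
rewrite bm_RintegralZl; last first.
  by apply: bmX; apply: bm_sum => j; exact: (be (nat_of_ord i, nat_of_ord j)).
have := @second_moment_sum _ _ _ Pr 'I_m (fun j w => e (nat_of_ord i, nat_of_ord j) w) B.
rewrite card_ord => /(_ _ _ _) h.
rewrite exprVn mulrC ler_pdivrMr ?exprn_gt0//.
rewrite (_ : B ^+ 2 / m%:R * m%:R ^+ 2 = m%:R * B ^+ 2); last first.
  by field; rewrite gt_eqF.
apply: h => [j|j w|j l jl]; [exact: be|exact: etaB|].
by apply: (cross_moment_y lawX lawY iZ beta (k := (nat_of_ord i, nat_of_ord j))
  (l := (nat_of_ord i, nat_of_ord l))).
Qed.

Lemma moment_avg_sqr_avg_x n m : (0 < n)%N -> (0 < m)%N ->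
  (forall y, \int[P]_x eta (x, y) = 0) ->
  \int[Pr]_w (m%:R^-1 * \sum_(j < m)
    (n%:R^-1 * \sum_(i < n) eta (X i w, Y j w)) ^+ 2) <= B ^+ 2 / n%:R.
Proof.
move=> n0 m0 eta0.
have mi0 : 0 < m%:R :> R by rewrite ltr0n.
have ni0 : 0 < n%:R :> R by rewrite ltr0n.
have bs j : bm (fun w => (n%:R^-1 * \sum_(i < n) eta (X i w, Y j w)) ^+ 2).
  apply: bmX; apply: bmM; [exact: bm_cst|apply: bm_sum => i].
  exact: (be (nat_of_ord i, j)).
rewrite bm_RintegralZl; last exact: bm_sum.
rewrite bm_Rintegral_sum// mulrC ler_pdivrMr//.
apply: (@le_trans _ _ (\sum_(j < m) B ^+ 2 / n%:R)); last first.
  by rewrite sumr_const card_ord mulr_natr.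
apply: ler_sum => j _.
under eq_Rintegral do rewrite exprMn.
rewrite bm_RintegralZl; last first.
  by apply: bmX; apply: bm_sum => i; exact: (be (nat_of_ord i, nat_of_ord j)).
have := @second_moment_sum _ _ _ Pr 'I_n (fun i w => e (nat_of_ord i, nat_of_ord j) w) B.
rewrite card_ord => /(_ _ _ _) h.
rewrite exprVn mulrC ler_pdivrMr ?exprn_gt0//.
rewrite (_ : B ^+ 2 / n%:R * n%:R ^+ 2 = n%:R * B ^+ 2); last first.
  by field; rewrite gt_eqF.
apply: h => [i|i w|i l il]; [exact: be|exact: etaB|].
by apply: (cross_moment_x lawX lawY iZ beta (k := (nat_of_ord i, nat_of_ord j))
  (l := (nat_of_ord l, nat_of_ord j))).
Qed.

(** Pairs (i, j) that differ in a single index are already orthogonal, because both marginals of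
    [eta] vanish; only the n m diagonal terms remain. *)
Lemma moment_sqr_avg n m : (0 < n)%N -> (0 < m)%N ->
  (forall y, \int[P]_x eta (x, y) = 0) ->
  (forall x, \int[Q]_y eta (x, y) = 0) ->
  \int[Pr]_w (n%:R^-1 * \sum_(i < n)
    (m%:R^-1 * \sum_(j < m) eta (X i w, Y j w))) ^+ 2 <= B ^+ 2 / (n%:R * m%:R).
Proof.
move=> n0 m0 etaP etaQ.
have mi0 : 0 < m%:R :> R by rewrite ltr0n.
have ni0 : 0 < n%:R :> R by rewrite ltr0n.
apply: (@le_trans _ _ (\int[Pr]_w ((n%:R * m%:R) ^- 2 *
    (\sum_(k : 'I_n * 'I_m) e (nat_of_ord k.1, nat_of_ord k.2) w) ^+ 2))).
  rewrite le_eqVlt; apply/orP; left; apply/eqP; apply: eq_Rintegral => w _.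
  rewrite -mulr_sumr mulrA -invfM exprMn exprVn; congr (_ * _ ^+ 2).
  by rewrite pair_big.
rewrite bm_RintegralZl; last first.
  by apply: bmX; apply: bm_sum => k; exact: be.
rewrite mulrC ler_pdivrMr ?exprn_gt0 ?mulr_gt0//.
rewrite (_ : B ^+ 2 / _ * _ = (n * m)%:R * B ^+ 2); last first.
  by rewrite natrM; field; rewrite !gt_eqF.
have := @second_moment_sum _ _ _ Pr ('I_n * 'I_m)%type
  (fun k w => e (nat_of_ord k.1, nat_of_ord k.2) w) B.
rewrite card_prod !card_ord; apply => [k|k w|[i j] [i' j'] kl]; [exact: be|exact: etaB|].
have [ii'|ii'] := eqVneq i i'.
  have jj' : j != j' by apply: contra kl => /eqP ->; rewrite ii'.
  by apply: (cross_moment_y lawX lawY iZ beta (k := (nat_of_ord i, nat_of_ord j))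
    (l := (nat_of_ord i', nat_of_ord j'))).
by apply: (cross_moment_x lawX lawY iZ beta (k := (nat_of_ord i, nat_of_ord j))
  (l := (nat_of_ord i', nat_of_ord j'))).
Qed.

End eta.

Lemma lln_x h B n : bm h -> (forall x, `|h x| <= B) -> (0 < n)%N ->
  \int[Pr]_w (n%:R^-1 * \sum_(i < n) h (X i w) - \int[P]_x h x) ^+ 2 <=
  (2 * B) ^+ 2 / n%:R.
Proof.
move=> bh hB n0; have ni0 : 0 < n%:R :> R by rewrite ltr0n.
pose r := \int[P]_x h x.
have rB : `|r| <= B by exact: bm_norm_Rintegral_le.
(* A kernel constant in its second variable, with a single Y sample, turns the moment bound for
   double averages into a law of large numbers. *)
pose eta (z : T * T) := h z.1 - r.
have beta : bm eta.
  by apply: bmB; [exact: (bm_comp bh measurable_fst)|exact: bm_cst].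
have etaB z : `|eta z| <= 2 * B.
  by rewrite (le_trans (ler_normB _ _))// mulr2n mulrDl mul1r lerD.
have eta0 y : \int[P]_x eta (x, y) = 0.
  by rewrite bm_RintegralB ?RintegralT_cst ?subrr//; exact: bm_cst.
apply: le_trans (moment_avg_sqr_avg_x beta etaB n0 (ltn0Sn 0) eta0).
rewrite le_eqVlt; apply/orP; left; apply/eqP; apply: eq_Rintegral => w _.
rewrite big_ord1 invr1 mul1r; congr (_ ^+ 2).
rewrite /eta big_split/= sumr_const card_ord mulrDr; congr (_ + _).
by rewrite -[(- r) *+ _]mulr_natr mulrCA mulVf ?mulr1 ?gt_eqF.
Qed.

Lemma lln_y h B m : bm h -> (forall x, `|h x| <= B) -> (0 < m)%N ->
  \int[Pr]_w (m%:R^-1 * \sum_(j < m) h (Y j w) - \int[Q]_y h y) ^+ 2 <=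
  (2 * B) ^+ 2 / m%:R.
Proof.
move=> bh hB m0; have mi0 : 0 < m%:R :> R by rewrite ltr0n.
pose r := \int[Q]_x h x.
have rB : `|r| <= B by exact: bm_norm_Rintegral_le.
pose eta (z : T * T) := h z.2 - r.
have beta : bm eta.
  by apply: bmB; [exact: (bm_comp bh measurable_snd)|exact: bm_cst].
have etaB z : `|eta z| <= 2 * B.
  by rewrite (le_trans (ler_normB _ _))// mulr2n mulrDl mul1r lerD.
have eta0 x : \int[Q]_y eta (x, y) = 0.
  by rewrite bm_RintegralB ?RintegralT_cst ?subrr//; exact: bm_cst.
apply: le_trans (moment_avg_sqr_avg_y beta etaB (ltn0Sn 0) m0 eta0).
rewrite le_eqVlt; apply/orP; left; apply/eqP; apply: eq_Rintegral => w _.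
rewrite big_ord1 invr1 mul1r; congr (_ ^+ 2).
rewrite /eta big_split/= sumr_const card_ord mulrDr; congr (_ + _).
by rewrite -[(- r) *+ _]mulr_natr mulrCA mulVf ?mulr1 ?gt_eqF.
Qed.

End sample_moments.

(** * Convergence in probability *)

Section with_high_probability.
Context d (W : measurableType d) (R : realType) (Pr : probability W R).
Implicit Types (E F : nat -> W -> Prop) (u v : nat -> W -> R).

(* Outer-measure formulation: the events need not be measurable. *)
Definition whp E := forall del : R, 0 < del -> \forall k \near \oo,
  exists A, [/\ measurable A, (Pr A <= del%:E)%E & forall w, ~ A w -> E k w].

Lemma near_whp E : (\forall k \near \oo, forall w, E k w) -> whp E.
Proof.
move=> nE del del0; apply: filterS nE => k Ek.
by exists set0; split => //; rewrite measure0 lee_fin ltW.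
Qed.

Lemma whpS E F : (forall k w, E k w -> F k w) -> whp E -> whp F.
Proof.
move=> EF hE del /hE; apply: filterS => k [A [mA PA AE]].
by exists A; split => // w /AE; exact: EF.
Qed.

Lemma whpI E F : whp E -> whp F -> whp (fun k w => E k w /\ F k w).
Proof.
move=> hE hF del del0; have del2 : 0 < del / 2 by rewrite divr_gt0.
move: (hE _ del2) (hF _ del2); apply: filterS2 => k [A [mA PA AE]] [B [mB PB BF]].
exists (A `|` B); split; first exact: measurableU.
  by rewrite (splitr del) EFinD (le_trans (measureU2 _ _ _))// leeD.
by move=> w /not_orP[/AE ? /BF].
Qed.

Lemma whp_markov u e : (forall k, bm (u k)) -> (forall k w, 0 <= u k w) ->
  \int[Pr]_w u k w @[k --> \oo] --> 0 -> 0 < e -> whp (fun k w => u k w < e).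
Proof.
move=> bu u0 cu e0 del del0.
have : 0 < del * e by exact: mulr_gt0.
move/cvgr_lt : cu => /[apply]; apply: filterS => k ku.
exists [set w | e <= u k w]; split.
- by apply: measurable_ge_set; case: (bu k).
- by rewrite (le_trans (bm_markov _ _ _ _))// lee_fin ler_pdivrMr// ltW.
- by move=> w /= /negP; rewrite -ltNge.
Qed.

Definition vanishes u := forall e, 0 < e -> whp (fun k w => `|u k w| < e).

Lemma vanishes_le u v : (forall k w, `|u k w| <= `|v k w|) -> vanishes v -> vanishes u.
Proof. by move=> uv hv e /hv; apply: whpS => k w; exact: le_lt_trans. Qed.

Lemma vanishesD u v : vanishes u -> vanishes v -> vanishes (fun k w => u k w + v k w).
Proof.
move=> hu hv e e0; have e2 : 0 < e / 2 by rewrite divr_gt0.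
apply: whpS (whpI (hu _ e2) (hv _ e2)) => k w [uk vk].
by rewrite (splitr e) (le_lt_trans (ler_normD _ _))// ltrD.
Qed.

Lemma vanishesZ r u : vanishes u -> vanishes (fun k w => r * u k w).
Proof.
move=> hu e e0; have r0 : 0 < `|r| + 1 by rewrite ltr_wpDl.
apply: whpS (hu (e / (`|r| + 1)) _) => [k w|]; last by rewrite divr_gt0.
rewrite ltr_pdivlMr// normrM => h; apply: le_lt_trans h.
by rewrite mulrC ler_wpM2l// lerDl.
Qed.

Lemma vanishesM u v : vanishes u -> vanishes v -> vanishes (fun k w => u k w * v k w).
Proof.
move=> hu hv e e0; apply: whpS (whpI (hu e e0) (hv 1 ltr01)) => k w [uk vk].
by rewrite normrM -(mulr1 e) ltr_pM.
Qed.

Lemma cvg_vanishes (r : nat -> R) : r k @[k --> \oo] --> 0 -> vanishes (fun k _ => r k).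
Proof.
move=> r0 e e0; apply: near_whp.
move/cvgr0Pnorm_lt : r0 => /(_ _ e0); apply: filterS => k rk _; exact: rk.
Qed.

Lemma L1_vanishes u v : (forall k w, `|u k w| <= v k w) -> (forall k, bm (v k)) ->
  \int[Pr]_w v k w @[k --> \oo] --> 0 -> vanishes u.
Proof.
move=> uv bv cv e e0.
have v0 k w : 0 <= v k w := le_trans (normr_ge0 _) (uv k w).
by apply: whpS (whp_markov bv v0 cv e0) => k w; exact: le_lt_trans.
Qed.

Lemma L2_vanishes u : (forall k, bm (u k)) ->
  \int[Pr]_w u k w ^+ 2 @[k --> \oo] --> 0 -> vanishes u.
Proof.
move=> bu cu e e0.
have bu2 k : bm (fun w => u k w ^+ 2) by exact: bmX.
have u0 k w : 0 <= u k w ^+ 2 by exact: sqr_ge0.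
apply: whpS (whp_markov bu2 u0 cu (exprn_gt0 2 e0)) => k w.
by rewrite -(real_normK (num_real (u k w))) ltr_pXn2r ?nnegrE ?(ltW e0).
Qed.

(** A bounded second moment gives tightness by Chebyshev: outside an event of probability del/2, |u|
    stays below [B], and there |v| < e/B suffices. *)
Lemma vanishesM_bounded_moment u v C : (forall k, bm (u k)) ->
  (forall k, \int[Pr]_w u k w ^+ 2 <= C) -> vanishes v ->
  vanishes (fun k w => u k w * v k w).
Proof.
move=> bu uC hv e e0 del del0.
have C1 : 0 < `|C| + 1 by rewrite ltr_wpDl.
have del2 : 0 < del / 2 by rewrite divr_gt0.
pose B := Num.sqrt ((`|C| + 1) / (del / 2)).
have B2 : B ^+ 2 = (`|C| + 1) / (del / 2) by rewrite sqr_sqrtr// ltW// divr_gt0.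
have B0 : 0 < B by rewrite sqrtr_gt0 divr_gt0.
have eB : 0 < e / B by rewrite divr_gt0.
move: (hv _ eB _ del2); apply: filterS => k [A [mA PA Av]].
pose D := [set w | B ^+ 2 <= u k w ^+ 2].
have bu2 : bm (fun w => u k w ^+ 2) by exact: bmX.
have mD : measurable D by apply: measurable_ge_set; case: bu2.
exists (A `|` D); split; first exact: measurableU.
  rewrite (splitr del) EFinD (le_trans (measureU2 _ _ _))// leeD//.
  rewrite (le_trans (bm_markov Pr bu2 (fun w => sqr_ge0 _) (exprn_gt0 2 B0)))//.
  rewrite lee_fin ler_pdivrMr ?exprn_gt0// B2 mulrC divfK ?gt_eqF//.
  by rewrite (le_trans (uC k))// (le_trans (ler_norm _))// lerDl.
move=> w /not_orP[/Av vk /negP]; rewrite -ltNge.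
rewrite -(real_normK (num_real (u k w))) ltr_pXn2r ?nnegrE ?(ltW B0)// => uk.
rewrite normrM -(divfK (lt0r_neq0 B0) e) mulrC.
by apply: ltr_pM.
Qed.

Lemma vanishes_continuous u (phi : R -> R) l : {for l, continuous phi} ->
  vanishes (fun k w => u k w - l) -> vanishes (fun k w => phi (u k w) - phi l).
Proof.
move=> /cvgrPdist_lt cphi hu e e0.
have [r /= r0 rphi] := (nbhs_ballP _ _).1 (cphi _ e0).
apply: whpS (hu _ r0) => k w ukl; rewrite distrC; apply: rphi.
by rewrite /ball /= distrC.
Qed.

Lemma vanishes_cvg u : (forall k, measurable_fun setT (u k)) -> vanishes u ->
  forall e, 0 < e -> Pr [set w | e <= `|u k w|] @[k --> \oo] --> 0%E.
Proof.
move=> mu hu e e0.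
have fin k : Pr [set w | e <= `|u k w|] \is a fin_num.
  by apply: fin_num_measure; apply: measurable_ge_set; exact: measurableT_comp.
apply/fine_cvgP; split; first by apply: nearW => k; exact: fin.
apply/cvgr0Pnorm_le => del del0; move: (hu _ e0 _ del0).
apply: filterS => k [A [mA PA Au]].
rewrite ger0_norm ?fine_ge0// -lee_fin fineK//.
apply: le_trans PA; apply: le_measure; rewrite ?inE//.
  by apply: measurable_ge_set; exact: measurableT_comp.
by move=> w /= euk; apply/not_notP => /Au; rewrite ltNge euk.
Qed.

End with_high_probability.

(** * Central limit theorem for the linear part *)

Section sample_clt.
Context d (W : measurableType d) (R : realType) (Pr : probability W R).
Context d' (T : measurableType d') (Z : nat + nat -> W -> T).
Variables P Q : probability T R.
Hypothesis lawX : forall i, has_law Pr (Z (inl i)) P.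
Hypothesis lawY : forall j, has_law Pr (Z (inr j)) Q.
Hypothesis iZ : mutually_independent Pr Z.

(** Injectivity of [idx] makes each summand independent of the sigma-algebra of the earlier ones,
    which yields the two moment identities of [lindeberg]. *)
Lemma lindeberg_independent (idx : nat -> nat + nat) (S : nat -> probability T R)
    (phi : nat -> T -> R) (del : nat -> R) n : injective idx ->
  (forall i, has_law Pr (Z (idx i)) (S i)) ->
  (forall i, bm (phi i)) -> (forall i z, `|phi i z| <= del i) ->
  (forall i, \int[S i]_z phi i z = 0) ->
  forall h a b K, taylor3 h a b K ->
  `|\int[Pr]_w h (\sum_(j < n) phi j (Z (idx j) w)) -
    normal_shift (Num.sqrt (\sum_(j < n) \int[S j]_z phi j z ^+ 2)) h 0| <=
  K * (1 + normal_abs_moment3 R) * \sum_(j < n) del j ^+ 3.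
Proof.
move=> inj law bphi phid phi0.
have bz j : bm (fun w => phi j (Z (idx j) w)).
  by apply: (bm_comp (bphi j)); case: (law j).
apply: (@lindeberg _ _ _ Pr (fun j w => phi j (Z (idx j) w))
  (fun j => \int[S j]_z phi j z ^+ 2) del n) => // i _.
  rewrite Rintegral_ge0/=; last by move=> z _; exact: sqr_ge0.
  apply: bm_Rintegral_le; first exact: bmX.
  move=> z; rewrite -(real_normK (num_real (phi i z))).
  by rewrite lerXn2r ?nnegrE// (le_trans _ (phid i z)).
move=> f bf V.
pose s := map idx (iota 0 i).
have us : uniq s by rewrite map_inj_uniq// iota_uniq.
have ins : idx i \notin s.
  by rewrite mem_map// mem_iota ltnn andbF.
pose y (w : g_sigma_algebraType (cylinder Z s)) : R := f (V w).
have by_ : bm y.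
  apply: (bm_comp bf); apply: measurable_sum => j.
  have [mphi _] := bphi j; apply: (measurableT_comp mphi).
  by apply: measurable_cylinder; rewrite map_f// mem_iota ltn_ord.
split.
  by rewrite (indep_factor lawX lawY iZ ins us (law i) (bphi i) by_) phi0 mul0r.
by rewrite (indep_factor lawX lawY iZ ins us (law i) (bmX 2 (bphi i)) by_).
Qed.

Variables (f g : T -> R) (B s : R) (n m : nat).
Hypotheses (bf : bm f) (bg : bm g).
Hypotheses (fB : forall x, `|f x| <= B) (gB : forall y, `|g y| <= B).
Hypotheses (s0 : 0 <= s) (n_gt0 : (0 < n)%N) (m_gt0 : (0 < m)%N).

Definition centered_average_sum w :=
  (n%:R^-1 * \sum_(i < n) f (Z (inl (nat_of_ord i)) w) - \int[P]_x f x) +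
  (m%:R^-1 * \sum_(j < m) g (Z (inr (nat_of_ord j)) w) - \int[Q]_y g y).

(** The X sample is listed first, then the Y sample; n summands of size 2 B s/n and m of size 2 B
    s/m give the cubic error, while the variances add up exactly. *)
Lemma sample_lindeberg h a b K : taylor3 h a b K ->
  `|\int[Pr]_w h (s * centered_average_sum w) -
    normal_shift (Num.sqrt (s ^+ 2 * (var P f / n%:R + var Q g / m%:R))) h 0| <=
  K * (1 + normal_abs_moment3 R) *
    ((2 * B * s) ^+ 3 * (n%:R ^- 2 + m%:R ^- 2)).
Proof.
move=> hT.
have n0 : 0 < n%:R :> R by rewrite ltr0n.
have m0 : 0 < m%:R :> R by rewrite ltr0n.
pose idx i : nat + nat := if (i < n)%N then inl i else inr (i - n)%N.
pose S i : probability T R := if (i < n)%N then P else Q.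
pose phi i x := if (i < n)%N then s / n%:R * (f x - \int[P]_x f x)
                else s / m%:R * (g x - \int[Q]_x g x).
pose del i := 2 * B * s * (if (i < n)%N then n%:R^-1 else m%:R^-1).
have inj : injective idx.
  move=> i j; rewrite /idx; case: ltnP => hi; case: ltnP => hj // [].
    by [].
  by move=> E; rewrite -(subnK hi) -(subnK hj) E.
have law i : has_law Pr (Z (idx i)) (S i) by rewrite /idx /S; case: ifP.
have bphi i : bm (phi i).
  by rewrite /phi; case: (i < n)%N; (apply: bmM; [exact: bm_cst|exact: bm_center]).
have phid i z : `|phi i z| <= del i.
  have cB (U : probability T R) k : bm k -> (forall x, `|k x| <= B) ->
      `|k z - \int[U]_x k x| <= 2 * B.
    move=> bk kB; rewrite (le_trans (ler_normB _ _))// mulr2n mulrDl mul1r lerD//.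
    exact: bm_norm_Rintegral_le.
  have aux (r u v : R) : 0 < r -> `|u - v| <= 2 * B ->
      `|s / r * (u - v)| <= 2 * B * s * r^-1.
    move=> r0 uv; rewrite normrM ger0_norm ?divr_ge0 ?(ltW r0)// mulrC -mulrA.
    by rewrite ler_wpM2r// divr_ge0// ltW.
  by rewrite /phi /del; case: (i < n)%N; apply: aux => //; exact: cB.
have phi0 i : \int[S i]_z phi i z = 0.
  have aux (U : probability T R) (r : R) k : bm k ->
      \int[U]_z (r * (k z - \int[U]_x k x)) = 0.
    move=> bk; rewrite bm_RintegralZl; last exact: bm_center.
    by rewrite bm_RintegralB ?RintegralT_cst ?subrr ?mulr0//; exact: bm_cst.
  by rewrite /S /phi; case: (i < n)%N; exact: aux.
have phi2 i : \int[S i]_z phi i z ^+ 2 =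
    if (i < n)%N then (s / n%:R) ^+ 2 * var P f else (s / m%:R) ^+ 2 * var Q g.
  have aux (U : probability T R) (r : R) k : bm k ->
      \int[U]_z (r * (k z - \int[U]_x k x)) ^+ 2 = r ^+ 2 * var U k.
    move=> bk; under eq_Rintegral do rewrite exprMn.
    by rewrite bm_RintegralZl//; apply: bmX; exact: bm_center.
  by rewrite /S /phi; case: (i < n)%N; exact: aux.
have split_sum (F : nat -> R) : \sum_(j < n + m) F j =
    \sum_(i < n) F i + \sum_(j < m) F (n + j)%N.
  by rewrite big_split_ord.
have := lindeberg_independent (n + m) inj law bphi phid phi0 hT.
rewrite (split_sum (fun j => del j ^+ 3)).
rewrite (split_sum (fun j => \int[S j]_z phi j z ^+ 2)).
have sum_cst k (r : R) : \sum_(i < k) r = k%:R * r by rewrite sumr_const card_ord mulr_natl.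
have lt (i : 'I_n) : (i < n)%N = true by rewrite ltn_ord.
have ge (j : 'I_m) : (n + j < n)%N = false by rewrite ltnNge leq_addr.
have -> : \sum_(i < n) \int[S i]_z phi i z ^+ 2 +
    \sum_(j < m) \int[S (n + j)%N]_z phi (n + j)%N z ^+ 2 =
    s ^+ 2 * (var P f / n%:R + var Q g / m%:R).
  under eq_bigr do rewrite phi2 lt.
  under [X in _ + X]eq_bigr do rewrite phi2 ge.
  rewrite !sum_cst; move: n%:R m%:R n0 m0 => p q p0 q0.
  by field; rewrite !gt_eqF.
have -> : \sum_(i < n) del i ^+ 3 + \sum_(j < m) del (n + j)%N ^+ 3 =
    (2 * B * s) ^+ 3 * (n%:R ^- 2 + m%:R ^- 2).
  rewrite /del; under eq_bigr do rewrite lt.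
  under [X in _ + X]eq_bigr do rewrite ge.
  rewrite !sum_cst; move: n%:R m%:R n0 m0 => p q p0 q0.
  by field; rewrite !gt_eqF.
have -> : \int[Pr]_w h (\sum_(j < n + m) phi j (Z (idx j) w)) =
    \int[Pr]_w h (s * centered_average_sum w).
  apply: eq_Rintegral => w _; congr h.
  rewrite (split_sum (fun j => phi j (Z (idx j) w))) /phi /idx.
  under eq_bigr do rewrite lt.
  under [X in _ + X]eq_bigr do rewrite ge addKn.
  rewrite -!mulr_sumr !sumrB !sum_cst /centered_average_sum.
  move: (\sum_(i < n) _) (\sum_(i < m) _) => u v.
  move: (\int[P]_x f x) (\int[Q]_x g x) n%:R m%:R n0 m0 => p q r t r0 t0.
  by field; rewrite !gt_eqF.
exact.
Qed.

End sample_clt.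

(** * The remainder *)

Section sample_remainder.
Context d (W : measurableType d) (R : realType) (Pr : probability W R).
Context d' (T : measurableType d') (Z : nat + nat -> W -> T).
Variables P Q : probability T R.
Hypothesis lawX : forall i, has_law Pr (Z (inl i)) P.
Hypothesis lawY : forall j, has_law Pr (Z (inr j)) Q.
Hypothesis iZ : mutually_independent Pr Z.
Variables (c : T * T -> R) (M : R).
Hypotheses (bc : bm c) (cM : forall z, `|c z| <= M).
Variables f g : T -> R.
Hypothesis fg : schrodinger c P Q f g.
Hypotheses (fM : forall x, `|f x| <= 3 * M) (gM : forall y, `|g y| <= 3 * M).
Variables (n m : nat) (n_gt0 : (0 < n)%N) (m_gt0 : (0 < m)%N).

Let X (i : nat) := Z (inl i).
Let Y (j : nat) := Z (inr j).
Local Notation Pn w := (empirical n_gt0 (fun i => X i w) : probability T R).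
Local Notation Qm w := (empirical m_gt0 (fun j => Y j w) : probability T R).
Local Notation kap := (convexity_modulus M).

Let bf : bm f. Proof. by case: fg. Qed.
Let bg : bm g. Proof. by case: fg. Qed.

Let eta z := 1 - gibbs c f g z.
Let bxi : bm (gibbs c f g). Proof. exact: bm_gibbs. Qed.
Let beta : bm eta. Proof. by apply: bmB => //; exact: bm_cst. Qed.

Let etaQ x : \int[Q]_y eta (x, y) = 0.
Proof.
rewrite bm_RintegralB; [|exact: bm_cst|exact: (bm_pair1 bxi)].
by rewrite RintegralT_cst (schrodinger_mass bc cM fg).1 subrr.
Qed.

Let etaP y : \int[P]_x eta (x, y) = 0.
Proof.
rewrite bm_RintegralB; [|exact: bm_cst|exact: (bm_pair2 bxi)].
by rewrite RintegralT_cst (schrodinger_mass bc cM fg).2 subrr.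
Qed.

Definition sample_defect w := gibbs_defect c f g (Pn w) (Qm w).

Definition sample_sqr_defect w :=
  \int[Pn w]_x gibbs_defect_f c f g (Qm w) x ^+ 2 +
  \int[Qm w]_y gibbs_defect_g c f g (Pn w) y ^+ 2.

Let defect_fE w x : gibbs_defect_f c f g (Qm w) x =
  m%:R^-1 * \sum_(j < m) eta (x, Y j w).
Proof.
rewrite -(Rintegral_empirical m_gt0 (fun j => Y j w) (bm_pair1 beta x)).
rewrite bm_RintegralB ?RintegralT_cst//; [exact: bm_cst|exact: (bm_pair1 bxi)].
Qed.

Let defect_gE w y : gibbs_defect_g c f g (Pn w) y =
  n%:R^-1 * \sum_(i < n) eta (X i w, y).
Proof.
rewrite -(Rintegral_empirical n_gt0 (fun j => X j w) (bm_pair2 beta y)).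
rewrite bm_RintegralB ?RintegralT_cst//; [exact: bm_cst|exact: (bm_pair2 bxi)].
Qed.

Let bdf w : bm (gibbs_defect_f c f g (Qm w)).
Proof. by apply: bmB; [exact: bm_cst|exact: bm_Rintegral1]. Qed.

Let bdg w : bm (gibbs_defect_g c f g (Pn w)).
Proof. by apply: bmB; [exact: bm_cst|exact: bm_Rintegral2]. Qed.

Let sample_defectE w : sample_defect w =
  n%:R^-1 * \sum_(i < n) (m%:R^-1 * \sum_(j < m) eta (X i w, Y j w)).
Proof.
have -> : sample_defect w = \int[Pn w]_x gibbs_defect_f c f g (Qm w) x.
  rewrite bm_RintegralB ?RintegralT_cst//; [exact: bm_cst|exact: bm_Rintegral1].
rewrite Rintegral_empirical//; congr (_ * _).
by apply: eq_bigr => i _; rewrite defect_fE.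
Qed.

Let sample_sqr_defectE w : sample_sqr_defect w =
  n%:R^-1 * \sum_(i < n) (m%:R^-1 * \sum_(j < m) eta (X i w, Y j w)) ^+ 2 +
  m%:R^-1 * \sum_(j < m) (n%:R^-1 * \sum_(i < n) eta (X i w, Y j w)) ^+ 2.
Proof.
rewrite /sample_sqr_defect !Rintegral_empirical; [|exact: bmX..].
by congr (_ * _ + _ * _); apply: eq_bigr => i _; rewrite (defect_fE, defect_gE).
Qed.

Let beta_ij i j : bm (fun w => eta (X i w, Y j w)).
Proof. exact: (bm_sample_pair lawX lawY beta (i, j)). Qed.

Let bavg N (F : nat -> W -> R) : (forall i, bm (F i)) ->
  bm (fun w => N%:R^-1 * \sum_(i < N) F i w).
Proof. by move=> bF; apply: bmM; [exact: bm_cst|exact: bm_sum]. Qed.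

Lemma bm_sample_defect : bm sample_defect.
Proof.
rewrite (funext sample_defectE).
apply: (bavg n (F := fun i w => m%:R^-1 * \sum_(j < m) eta (X i w, Y j w))) => i.
exact: (bavg m (F := fun j w => eta (X i w, Y j w))).
Qed.

Let bsqr1 : bm (fun w => n%:R^-1 * \sum_(i < n)
  (m%:R^-1 * \sum_(j < m) eta (X i w, Y j w)) ^+ 2).
Proof.
apply: (bavg n (F := fun i w => (m%:R^-1 * \sum_(j < m) eta (X i w, Y j w)) ^+ 2)) => i.
by apply: bmX; exact: (bavg m (F := fun j w => eta (X i w, Y j w))).
Qed.

Let bsqr2 : bm (fun w => m%:R^-1 * \sum_(j < m)
  (n%:R^-1 * \sum_(i < n) eta (X i w, Y j w)) ^+ 2).
Proof.
apply: (bavg m (F := fun j w => (n%:R^-1 * \sum_(i < n) eta (X i w, Y j w)) ^+ 2)) => j.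
by apply: bmX; exact: (bavg n (F := fun i w => eta (X i w, Y j w))).
Qed.

Lemma bm_sample_sqr_defect : bm sample_sqr_defect.
Proof. by rewrite (funext sample_sqr_defectE); exact: bmD. Qed.

Lemma sample_sqr_defect_ge0 w : 0 <= sample_sqr_defect w.
Proof. by apply: addr_ge0; apply: Rintegral_ge0 => x _; exact: sqr_ge0. Qed.

Section moments.
Variable B : R.
Hypothesis xiB : forall z, `|1 - gibbs c f g z| <= B.

Lemma moment_sample_defect :
  \int[Pr]_w sample_defect w ^+ 2 <= B ^+ 2 / (n%:R * m%:R).
Proof.
rewrite (funext sample_defectE).
exact: (moment_sqr_avg lawX lawY iZ beta xiB).
Qed.

Lemma moment_sample_sqr_defect :
  \int[Pr]_w sample_sqr_defect w <= B ^+ 2 * (n%:R^-1 + m%:R^-1).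
Proof.
rewrite (funext sample_sqr_defectE) bm_RintegralD// mulrDr addrC.
apply: lerD.
  exact: (moment_avg_sqr_avg_x lawX lawY iZ beta xiB).
exact: (moment_avg_sqr_avg_y lawX lawY iZ beta xiB).
Qed.

End moments.

Variables (f' g' : W -> T -> R).
Hypothesis fg' : forall w, schrodinger c (Pn w) (Qm w) (f' w) (g' w).
Hypotheses (fM' : forall w x, `|f' w x| <= 3 * M) (gM' : forall w y, `|g' w y| <= 3 * M).

Let bf' w : bm (f' w). Proof. by case: (fg' w). Qed.
Let bg' w : bm (g' w). Proof. by case: (fg' w). Qed.

Lemma cost_remainder w :
  `|\int[Pn w]_x f' w x + \int[Qm w]_y g' w y -
    (\int[Pn w]_x f x + \int[Qm w]_y g y) - sample_defect w| <=
  sample_sqr_defect w / (4 * kap).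
Proof.
have := dual_gap_bound bc cM bf bg fM gM (fM' w) (gM' w) (fg' w).
rewrite !bm_RintegralB// -/(sample_defect w) -/(sample_sqr_defect w).
have -> (p q r s : R) : p - q + (r - s) = p + r - (q + s) by ring.
by case/andP => h1 h2; rewrite ger0_norm.
Qed.

(** Variances ignore the shift [s] of [potential_perturbation], so L^2 closeness modulo constants is
    enough. *)
Lemma var_f_remainder w e : 0 < e ->
  `|var (Pn w) (f' w) - var (Pn w) f| <= 4 * (3 * M) * e +
    (4 * (3 * M) / e + 1) * (sample_sqr_defect w / (4 * kap ^+ 2)).
Proof.
move=> e0; have M0 : 0 <= 3 * M := le_trans (normr_ge0 _) (fM point).
have [s [us _]] := potential_perturbation bc cM bf bg fM gM (fM' w) (gM' w) (fg' w).
pose u x := f' w x - f x + s.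
have bu : bm u by apply: bmD; [exact: bmB|exact: bm_cst].
rewrite -(var_shift (Pn w) s (bf' w)).
have -> : (fun x => f' w x + s) = (fun x => f x + u x).
  by apply/funext => x; rewrite /u; ring.
apply: (le_trans (var_perturbation (Pn w) bf bu fM e0)).
rewrite lerD2l; apply: ler_wpM2l; last exact: us.
by apply: addr_ge0 => //; apply: divr_ge0; [exact: mulr_ge0|exact: ltW].
Qed.

Lemma var_g_remainder w e : 0 < e ->
  `|var (Qm w) (g' w) - var (Qm w) g| <= 4 * (3 * M) * e +
    (4 * (3 * M) / e + 1) * (sample_sqr_defect w / (4 * kap ^+ 2)).
Proof.
move=> e0; have M0 : 0 <= 3 * M := le_trans (normr_ge0 _) (fM point).
have [s [_ us]] := potential_perturbation bc cM bf bg fM gM (fM' w) (gM' w) (fg' w).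
pose u y := g' w y - g y - s.
have bu : bm u by apply: bm_center; exact: bmB.
rewrite -(var_shift (Qm w) (- s) (bg' w)).
have -> : (fun x => g' w x - s) = (fun x => g x + u x).
  by apply/funext => x; rewrite /u; ring.
apply: (le_trans (var_perturbation (Qm w) bg bu gM e0)).
rewrite lerD2l; apply: ler_wpM2l; last exact: us.
by apply: addr_ge0 => //; apply: divr_ge0; [exact: mulr_ge0|exact: ltW].
Qed.

End sample_remainder.

(** * Asymptotics *)

(** The inverse is discontinuous at 0; it is rewritten as exp(- ln) with value 0 there, in agreement
    with the convention 0^-1 = 0. *)
Lemma measurable_rsqrt d (W : measurableType d) (R : realType) (u : W -> R) :
  measurable_fun setT u -> measurable_fun setT (fun w => (Num.sqrt (u w))^-1).
Proof.
move=> mu.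
have -> : (fun w => (Num.sqrt (u w))^-1) =
    (fun x : R => if x <= 0 then 0 else expR (- ln x)) \o (fun w => Num.sqrt (u w)).
  apply/funext => w /=; have [s0|s0] := leP (Num.sqrt (u w)) 0; last first.
    by rewrite expRN lnK// posrE.
  by have /eqP -> : Num.sqrt (u w) == 0; rewrite ?invr0// eq_le s0 sqrtr_ge0.
apply: measurableT_comp.
  apply: measurable_fun_ifT => //.
    by apply: (measurable_fun_ler (f := fun x : R => x) (g := fun=> 0)).
  apply: measurableT_comp => //; apply: measurableT_comp => //; exact: measurable_ln.
apply: measurableT_comp => //.
by apply: continuous_measurable_fun; exact: sqrt_continuous.
Qed.

Lemma cvg_natV (R : realType) (n : nat -> nat) :
  n k @[k --> \oo] --> \oo -> (n k)%:R^-1 @[k --> \oo] --> (0 : R).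
Proof.
move=> /cvgnyPge noo; apply/cvgr0Pnorm_lt => e e0.
move: (noo (Num.truncn e^-1).+1); apply: filterS => k nk.
have nk0 : 0 < (n k)%:R :> R by rewrite ltr0n (leq_trans _ nk).
rewrite ger0_norm ?invr_ge0 ?ltW// invf_plt ?posrE//.
apply: (lt_le_trans (truncnS_gt e^-1)).
by rewrite ler_nat.
Qed.

Lemma squeeze0 (R : realType) (u v : nat -> R) : (forall k, 0 <= u k <= v k) ->
  v k @[k --> \oo] --> 0 -> u k @[k --> \oo] --> 0.
Proof.
move=> uv v0; apply: (squeeze_cvgr _ (cvg_cst 0) v0).
exact: nearW.
Qed.

Section asymptotics.
Context d (W : measurableType d) (R : realType) (Pr : probability W R).
Context d' (T : measurableType d') (Z : nat + nat -> W -> T).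
Variables P Q : probability T R.
Hypothesis lawX : forall i, has_law Pr (Z (inl i)) P.
Hypothesis lawY : forall j, has_law Pr (Z (inr j)) Q.
Hypothesis iZ : mutually_independent Pr Z.
Variables (c : T * T -> R) (M : R).
Hypotheses (bc : bm c) (cM : forall z, `|c z| <= M).
Variables f g : T -> R.
Hypothesis fg : schrodinger c P Q f g.
Hypotheses (fM : forall x, `|f x| <= 3 * M) (gM : forall y, `|g y| <= 3 * M).
Variables (n m : nat -> nat).
Hypotheses (n_gt0 : forall k, (0 < n k)%N) (m_gt0 : forall k, (0 < m k)%N).
Hypotheses (n_oo : n k @[k --> \oo] --> \oo) (m_oo : m k @[k --> \oo] --> \oo).

Let X (i : nat) := Z (inl i).
Let Y (j : nat) := Z (inr j).
Local Notation Pn k w := (empirical (n_gt0 k) (fun i => X i w) : probability T R).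
Local Notation Qm k w := (empirical (m_gt0 k) (fun j => Y j w) : probability T R).

Variables f' g' : nat -> W -> T -> R.
Hypothesis fg' : forall k w, schrodinger c (Pn k w) (Qm k w) (f' k w) (g' k w).
Hypotheses (fM' : forall k w x, `|f' k w x| <= 3 * M).
Hypotheses (gM' : forall k w y, `|g' k w y| <= 3 * M).

Let bf : bm f. Proof. by case: fg. Qed.
Let bg : bm g. Proof. by case: fg. Qed.
Let M0 : 0 <= 3 * M. Proof. exact: le_trans (normr_ge0 _) (fM point). Qed.
Let kap0 : 0 < convexity_modulus M. Proof. exact: convexity_modulus_gt0 cM. Qed.

Let rate k : R := (n k)%:R^-1 + (m k)%:R^-1.
Let n0 k : 0 < (n k)%:R :> R. Proof. by rewrite ltr0n. Qed.
Let m0 k : 0 < (m k)%:R :> R. Proof. by rewrite ltr0n. Qed.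
Let rate0 k : 0 < rate k. Proof. by rewrite addr_gt0// invr_gt0. Qed.

Let rate_cvg : rate k @[k --> \oo] --> 0.
Proof. by rewrite -(addr0 0); apply: cvgD; exact: cvg_natV. Qed.

Let sqrt_rate_cvg : Num.sqrt (rate k) @[k --> \oo] --> 0.
Proof.
rewrite -(sqrtr0 R); apply: cvg_comp rate_cvg _.
exact: sqrt_continuous.
Qed.

Let scaled_cvg0 (u : nat -> R) (v : nat -> R) C : (forall k, 0 <= u k <= C * v k) ->
  v k @[k --> \oo] --> 0 -> u k @[k --> \oo] --> 0.
Proof.
move=> uv v0; apply: squeeze0 uv _; rewrite -(mulr0 C).
by apply: cvgM => //; exact: cvg_cst.
Qed.

Local Notation defect k := (sample_defect Z c f g (n_gt0 k) (m_gt0 k)).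
Local Notation sqr_defect k := (sample_sqr_defect Z c f g (n_gt0 k) (m_gt0 k)).

Let bdefect k : bm (defect k).
Proof. exact: (bm_sample_defect lawX lawY bc fg). Qed.
Let bsqr k : bm (sqr_defect k).
Proof. exact: (bm_sample_sqr_defect lawX lawY bc fg). Qed.
Let sqr0 k w : 0 <= sqr_defect k w.
Proof. exact: sample_sqr_defect_ge0. Qed.

Let moments : exists C, 0 <= C /\ forall k,
  \int[Pr]_w sqr_defect k w <= C * rate k /\
  \int[Pr]_w defect k w ^+ 2 <= C * rate k ^+ 2.
Proof.
have [_ [B etaB]] : bm (fun z => 1 - gibbs c f g z).
  by apply: bmB; [exact: bm_cst|exact: bm_gibbs].
exists (B ^+ 2); split => [|k]; first exact: sqr_ge0.
split; first exact: (moment_sample_sqr_defect lawX lawY iZ bc cM fg).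
apply: (le_trans (moment_sample_defect lawX lawY iZ bc cM fg _ _ etaB)).
rewrite ler_wpM2l ?sqr_ge0// invfM /rate sqrrD.
have : 0 <= (n k)%:R ^- 2 :> R by rewrite invr_ge0 sqr_ge0.
have : 0 <= (m k)%:R ^- 2 :> R by rewrite invr_ge0 sqr_ge0.
have : 0 <= (n k)%:R^-1 * (m k)%:R^-1 :> R by rewrite mulr_ge0// invr_ge0 ltW.
rewrite !exprVn; move: (_ * _) (_ ^- 2) (_ ^- 2) => p q r; lra.
Qed.

Let var_remainder_vanishes (u : nat -> W -> R) :
  (forall k w e, 0 < e -> `|u k w| <= 4 * (3 * M) * e + (4 * (3 * M) / e + 1) *
     (sqr_defect k w / (4 * convexity_modulus M ^+ 2))) ->
  vanishes Pr u.
Proof.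
(* First [a] is chosen to keep the linear term below e/2; with [a] fixed, the other term has mean of
   order [rate]. *)
move=> uP e e0; pose a := e / 2 / (4 * (3 * M) + 1).
have c0 : 0 < 4 * (3 * M) + 1 by rewrite ltr_wpDl// mulr_ge0.
have a0 : 0 < a by rewrite !divr_gt0.
have aE : 4 * (3 * M) * a <= e / 2.
  rewrite /a mulrCA ler_piMr// ?divr_ge0 ?ltW// ltr_pdivrMr// mul1r.
  by rewrite ltrDl.
pose C := (4 * (3 * M) / a + 1) / (4 * convexity_modulus M ^+ 2).
have C0 : 0 <= C.
  apply: divr_ge0; last by rewrite mulr_ge0// sqr_ge0.
  by apply: addr_ge0 => //; apply: divr_ge0; [exact: mulr_ge0|exact: ltW].
have bC k : bm (fun w => C * sqr_defect k w) by apply: bmM => //; exact: bm_cst.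
have C1 k w : 0 <= C * sqr_defect k w by exact: mulr_ge0.
have [K [K0 KP]] := moments.
have cC : \int[Pr]_w (C * sqr_defect k w) @[k --> \oo] --> 0.
  apply: (@scaled_cvg0 _ rate (C * K)) => // k.
  rewrite bm_RintegralZl// -mulrA ler_wpM2l ?(KP k).1//.
  by rewrite mulr_ge0//; apply: Rintegral_ge0 => w _; exact: sqr0.
have e2 : 0 < e / 2 by rewrite divr_gt0.
apply: whpS (whp_markov bC C1 cC e2) => k w h.
apply: (le_lt_trans (uP k w a a0)); rewrite [ltRHS]splitr.
apply: ler_ltD => //; apply: le_lt_trans h.
by rewrite /C le_eqVlt; apply/orP; left; rewrite [eqbRHS]mulrAC -[eqbRHS]mulrA.
Qed.

Let var_avg_vanishes (S : probability T R) h (U : nat -> W -> T) (N : nat -> nat)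
    (N_gt0 : forall k, (0 < N k)%N) : bm h -> (forall x, `|h x| <= 3 * M) ->
  (forall i, measurable_fun setT (U i)) -> N k @[k --> \oo] --> \oo ->
  (forall k (l : T -> R) B, bm l -> (forall x, `|l x| <= B) ->
    \int[Pr]_w ((N k)%:R^-1 * \sum_(i < N k) l (U i w) - \int[S]_x l x) ^+ 2 <=
    (2 * B) ^+ 2 / (N k)%:R) ->
  vanishes Pr (fun k w =>
    var (empirical (N_gt0 k) (fun i => U i w) : probability T R) h - var S h).
Proof.
move=> bh hM mU Noo lln.
pose avg l k w := (N k)%:R^-1 * \sum_(i < N k) l (U i w) - \int[S]_x l x.
have van l B : bm l -> (forall x, `|l x| <= B) -> vanishes Pr (avg l).
  move=> bl lB; apply: L2_vanishes => [k|].
    apply: bm_center; apply: bmM; first exact: bm_cst.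
    by apply: bm_sum => i; exact: (bm_comp bl).
  apply: (@scaled_cvg0 _ (fun k => (N k)%:R^-1) ((2 * B) ^+ 2)) => [k|]; last exact: cvg_natV.
  rewrite lln// andbT; apply: Rintegral_ge0 => w _; exact: sqr_ge0.
have h2M x : `|h x ^+ 2| <= (3 * M) ^+ 2 by rewrite normrX lerXn2r ?nnegrE.
have v2 := van _ _ (bmX 2 bh) h2M.
(* With p and r the empirical and true means, this is r^2 - p^2 = -(p - r)(p + r), where |p + r| is
   at most 6 M. *)
have v1 : vanishes Pr (fun k w => avg h k w * (- (avg h k w + 2 * \int[S]_x h x))).
  apply: vanishes_le (vanishesZ (6 * M) (van _ _ bh hM)) => k w.
  rewrite normrM normrN mulrC [leRHS]normrM ler_wpM2r//.
  have IM : `|\int[S]_x h x| <= 3 * M by exact: bm_norm_Rintegral_le.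
  have AM : `|(N k)%:R^-1 * \sum_(i < N k) h (U i w)| <= 3 * M.
    rewrite -(Rintegral_empirical (N_gt0 k) (fun i => U i w) bh).
    exact: bm_norm_Rintegral_le.
  rewrite (le_trans _ (ler_norm _))// /avg; move: IM AM.
  by move: (\int[S]_x h x) (_ * \sum_(i < N k) _) => p q; rewrite !ler_norml; lra.
apply: vanishes_le (vanishesD v2 v1) => k w.
rewrite !var_eq// !Rintegral_empirical//; last exact: bmX.
rewrite /avg; move: (_ * \sum_(i < N k) h (U i w) ^+ 2) (_ * \sum_(i < N k) h (U i w)) => p q.
move: (\int[S]_x _) (\int[S]_x _) => r s.
by rewrite le_eqVlt; apply/orP; left; apply/eqP; congr `|_|; ring.
Qed.

Lemma var_f_vanishes : vanishes Pr (fun k w => var (Pn k w) (f' k w) - var P f).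
Proof.
have v1 : vanishes Pr (fun k w => var (Pn k w) (f' k w) - var (Pn k w) f).
  apply: var_remainder_vanishes => k w e.
  exact: (var_f_remainder bc cM fg fM gM (fg' k) (fM' k) (gM' k)).
have v2 : vanishes Pr (fun k w => var (Pn k w) f - var P f).
  apply: var_avg_vanishes => // [i|k l B bl lB]; first by case: (lawX i).
  exact: (lln_x lawX lawY iZ bl lB).
by apply: vanishes_le (vanishesD v1 v2) => k w; rewrite addrA subrK.
Qed.

Lemma var_g_vanishes : vanishes Pr (fun k w => var (Qm k w) (g' k w) - var Q g).
Proof.
have v1 : vanishes Pr (fun k w => var (Qm k w) (g' k w) - var (Qm k w) g).
  apply: var_remainder_vanishes => k w e.
  exact: (var_g_remainder bc cM fg fM gM (fg' k) (fM' k) (gM' k)).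
have v2 : vanishes Pr (fun k w => var (Qm k w) g - var Q g).
  apply: var_avg_vanishes => // [i|k l B bl lB]; first by case: (lawY i).
  exact: (lln_y lawX lawY iZ bl lB).
by apply: vanishes_le (vanishesD v1 v2) => k w; rewrite addrA subrK.
Qed.

Definition scale k : R := Num.sqrt ((n k * m k)%:R / (n k + m k)%:R).

Let scaleE k : scale k = (Num.sqrt (rate k))^-1.
Proof.
rewrite /scale -sqrtrV ?ltW//; congr Num.sqrt.
by rewrite /rate natrM natrD; field; rewrite !gt_eqF// addr_gt0.
Qed.

Let scale_ge0 k : 0 <= scale k. Proof. exact: sqrtr_ge0. Qed.

Let scale2 k : scale k ^+ 2 = (rate k)^-1.
Proof. by rewrite scaleE exprVn sqr_sqrtr// ltW. Qed.

Let scale_rate k : scale k * rate k = Num.sqrt (rate k).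
Proof.
rewrite scaleE -{2}(sqr_sqrtr (ltW (rate0 k))) expr2 mulKf// gt_eqF//.
by rewrite sqrtr_gt0.
Qed.

Local Notation linear k := (centered_average_sum Z P Q f g (n k) (m k)).

Let blinear k : bm (linear k).
Proof.
apply: bmD; apply: bm_center; apply: bmM; try exact: bm_cst.
  by apply: bm_sum => i; apply: (bm_comp bf); case: (lawX i).
by apply: bm_sum => i; apply: (bm_comp bg); case: (lawY i).
Qed.

(** Provides tightness of the scaled linear part, which is later multiplied by the vanishing error
    of the denominator. *)
Lemma moment_linear k :
  \int[Pr]_w (scale k * linear k w) ^+ 2 <= 2 * (6 * M) ^+ 2.
Proof.
under eq_Rintegral do rewrite exprMn.
rewrite bm_RintegralZl; last exact: bmX.
rewrite scale2 mulrC ler_pdivrMr//.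
pose a w := (n k)%:R^-1 * \sum_(i < n k) f (X i w) - \int[P]_x f x.
pose b w := (m k)%:R^-1 * \sum_(i < m k) g (Y i w) - \int[Q]_x g x.
have ba : bm a.
  apply: bm_center; apply: bmM; first exact: bm_cst.
  by apply: bm_sum => i; apply: (bm_comp bf); case: (lawX i).
have bb : bm b.
  apply: bm_center; apply: bmM; first exact: bm_cst.
  by apply: bm_sum => i; apply: (bm_comp bg); case: (lawY i).
have ha := lln_x lawX lawY iZ bf fM (n_gt0 k).
have hb := lln_y lawX lawY iZ bg gM (m_gt0 k).
have b2 l : bm l -> bm (fun w => 2 * l w ^+ 2).
  by move=> ?; apply: bmM; [exact: bm_cst|exact: bmX].
apply: (@le_trans _ _ (\int[Pr]_w (2 * a w ^+ 2 + 2 * b w ^+ 2))).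
  apply: bm_le_Rintegral; [exact: bmX|by apply: bmD; exact: b2|] => w.
  rewrite -[centered_average_sum _ _ _ _ _ _ _ _]/(a w + b w).
  rewrite -subr_ge0 (_ : _ - _ = (a w - b w) ^+ 2); first exact: sqr_ge0.
  by move: (a w) (b w) => p q; ring.
rewrite bm_RintegralD; [|exact: b2..].
rewrite !bm_RintegralZl; [|exact: bmX..].
move: ha hb; rewrite /rate.
have -> : 2 * (3 * M) = 6 * M by ring.
move: (Rintegral _ _ _) (Rintegral _ _ _) => p q.
rewrite mulrDr -!mulrA; move: (_ * (n k)%:R^-1) (_ * (m k)%:R^-1) => r s; lra.
Qed.

Lemma remainder_vanishes :
  vanishes Pr (fun k w => scale k *
    (\int[Pn k w]_x f' k w x + \int[Qm k w]_y g' k w y -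
     (\int[P]_x f x + \int[Q]_y g y) - linear k w)).
Proof.
have [C [C0 CP]] := moments.
(* Degeneracy matters here: the second moment C rate^2, multiplied by [scale k ^+ 2] = 1/rate, still
   tends to 0. *)
have v1 : vanishes Pr (fun k w => scale k * defect k w).
  apply: L2_vanishes => [k|]; first by apply: bmM => //; exact: bm_cst.
  apply: (@scaled_cvg0 _ rate C) => // k.
  under eq_Rintegral do rewrite exprMn.
  rewrite bm_RintegralZl; last exact: bmX.
  apply/andP; split.
    by rewrite mulr_ge0 ?sqr_ge0//; apply: Rintegral_ge0 => w _; exact: sqr_ge0.
  rewrite scale2 mulrC ler_pdivrMr// -mulrA -expr2; exact: (CP k).2.
pose rem k w := \int[Pn k w]_x f' k w x + \int[Qm k w]_y g' k w y -
    (\int[Pn k w]_x f x + \int[Qm k w]_y g y) - defect k w.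
have v2 : vanishes Pr (fun k w => scale k * rem k w).
  pose kap := convexity_modulus M.
  have k40 : 0 < 4 * kap by rewrite mulr_gt0.
  apply: (@L1_vanishes _ _ _ _ _
    (fun k w => scale k / (4 * kap) * sqr_defect k w)) => [k w|k|].
  - rewrite normrM ger0_norm// -mulrA ler_wpM2l// mulrC.
    exact: (cost_remainder bc cM fg fM gM (fg' k) (fM' k) (gM' k)).
  - by apply: bmM => //; exact: bm_cst.
  - apply: (@scaled_cvg0 _ (fun k => Num.sqrt (rate k)) (C / (4 * kap))) => // k.
    rewrite bm_RintegralZl//; apply/andP; split.
      apply: mulr_ge0; first by rewrite divr_ge0// ltW.
      by apply: Rintegral_ge0 => w _; exact: sqr0.
    rewrite -scale_rate; apply: (@le_trans _ _ (scale k / (4 * kap) * (C * rate k))).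
      by rewrite ler_wpM2l ?(CP k).1// divr_ge0// ltW.
    rewrite le_eqVlt; apply/orP; left; apply/eqP.
    by move: (scale k) (rate k) (4 * kap)^-1 => p q r; ring.
apply: vanishes_le (vanishesD v1 v2) => k w.
rewrite /rem /centered_average_sum !(Rintegral_empirical _ _ bf) !(Rintegral_empirical _ _ bg).
move: (\int[Pn k w]_x _) (\int[Qm k w]_x _) (defect k w) => p q r.
move: (_ * \sum_(i < n k) _) (_ * \sum_(i < m k) _) (\int[P]_x _) (\int[Q]_x _) => s t u v.
by rewrite le_eqVlt; apply/orP; left; apply/eqP; congr `|_|; ring.
Qed.

Definition linear_variance k : R :=
  (m k)%:R / (n k + m k)%:R * var P f + (n k)%:R / (n k + m k)%:R * var Q g.

(** Normalizing by the variance at stage k, not by its limit, makes the comparison law exactly N(0,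
    1) as soon as this variance is at least [s0]; the Lindeberg error is then at most C
    rate^(1/2). *)
Lemma linear_clt s0 h : 0 < s0 -> (\forall k \near \oo, s0 <= linear_variance k) ->
  smooth h ->
  \int[Pr]_w h (scale k * linear k w / Num.sqrt (linear_variance k)) @[k --> \oo] -->
  \int[std_normal R]_x h x.
Proof.
move=> s00 near_s0 [a [b [K hT]]].
pose s k := scale k / Num.sqrt (linear_variance k).
have s_ge0 k : 0 <= s k by rewrite divr_ge0// sqrtr_ge0.
have s2 k : 0 < linear_variance k ->
    s k ^+ 2 * (var P f / (n k)%:R + var Q g / (m k)%:R) = 1.
  move=> V0.
  have VE : linear_variance k =
      (rate k)^-1 * (var P f / (n k)%:R + var Q g / (m k)%:R).
    rewrite /linear_variance /rate natrD.
    move: (n k)%:R (m k)%:R (n0 k) (m0 k) => p q p0 q0.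
    by field; rewrite !gt_eqF// addr_gt0.
  rewrite /s exprMn scale2 exprVn sqr_sqrtr ?ltW// mulrAC -VE divff//.
  by rewrite gt_eqF.
have NE : normal_shift 1 h 0 = \int[std_normal R]_x h x.
  by apply: eq_Rintegral => z _; rewrite add0r mul1r.
pose C := K * (1 + normal_abs_moment3 R) * ((2 * (3 * M)) ^+ 3 / Num.sqrt s0 ^+ 3).
have C0 : 0 <= K * (1 + normal_abs_moment3 R).
  by rewrite mulr_ge0 ?(taylor3_ge0 hT)// addr_ge0// normal_abs_moment3_ge0.
have bound k : s0 <= linear_variance k ->
    `|\int[Pr]_w h (scale k * linear k w / Num.sqrt (linear_variance k)) -
    \int[std_normal R]_x h x| <= C * Num.sqrt (rate k).
  move=> s0V; have V0 : 0 < linear_variance k by exact: lt_le_trans s0V.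
  have := sample_lindeberg lawX lawY iZ bf bg fM gM (s_ge0 k) (n_gt0 k) (m_gt0 k) hT.
  rewrite s2// sqrtr1 NE.
  under eq_Rintegral do rewrite /s mulrAC.
  move/le_trans; apply; rewrite /C -[leRHS]mulrA ler_wpM2l//.
  rewrite exprMn -[leLHS]mulrA -[leRHS]mulrA.
  apply: ler_wpM2l; first by rewrite exprn_ge0// mulr_ge0.
  have rate2 : (n k)%:R ^- 2 + (m k)%:R ^- 2 <= rate k ^+ 2.
    rewrite /rate sqrrD -!exprVn.
    have : 0 <= (n k)%:R^-1 * (m k)%:R^-1 :> R by rewrite mulr_ge0// invr_ge0 ltW.
    move: (_ * _) (_ ^+ 2) (_ ^+ 2) => p q r; lra.
  apply: (@le_trans _ _ (s k ^+ 3 * rate k ^+ 2)).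
    by apply: ler_wpM2l => //; exact: exprn_ge0.
  have -> : s k ^+ 3 * rate k ^+ 2 =
      (Num.sqrt (linear_variance k)) ^- 3 * Num.sqrt (rate k).
    rewrite /s exprMn exprVn mulrAC mulrC; congr (_ * _).
    rewrite exprSr scale2 -mulrA mulrC expr2 -scale_rate.
    by move: (scale k) (rate k) (rate0 k) => p q q0; field; rewrite gt_eqF.
  rewrite ler_wpM2r ?sqrtr_ge0// lef_pV2 ?posrE ?exprn_gt0 ?sqrtr_gt0//.
  apply: lerXn2r; rewrite ?nnegrE ?sqrtr_ge0//.
  exact: ler_wsqrtr.
have C_cvg : C * Num.sqrt (rate k) @[k --> \oo] --> 0.
  by rewrite -(mulr0 C); apply: cvgM => //; exact: cvg_cst.
apply/cvgrPdist_lt => e e0; move/cvgr_lt : C_cvg => /(_ _ e0).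
apply: filterS2 near_s0 => k /bound h1 h2.
by rewrite distrC; exact: le_lt_trans h1 h2.
Qed.

Variable lambda : R.
Hypothesis lambda_cvg : (m k)%:R / (n k + m k)%:R @[k --> \oo] --> lambda.

Let alpha k : R := (m k)%:R / (n k + m k)%:R.
Let beta k : R := (n k)%:R / (n k + m k)%:R.

Let betaE k : beta k = 1 - alpha k.
Proof.
rewrite /alpha /beta natrD; move: (n k)%:R (m k)%:R (n0 k) (m0 k) => p q p0 q0.
by field; rewrite gt_eqF// addr_gt0.
Qed.

Let alpha01 k : 0 <= alpha k <= 1.
Proof.
have : 0 <= beta k by rewrite divr_ge0.
by rewrite betaE subr_ge0 => ->; rewrite divr_ge0.
Qed.

Let v := lambda * var P f + (1 - lambda) * var Q g.

Let linear_variance_cvg : linear_variance k @[k --> \oo] --> v.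
Proof.
have -> : linear_variance = (fun k => alpha k * var P f + (1 - alpha k) * var Q g).
  by apply/funext => k; rewrite -betaE.
apply: cvgD; apply: cvgM; [exact: lambda_cvg|exact: cvg_cst| |exact: cvg_cst].
by apply: cvgB; [exact: cvg_cst|exact: lambda_cvg].
Qed.

Definition sample_variance k w : R :=
  alpha k * var (Pn k w) (f' k w) + beta k * var (Qm k w) (g' k w).

Lemma sample_variance_vanishes : vanishes Pr (fun k w => sample_variance k w - v).
Proof.
have v0 : vanishes Pr (fun k _ => linear_variance k - v).
  by apply: cvg_vanishes; rewrite -(subrr v); apply: cvgB => //; exact: cvg_cst.
have bounded (r : nat -> R) (u : nat -> W -> R) : (forall k, 0 <= r k <= 1) ->
    vanishes Pr u -> vanishes Pr (fun k w => r k * u k w).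
  move=> r01; apply: vanishes_le => k w; have /andP[r0 r1] := r01 k.
  by rewrite normrM ger0_norm// ler_piMl.
have b01 k : 0 <= beta k <= 1 by rewrite betaE; have := alpha01 k; lra.
apply: vanishes_le (vanishesD (vanishesD (bounded _ _ alpha01 var_f_vanishes)
  (bounded _ _ b01 var_g_vanishes)) v0) => k w.
rewrite /sample_variance /linear_variance -/(alpha k) -/(beta k).
move: (alpha k) (beta k) (var _ (f' k w)) (var _ (g' k w)) (var P f) (var Q g) v.
by move=> a b p q r s t; rewrite le_eqVlt; apply/orP; left; apply/eqP; congr `|_|; ring.
Qed.

Hypothesis v_gt0 : 0 < v.

Local Notation rsqrt x := (Num.sqrt x)^-1.

Let rsqrt_continuous : {for v, continuous (fun x : R => rsqrt x)}.
Proof.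
apply: (@cvgV _ _ _ _ (fun x : R => Num.sqrt x)); first by rewrite gt_eqF// sqrtr_gt0.
exact: sqrt_continuous.
Qed.

Definition cost_gap k w := \int[Pn k w]_x f' k w x + \int[Qm k w]_y g' k w y -
  (\int[P]_x f x + \int[Q]_y g y).

Lemma studentized_vanishes : vanishes Pr (fun k w =>
  scale k * (cost_gap k w / Num.sqrt (sample_variance k w)) -
  scale k * linear k w / Num.sqrt (linear_variance k)).
Proof.
have r1 := vanishes_continuous rsqrt_continuous sample_variance_vanishes.
have v0 : vanishes Pr (fun k _ => linear_variance k - v).
  by apply: cvg_vanishes; rewrite -(subrr v); apply: cvgB => //; exact: cvg_cst.
have r2 := vanishesZ (-1) (vanishes_continuous rsqrt_continuous v0).
have bN k : bm (fun w => scale k * linear k w) by apply: bmM => //; exact: bm_cst.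
(* Let r and s be the inverse roots of the sample and linear variances, t that of their limit, E the
   scaled remainder and L the scaled linear part. The difference is E (r - t) + t E + L ((r - t) -
   (s - t)). *)
have t1 := vanishesM remainder_vanishes r1.
have t2 := vanishesZ (rsqrt v) remainder_vanishes.
have t3 := vanishesM_bounded_moment bN moment_linear (vanishesD r1 r2).
apply: vanishes_le (vanishesD (vanishesD t1 t2) t3) => k w.
rewrite -/(cost_gap k w).
move: (rsqrt (sample_variance k w)) (rsqrt (linear_variance k)) (rsqrt v).
move: (scale k) (linear k w) (cost_gap k w) => p q r s t u'.
by rewrite le_eqVlt; apply/orP; left; apply/eqP; congr `|_|; ring.
Qed.

Lemma studentized_clt :
  (forall k, measurable_fun setT (cost_gap k)) ->
  (forall k, measurable_fun setT (sample_variance k)) ->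
  cvg_in_distribution Pr (fun k w =>
    scale k * (cost_gap k w / Num.sqrt (sample_variance k w))) (normal_prob 0 1).
Proof.
move=> mcost mvar.
pose lin k w := scale k * linear k w / Num.sqrt (linear_variance k).
have mlin k : measurable_fun setT (lin k).
  by apply: measurable_funM => //; apply: measurable_funM => //; case: (blinear k).
have mstud k : measurable_fun setT (fun w =>
    scale k * (cost_gap k w / Num.sqrt (sample_variance k w))).
  apply: measurable_funM => //; apply: measurable_funM => //.
  exact: measurable_rsqrt.
have v2 : 0 < v / 2 by rewrite divr_gt0.
have near_v2 : \forall k \near \oo, v / 2 <= linear_variance k.
  have : v / 2 < v by rewrite ltr_pdivrMr// ltr_pMr// ltr1n.
  by move/cvgr_ge : linear_variance_cvg; apply.
apply: smooth_cvg_in_distribution => // h sh.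
apply: (smooth_slutsky mlin mstud _ sh); last exact: linear_clt near_v2 sh.
apply: vanishes_cvg studentized_vanishes => k.
exact: (measurable_funB (mstud k) (mlin k)).
Qed.

End asymptotics.

(** * Consistency of the variance estimator and the studentized limit theorem *)

Theorem proposition3p4 (R : realType) (Omega : ptopologicalType)
    (polish_Omega : polish_space R Omega)
    (c : borel Omega * borel Omega -> R)
    (measurable_c : measurable_fun setT c) (bounded_c : bounded_fun c)
    (P Q : probability (borel Omega) R)
    (d : measure_display) (W : measurableType d) (Pr : probability W R)
    (X Y : nat -> W -> borel Omega)
    (X_law : forall i, has_law Pr (X i) P)
    (Y_law : forall j, has_law Pr (Y j) Q)
    (XY_indep : mutually_independent Pr
       (fun i : nat + nat => match i with inl i => X i | inr j => Y j end))
    (n m : nat -> nat)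
    (n_gt0 : forall k, (0 < n k)%N) (m_gt0 : forall k, (0 < m k)%N)
    (n_oo : n k @[k --> \oo] --> \oo) (m_oo : m k @[k --> \oo] --> \oo)
    (lambda : R) (lambda01 : 0 < lambda < 1)
    (ratio_cvg :
       ((m k)%:R / (n k + m k)%:R : R) @[k --> \oo] --> lambda) :
  let Pn k w : probability (borel Omega) R :=
    empirical (n_gt0 k) (fun i => X i w) in
  let Qm k w : probability (borel Omega) R :=
    empirical (m_gt0 k) (fun j => Y j w) in
  let hsigma2 k w : R :=
    empirical_sigma2 c (n_gt0 k) (m_gt0 k) (fun i => X i w) (fun j => Y j w) in
  cvg_in_probability Pr hsigma2 (sigma2 c P Q lambda) /\
  (0 < sigma2 c P Q lambda ->
   cvg_in_distribution Pr
     (fun k w =>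
        Num.sqrt ((n k * m k)%:R / (n k + m k)%:R) *
        ((fine (entropic_cost c (Pn k w) (Qm k w)) -
          fine (entropic_cost c P Q)) / Num.sqrt (hsigma2 k w)))
     (normal_prob 0 1)).
Proof.
move=> Pn Qm hsigma2.
have bc : bm c := bm_bounded_fun measurable_c bounded_c.
have [_ [M cM]] := bc.
have M0 : 0 <= M := le_trans (normr_ge0 _) (cM point).
pose Z (i : nat + nat) := match i with inl i => X i | inr j => Y j end.
have bound P' Q' : (forall x, `|potential_f c P' Q' x| <= 3 * M) /\
    (forall y, `|potential_g c P' Q' y| <= 3 * M).
  have [fg g0] := potentialsP bc cM P' Q'.
  have [fM gM] := schrodinger_bound bc cM fg g0.
  (* The sharper bound 2 M for the second potential is weakened so that both share 3 M. *)
  by split => // y; rewrite (le_trans (gM y))// ler_wpM2r// ler_nat.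
have fg P' Q' := (potentialsP bc cM P' Q').1.
have [fM gM] := bound P Q.
pose f' k w := potential_f c (Pn k w) (Qm k w).
pose g' k w := potential_g c (Pn k w) (Qm k w).
have fg' k w : schrodinger c (Pn k w) (Qm k w) (f' k w) (g' k w) by exact: fg.
have fM' k w := (bound (Pn k w) (Qm k w)).1.
have gM' k w := (bound (Pn k w) (Qm k w)).2.
have varE P' Q' : variance_f c P' Q' = var P' (potential_f c P' Q') /\
    variance_g c P' Q' = var Q' (potential_g c P' Q').
  by have [bf bg _ _] := fg P' Q'; rewrite /variance_f /variance_g !fine_variance.
have hsE k : hsigma2 k = sample_variance Z n_gt0 m_gt0 f' g' k.
  by apply/funext => w; rewrite /hsigma2 /empirical_sigma2 (varE _ _).1 (varE _ _).2.
have sE : sigma2 c P Q lambda = lambda * var P (potential_f c P Q) +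
    (1 - lambda) * var Q (potential_g c P Q).
  by rewrite /sigma2 (varE _ _).1 (varE _ _).2.
have mX i : measurable_fun setT (X i) by case: (X_law i).
have mY j : measurable_fun setT (Y j) by case: (Y_law j).
have mhs k : measurable_fun setT (hsigma2 k).
  rewrite hsE; apply: measurable_funD; apply: measurable_funM => //.
    exact: (measurable_var_empirical_f bc cM mX mY (fg' k)).
  exact: (measurable_var_empirical_g bc cM mX mY (fg' k)).
split.
  split => //; apply: vanishes_cvg => [k|]; first exact: measurable_funB.
  rewrite sE; under eq_fun => k do rewrite hsE.
  exact: (sample_variance_vanishes X_law Y_law XY_indep bc cM (fg P Q) fM gM
    n_oo m_oo fg' fM' gM' ratio_cvg).
rewrite sE => s_gt0.
pose gap := cost_gap Z P Q (potential_f c P Q) (potential_g c P Q) n_gt0 m_gt0 f' g'.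
(* By duality both costs are real numbers, so [fine] never meets an infinite value. *)
have gapE k w :
    fine (entropic_cost c (Pn k w) (Qm k w)) - fine (entropic_cost c P Q) = gap k w.
  by rewrite (entropic_costE bc cM (fg' k w)) (entropic_costE bc cM (fg P Q)).
have mgap k : measurable_fun setT (gap k).
  apply: measurable_funB => //.
  exact: (measurable_cost_empirical bc cM mX mY (fg' k)).
set T := (T in cvg_in_distribution _ T _).
have -> : T = fun k w => scale R n m k *
    (gap k w / Num.sqrt (sample_variance Z n_gt0 m_gt0 f' g' k w)).
  by apply/funext => k; apply/funext => w; rewrite /T gapE hsE.
apply: (studentized_clt X_law Y_law XY_indep bc cM (fg P Q) fM gM
  n_oo m_oo fg' fM' gM' ratio_cvg s_gt0) => // k.
by rewrite -hsE.
Qed.
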